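(* Let $Y$ be a cyclically $4$-edge-connected cubic planar graph with girth at least $4$. Let $H$ be a graph obtained from $Y$ by deleting two adjacent vertices. Let $k \ge 4$ be an even integer. If $H$ has circumference at least $k$, then $H$ has some cycle whose length lies in the interval $[k, 3k/2]$.
   Context: Graphs are finite and simple. A graph $Y$ is cyclically $4$-edge-connected if it is $3$-connected and for every edge-cut $S$ of $Y$ with fewer than $4$ edges, $Y - S$ contains a component without cycles. A graph is cubic if every vertex has degree $3$. A planar graph is one that can be embedded in the plane without edge crossings. The length of a cycle is its number of edges. The girth of a graph is the length of a shortest cycle, and the circumference is the length of a longest cycle. *)

(* Defs.v *)
From HB Require Import structures.
From mathcomp Require Import all_boot all_order all_algebra.
From mathcomp Require Import classical_sets set_interval reals topology normedtype.
Import numFieldNormedType.Exports.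

Set Implicit Arguments.
Unset Strict Implicit.
Unset Printing Implicit Defensive.

Record sgraph := SGraph {
  vertex :> finType;
  adj : rel vertex;
  adj_sym : symmetric adj;
  adj_irrefl : irreflexive adj
}.

Definition edges (G : sgraph) : {set {set G}} :=
  [set [set p.1; p.2] | p : G * G & adj p.1 p.2].

Section Induced.
Variables (G : sgraph) (A : {set G}).
Definition induced_adj : rel {x : G | x \in A} :=
  fun x y => adj (val x) (val y).
Lemma induced_adj_sym : symmetric induced_adj.
Proof. by move=> x y; apply: adj_sym. Qed.
Lemma induced_adj_irrefl : irreflexive induced_adj.
Proof. by move=> x; apply: adj_irrefl. Qed.
Definition induced : sgraph := SGraph induced_adj_sym induced_adj_irrefl.
End Induced.

Definition delete_vertices (G : sgraph) (A : {set G}) : sgraph :=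
  induced (~: A).

Section DeleteEdges.
Variables (G : sgraph) (S : {set {set G}}).
Definition delete_adj : rel G :=
  fun x y => adj x y && ([set x; y] \notin S).
Lemma delete_adj_sym : symmetric delete_adj.
Proof. by move=> x y; rewrite /delete_adj adj_sym finset.setUC. Qed.
Lemma delete_adj_irrefl : irreflexive delete_adj.
Proof. by move=> x; rewrite /delete_adj adj_irrefl. Qed.
Definition delete_edges : sgraph := SGraph delete_adj_sym delete_adj_irrefl.
End DeleteEdges.

(* A cycle is listed by its successive vertices, so its length is [size c];
   the bound excludes the closed walk [:: x; y] along a single edge. *)
Definition is_cycle (G : sgraph) (c : seq G) : Prop :=
  ucycle (@adj G) c /\ 3 <= size c.

Definition acyclic (G : sgraph) : Prop := forall c : seq G, ~ is_cycle c.

Definition is_girth (G : sgraph) (g : nat) : Prop :=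
  (exists2 c : seq G, is_cycle c & size c = g) /\
  (forall c : seq G, is_cycle c -> g <= size c).

Definition is_circumference (G : sgraph) (l : nat) : Prop :=
  (exists2 c : seq G, is_cycle c & size c = l) /\
  (forall c : seq G, is_cycle c -> size c <= l).

Definition cubic (G : sgraph) : Prop :=
  forall x : G, #|[set y | adj x y]| = 3.

Definition connected_graph (G : sgraph) : Prop :=
  0 < #|G| /\ forall x y : G, connect (@adj G) x y.

Definition k_connected (k : nat) (G : sgraph) : Prop :=
  k < #|G| /\
  forall A : {set G}, #|A| < k -> connected_graph (delete_vertices A).

Definition is_component (G : sgraph) (C : {set G}) : Prop :=
  exists x : G, C = [set y | connect (@adj G) x y].

(* The edges with exactly one end in [X], for a nonempty proper [X]. *)
Definition edge_cut (G : sgraph) (S : {set {set G}}) : Prop :=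
  exists X : {set G}, [/\ X != finset.set0, X != [set: G]%SET &
    S = [set e in edges G | #|e :&: X| == 1]].

Definition cyclically_4_edge_connected (G : sgraph) : Prop :=
  k_connected 3 G /\
  forall S : {set {set G}}, edge_cut S -> #|S| < 4 ->
    exists2 C : {set delete_edges S}, is_component C & acyclic (induced C).

Section Planar.
Variable R : realType.
Local Open Scope ring_scope.

(* Vertices are drawn at the points [p x], and the edge [e] along the arc
   traced by [gamma e] on the unit interval. *)
Record is_plane_drawing (G : sgraph)
    (p : G -> R * R) (gamma : {set G} -> R -> R * R) : Prop := {
  drawing_vertices : injective p;
  drawing_continuous : forall e, e \in edges G ->
    {within `[0, 1], continuous (gamma e)}%classic;
  drawing_injective : forall e, e \in edges G ->
    forall s t : R, 0 <= s <= 1 -> 0 <= t <= 1 ->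
    gamma e s = gamma e t -> s = t;
  drawing_ends : forall e, e \in edges G ->
    exists x y : G, [/\ e = [set x; y], gamma e 0 = p x & gamma e 1 = p y];
  drawing_avoids_vertices : forall e, e \in edges G ->
    forall (t : R) (x : G), 0 < t < 1 -> gamma e t <> p x;
  drawing_no_crossing : forall e e', e \in edges G -> e' \in edges G ->
    e != e' -> forall s t : R, 0 < s < 1 -> 0 < t < 1 -> gamma e s <> gamma e' t
}.

Definition planar (G : sgraph) : Prop :=
  exists (p : G -> R * R) (gamma : {set G} -> R -> R * R),
    is_plane_drawing p gamma.

End Planar.

(* Main.v *)
(* A closed polygon has a winding parity around every point off it. Sampling the
   arcs of a plane drawing finely enough gives, for every even edge set z and every
   vertex x, parities that depend additively on z; they colour the three corners at
   x so that exactly the edges of z separate colours. A face is a class of corners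
   that no z distinguishes. This encodes the dual triangulation T: its cycle-space
   dimension count yields Euler's formula, and cyclic 4-edge-connectedness makes
   every triangle of T a corner of Y.

   A cycle of H is the boundary of a bond D of T (D and its complement connected)
   that avoids the set O of the four faces at u and v. Write k = 2K and suppose that
   no such bond has a boundary of length in [2K, 3K]. Removing one face f from a bond
   shortens the boundary by at most |f| - 2, so a minimal bond of length at least 2K
   is one face longer than 3K or contains two faces of length at least K + 4. Call the
   latter faces, outside O, big. Bonds without big faces are thus shorter than 2K, as
   are bonds whose only big face is shorter than 2K; applied to paths in the link of a
   big face and to stars around it, this gives every big face many neighbours in the
   component Q of T[big + O] containing it. If v has d neighbours in Q and t triangles
   in Q, then 12 + t - 3d is at most 0 at big faces and sums to less than 24 over O,
   while Euler's formula makes its sum over Q at least 24. *)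
Require Import Defs.
From mathcomp Require Import all_boot all_order all_algebra.
From mathcomp Require classical_sets set_interval topology normedtype.
From mathcomp Require Import reals boolp.
From Stdlib Require Import Ring.

Set Implicit Arguments.
Unset Strict Implicit.
Unset Printing Implicit Defensive.

(** Faces are never regions of the plane: a drawing enters through one parity identity for disjoint
    polygonal paths. Edges with a common end touch, which ruins that identity, so it is applied to
    half edges, each running from a vertex to the midpoint of its edge; two of them with different
    starts and different edges are disjoint. The gap this leaves at each vertex is closed by a local
    correction, [theta].

    The charge [12 + t - 3 * d] is Euler's formula for T[Q] in disguise. Let T[Q] have n vertices, m
    edges and s triangular faces. Since every triangle of T is a corner of Y, the other faces have
    length at least 4 once Q is not tiny, and Euler's formula turns into [8 + 2 * m - s <= 4 * n].
    Three times this is the bound 24, because d sums to [2 * m] and t to [3 * s]. The margin is a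
    single unit: the charges over O reach at most 23, and the last unit is gained from an edge of
    T[Q] that leaves O. *)

Lemma addb_ring_theory :
  Ring_theory.ring_theory false true addb andb addb id (@eq bool).
Proof. by split=> [[]|[] []|[] [] []|[]|[] []|[] [] []|[] [] []|[] []|[]]. Qed.

Ltac bool_cst t :=
  match t with
  | true => constr:(true)
  | false => constr:(false)
  | _ => constr:(InitialRing.NotConstant)
  end.

Lemma eqb_decision (a b : bool) : (a == b) = true -> a = b.
Proof. by move/eqP. Qed.

Add Ring AddbRing : addb_ring_theory
  (decidable eqb_decision, constants [bool_cst]).

(* Stdlib's [ring]; algebra-tactics rebinds the name below. *)
Ltac boolring := ring.

(** Linear combination over the two-element field: an equation is used by adding it to the goal, and
    [boolring] decides the identity that remains. *)
Lemma addb_lin1 (a b a1 b1 : bool) :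
  a1 = b1 -> a (+) b = a1 (+) b1 -> a = b.
Proof. by move=> ->; rewrite addbb; case: a; case: b. Qed.

Lemma addb_lin2 (a b a1 b1 a2 b2 : bool) :
  a1 = b1 -> a2 = b2 -> a (+) b = (a1 (+) b1) (+) (a2 (+) b2) -> a = b.
Proof. by move=> -> ->; rewrite !addbb; case: a; case: b. Qed.

From mathcomp Require Import ring lra zify.

(** * From a plane drawing to winding parities *)

Lemma mem_edges (G : sgraph) (x y : G) : adj x y -> [set x; y]%SET \in edges G.
Proof. by move=> xy; apply/imsetP; exists (x, y); rewrite ?inE. Qed.

Module Drawing.
Import classical_sets set_interval reals topology normedtype.
Import numFieldNormedType.Exports.
Import Order.TTheory GRing.Theory Num.Theory.

(** * Crossing parities of polygonal paths *)

Section Crossing.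
Variables (R : realFieldType) (eta : R).
Implicit Types (s t u v : R * R).
Local Open Scope ring_scope.

(** A sheared first coordinate. The shear [eta] is chosen later so that distinct sample points have
    distinct abscissas. *)
Definition absc (p : R * R) : R := p.1 + eta * p.2.

(** The height of [u] over the line through [s] and [t], measured at fixed abscissa and multiplied
    by the square of [absc t - absc s] to avoid a division. *)
Definition below s t u : bool :=
  (absc t - absc s) * ((absc t - absc s) * u.2
     - (absc t - absc u) * s.2 - (absc u - absc s) * t.2) < 0.

(** For [u] in general position: the ray from [u] that keeps [absc] fixed and raises the second
    coordinate meets the segment from [s] to [t]. *)
Definition shade s t u : bool :=
  ((absc s < absc u) (+) (absc t < absc u)) && below s t u.

Definition line_separated s t u v : Prop :=
  exists a b c : R, [/\ a * s.1 + b * s.2 < c, a * t.1 + b * t.2 < c,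
    c < a * u.1 + b * u.2 & c < a * v.1 + b * v.2].

(** In the coordinates [X = absc] and [y], the separating form is [a * X + (b - a * eta) * y - c].
    It is negative along the segment and positive at [u], so at the abscissa of [u] the sign of its
    [y]-coefficient tells on which side of the segment [u] lies. *)
Lemma below_lower (a b c : R) s t u :
  a * s.1 + b * s.2 < c -> a * t.1 + b * t.2 < c -> c < a * u.1 + b * u.2 ->
  absc s != absc u -> absc t != absc u ->
  (absc s < absc u) (+) (absc t < absc u) ->
  b - a * eta != 0 /\ below s t u = (b - a * eta < 0).
Proof.
move=> ls lt lu su tu; rewrite /below.
set X := absc s; set Y := absc t; set Z := absc u.
have [es et eu] : [/\ s.1 = X - eta * s.2, t.1 = Y - eta * t.2 & u.1 = Z - eta * u.2].
  by rewrite /X /Y /Z /absc !addrK.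
move: ls lt lu; rewrite es et eu => ls lt lu.
set B := b - a * eta.
set D := (Y - X) * u.2 - (Y - Z) * s.2 - (Z - X) * t.2.
have key : (Y - X) * (a * Z + B * u.2 - c) =
    (Y - Z) * (a * X + B * s.2 - c) + (Z - X) * (a * Y + B * t.2 - c) + B * D.
  by rewrite /D; ring.
have {}ls : a * X + B * s.2 - c < 0 by rewrite /B; lra.
have {}lt : a * Y + B * t.2 - c < 0 by rewrite /B; lra.
have {}lu : 0 < a * Z + B * u.2 - c by rewrite /B; lra.
case: (ltrgtP X Z) su => // XZ _; case: (ltrgtP Y Z) tu => //= YZ _ _.
- have BD : 0 < B * D by nra.
  have YX : 0 < Y - X by lra.
  rewrite pmulr_rlt0 //.
  case: (ltrgtP B 0) => hB; last by move: BD; rewrite hB mul0r ltxx.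
    by move: BD; rewrite nmulr_rgt0.
  by move: BD; rewrite pmulr_rgt0 // => /ltW; rewrite leNgt => /negbTE.
- have BD : B * D < 0 by nra.
  have YX : Y - X < 0 by lra.
  rewrite nmulr_rlt0 //.
  case: (ltrgtP B 0) => hB; last by move: BD; rewrite hB mul0r ltxx.
    by move: BD; rewrite nmulr_rlt0.
  by move: BD; rewrite pmulr_rlt0 // => /ltW; rewrite leNgt => /negbTE.
Qed.

(** All four shades depend on the abscissas and on the single sign of [b - a * eta], which tells
    which segment is the upper one. Their sum is the same for both signs, so only the interleaving
    of the abscissas is left. *)
Lemma shade_sep s t u v : line_separated s t u v ->
  absc s != absc u -> absc s != absc v -> absc t != absc u -> absc t != absc v ->
  shade s t u (+) shade s t v (+) shade u v s (+) shade u v t =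
  (absc s < absc u) (+) (absc s < absc v) (+)
  (absc t < absc u) (+) (absc t < absc v).
Proof.
move=> [a [b [c [ls lt lu lv]]]] su sv tu tv.
have lo p : a * p.1 + b * p.2 < c -> (- a) * p.1 + (- b) * p.2 > - c by lra.
have hi p : c < a * p.1 + b * p.2 -> (- a) * p.1 + (- b) * p.2 < - c by lra.
have us := su; have ut := tu; have vs := sv; have vt := tv.
rewrite eq_sym in us; rewrite eq_sym in ut; rewrite eq_sym in vs; rewrite eq_sym in vt.
have Bu := below_lower ls lt lu su tu; have Bv := below_lower ls lt lv sv tv.
have Bs := below_lower (hi _ lu) (hi _ lv) (lo _ ls) us vs.
have Bt := below_lower (hi _ lu) (hi _ lv) (lo _ lt) ut vt.
have flip : b - a * eta != 0 -> (- b - - a * eta < 0) = ~~ (b - a * eta < 0).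
  move=> B0; rewrite -leNgt le_eqVlt eq_sym (negbTE B0) /=.
  by apply/idP/idP; lra.
have ltC p q : absc p != absc q -> (absc q < absc p) = ~~ (absc p < absc q).
  by move=> pq; rewrite -leNgt lt_neqAle eq_sym pq.
have Eu : shade s t u = ((absc s < absc u) (+) (absc t < absc u)) && (b - a * eta < 0).
  by rewrite /shade; case: (_ (+) _) Bu => // /(_ isT) [_ ->].
have Ev : shade s t v = ((absc s < absc v) (+) (absc t < absc v)) && (b - a * eta < 0).
  by rewrite /shade; case: (_ (+) _) Bv => // /(_ isT) [_ ->].
have Bne : - b - - a * eta != 0 -> b - a * eta != 0.
  by apply: contraNneq => h; apply/eqP; lra.
have Es : shade u v s = ((absc u < absc s) (+) (absc v < absc s)) && ~~ (b - a * eta < 0).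
  by rewrite /shade; case: (_ (+) _) Bs => // /(_ isT) [/Bne /flip <- ->].
have Et : shade u v t = ((absc u < absc t) (+) (absc v < absc t)) && ~~ (b - a * eta < 0).
  by rewrite /shade; case: (_ (+) _) Bt => // /(_ isT) [/Bne /flip <- ->].
rewrite Eu Ev Es Et (ltC s u) // (ltC s v) // (ltC t u) // (ltC t v) //.
by do 5 case: (_ < _).
Qed.

Definition path_shade (P : nat -> R * R) (n : nat) u : bool :=
  iteri n (fun i b => b (+) shade (P i) (P i.+1) u) false.

(** Both sides are additive under concatenation of either path, because each inner point occurs
    twice and cancels; so the identity for two segments sums up. *)
Lemma path_shade_sep (P Q : nat -> R * R) n m :
  (forall i j, i < n -> j < m -> line_separated (P i) (P i.+1) (Q j) (Q j.+1))%N ->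
  (forall i j, i <= n -> j <= m -> absc (P i) != absc (Q j))%N ->
  path_shade P n (Q 0%N) (+) path_shade P n (Q m) (+)
  path_shade Q m (P 0%N) (+) path_shade Q m (P n) =
  (absc (P 0%N) < absc (Q 0%N)) (+) (absc (P 0%N) < absc (Q m)) (+)
  (absc (P n) < absc (Q 0%N)) (+) (absc (P n) < absc (Q m)).
Proof.
elim: n => [|n IHn] sep ne.
  have p0 u : path_shade P 0 u = false by [].
  rewrite !p0; move: (path_shade _ _ _) (_ < _) (_ < _); by do 3 case.
have {}IHn := IHn (fun i j hi hj => sep i j (ltnW hi) hj)
  (fun i j hi hj => ne i j (leqW hi) hj).
have {}sep j : (j < m)%N -> line_separated (P n) (P n.+1) (Q j) (Q j.+1).
  by move=> hj; apply: sep.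
have step : shade (P n) (P n.+1) (Q 0%N) (+) shade (P n) (P n.+1) (Q m) (+)
   path_shade Q m (P n) (+) path_shade Q m (P n.+1) =
   (absc (P n) < absc (Q 0%N)) (+) (absc (P n) < absc (Q m)) (+)
   (absc (P n.+1) < absc (Q 0%N)) (+) (absc (P n.+1) < absc (Q m)).
  elim: m sep ne {IHn} => [|m IHm] sep ne.
    have q0 u : path_shade Q 0 u = false by [].
    rewrite !q0; move: (shade _ _ _) (_ < _) (_ < _); by do 3 case.
  have IH : _ := IHm (fun j hj => sep j (leqW hj)) (fun i j hi hj => ne i j hi (leqW hj)).
  have := shade_sep (sep m (ltnSn m)) (ne n m _ _) (ne n m.+1 _ _)
    (ne n.+1 m _ _) (ne n.+1 m.+1 _ _).
  rewrite !leqnSn !leqnn => /(_ isT isT isT isT isT isT isT isT).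
  move=> one; apply: (addb_lin2 IH one).
  by rewrite /path_shade /=; boolring.
apply: (addb_lin2 IHn step).
by rewrite /path_shade /=; boolring.
Qed.
End Crossing.

(** * Replacing disjoint arcs by separated polygonal paths *)

Section Sampling.
Variable R : realType.
Local Open Scope ring_scope.

Definition continuous01 (h : R -> R * R) : Prop :=
  forall s : R, 0 <= s <= 1 -> forall e : R, 0 < e -> exists2 d : R, 0 < d &
    forall s' : R, 0 <= s' <= 1 -> `|s' - s| < d ->
      `|(h s').1 - (h s).1| < e /\ `|(h s').2 - (h s).2| < e.

Lemma within_continuous01 (h : R -> R * R) :
  {within `[0, 1], continuous h}%classic -> continuous01 h.
Proof.
move=> /subspace_continuousP ch s s01 e e0.
have /ch : (`[0, 1]%classic : set R) s by rewrite /= in_itv.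
move/cvg_ballP => /(_ e e0).
rewrite near_withinE => /nbhs_ballP[d /= d0 hd]; exists d => // s' s'01 ss'.
have := hd s'; rewrite /ball /= => hs'.
have [] : prod_ball (h s) e (h s') by apply: hs'; rewrite ?in_itv // distrC.
by rewrite /ball /= !(distrC (_ (h s))).
Qed.

Lemma line_separated_far (e : R) (a b s t u v : R * R) : 0 < e ->
  (3 * e <= `|a.1 - b.1| \/ 3 * e <= `|a.2 - b.2|) ->
  `|s.1 - a.1| < e -> `|s.2 - a.2| < e -> `|t.1 - a.1| < e -> `|t.2 - a.2| < e ->
  `|u.1 - b.1| < e -> `|u.2 - b.2| < e -> `|v.1 - b.1| < e -> `|v.2 - b.2| < e ->
  line_separated s t u v.
Proof.
rewrite !ltr_norml !ler_normr => e0 ab /andP[s1 s1'] /andP[s2 s2'] /andP[t1 t1']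
  /andP[t2 t2'] /andP[u1 u1'] /andP[u2 u2'] /andP[v1 v1'] /andP[v2 v2'].
case: ab => /orP[] ab.
- by exists (-1), 0, (- (a.1 + b.1) / 2); split; lra.
- by exists 1, 0, ((a.1 + b.1) / 2); split; lra.
- by exists 0, (-1), (- (a.2 + b.2) / 2); split; lra.
- by exists 0, 1, ((a.2 + b.2) / 2); split; lra.
Qed.

(** Compactness of the square of parameter pairs: near each pair the arcs stay in small boxes around
    two different points, and a line parallel to an axis separates these boxes. The near-covering
    property yields one step size for all pairs. *)
Lemma disjoint_arcs_sampling (h h' : R -> R * R) :
  continuous01 h -> continuous01 h' ->
  (forall s t : R, 0 <= s <= 1 -> 0 <= t <= 1 -> h s <> h' t) ->
  exists N0 : nat, forall N i j : nat, (N0 <= N)%N -> (i < N)%N -> (j < N)%N ->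
    line_separated (h (i%:R / N%:R)) (h (i.+1%:R / N%:R))
              (h' (j%:R / N%:R)) (h' (j.+1%:R / N%:R)).
Proof.
move=> ch ch' dis.
pose P (N : nat) (x : R * R) := 0 <= x.1 <= 1 -> 0 <= x.2 <= 1 ->
  forall s t : R, 0 <= s <= 1 -> 0 <= t <= 1 ->
  `|s - x.1| <= N%:R^-1 -> `|t - x.2| <= N%:R^-1 ->
  line_separated (h x.1) (h s) (h' x.2) (h' t).
have cK : compact (`[0, 1]%classic `*` `[0, 1]%classic : set (R * R)).
  by apply: compact_setX; apply: segment_compact.
move/compact_near_coveringP: cK => /(_ nat \oo%classic P _) near_cov.
have : (\forall N \near \oo, (`[0, 1] `*` `[0, 1] `<=` P N))%classic.
  apply: near_cov => -[s0 t0] [/=]; rewrite !in_itv /= => s01 t01.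
  (* A third of the larger coordinate distance is the box size that [line_separated_far] asks
     for. *)
  pose e : R := Num.max `|(h s0).1 - (h' t0).1| `|(h s0).2 - (h' t0).2| / 3.
  have e0 : 0 < e.
    rewrite divr_gt0 // lt_max !normr_gt0 !subr_eq0.
    case: (eqVneq (h s0).1 (h' t0).1) => //= e1; apply/negP => /eqP e2.
    by apply: (dis s0 t0) => //; rewrite [LHS]surjective_pairing e1 e2 -surjective_pairing.
  have [d d0 hd] := ch s0 s01 e e0; have [d' d'0 hd'] := ch' t0 t01 e e0.
  (* Half of the radius is for the distance of the base pair from [(s0, t0)], half for the step
     [1 / N]. *)
  have dd0 : 0 < Num.min d d' / 2 by rewrite divr_gt0 // lt_min d0.
  set r := Num.min d d' / 2 in dd0.
  have rN (N : nat) : (Num.bound r^-1 <= N)%N -> N%:R^-1 < r.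
    move=> le_N; have rN : r^-1 < N%:R.
      apply: (@lt_le_trans _ _ (Num.bound r^-1)%:R); last by rewrite ler_nat.
      by apply: archi_boundP; rewrite invr_ge0 ltW.
    by rewrite -[r]invrK ltf_pV2 // posrE ?invr_gt0 // (lt_trans _ rN) ?invr_gt0.
  exists (ball ((s0, t0) : R * R) r, [set N | (Num.bound r^-1 <= N)%N]%classic) => /=.
    by split; [exact: nbhsx_ballx | exists (Num.bound r^-1)].
  move=> [[s1 t1] N] [/= [/= bs bt] /rN Nr] /= s1_01 t1_01 s t hs ht ss tt.
  have rd : r + r <= d by rewrite /r; case: (leP d d'); lra.
  have rd' : r + r <= d' by rewrite /r; case: (leP d d'); lra.
  move: bs bt; rewrite /ball /= distrC (distrC t0) => bs bt.
  have [a1 a2] := hd _ s1_01 ltac:(lra).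
  have [b1 b2] := hd' _ t1_01 ltac:(lra).
  have [a3 a4] : `|(h s).1 - (h s0).1| < e /\ `|(h s).2 - (h s0).2| < e.
    by apply: hd => //; have := ler_distD s1 s s0; lra.
  have [b3 b4] : `|(h' t).1 - (h' t0).1| < e /\ `|(h' t).2 - (h' t0).2| < e.
    by apply: hd' => //; have := ler_distD t1 t t0; lra.
  apply: (@line_separated_far e (h s0) (h' t0)) => //.
  rewrite /e mulrCA divff ?mulr1 ?pnatr_eq0 // !ge_max !lexx /= !andbT.
  by apply/orP; exact: le_total.
move=> [N0 _ HN]; exists N0.+1 => N i j leN iN jN.
have N0R : 0 < (N%:R : R) by rewrite ltr0n; apply: leq_trans iN.
have frac (a : nat) : (a <= N)%N -> 0 <= a%:R / N%:R <= (1 : R).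
  by move=> aN; rewrite divr_ge0 ?ler0n // ler_pdivrMr // mul1r ler_nat.
have step (a : nat) : `|a.+1%:R / N%:R - a%:R / N%:R| <= (N%:R^-1 : R).
  by rewrite -mulrBl -natrB // subSnn mul1r ger0_norm // invr_ge0 ltW.
have HP := HN N (ltnW leN) (i%:R / N%:R, j%:R / N%:R) _.
apply: HP => /=; rewrite ?frac // 1?ltnW //.
by rewrite !in_itv /= !frac // ltnW.
Qed.
End Sampling.

(** * Half edges of a plane drawing *)

Section HalfArcs.
Variables (R : realType) (Y : sgraph).
Local Open Scope ring_scope.

(** Two distinct points share an abscissa for at most one value of [eta]; the list [B] contains all
    these values, and [eta] is chosen larger than each of them. *)
Lemma generic_direction (s : seq (R * R)) :
  exists eta : R, {in s &, forall P Q, P <> Q -> absc eta P != absc eta Q}.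
Proof.
pose B := [seq (Q.1 - P.1) / (P.2 - Q.2) | P <- s, Q <- s].
pose eta : R := 1 + \sum_(b <- B) `|b|.
have etaB b : b \in B -> b != eta.
  move=> bB; rewrite lt_eqF // /eta (big_rem _ bB) /=.
  have : 0 <= \sum_(y <- rem b B) `|y| by apply: sumr_ge0.
  by have := ler_norm b; lra.
exists eta => P Q Ps Qs PQ; apply/negP => /eqP.
rewrite /absc => eq_abs; have [e2|ne2] := eqVneq P.2 Q.2.
  apply: PQ; rewrite [P]surjective_pairing [Q]surjective_pairing e2.
  by congr (_, _); move: eq_abs; rewrite e2 => /addIr.
have /negP[] := etaB _ (allpairs_f (fun P Q => (Q.1 - P.1) / (P.2 - Q.2)) Ps Qs).
have ne0 : P.2 - Q.2 != 0 by rewrite subr_eq0.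
by rewrite -(inj_eq (mulIf ne0)) divfK //; apply/eqP; lra.
Qed.

Lemma uniform_bound (I : finType) (P : I -> nat -> Prop) :
  (forall i, exists N0, forall N, (N0 <= N)%N -> P i N) ->
  exists N0, forall i N, (N0 <= N)%N -> P i N.
Proof.
move=> ex_bound.
suff [N0 HN0] : exists N0, forall i N, i \in enum I -> (N0 <= N)%N -> P i N.
  by exists N0 => i N; apply: HN0; rewrite mem_enum.
elim: (enum I) => [|i s [N1 HN1]]; first by exists 0%N.
have [N2 HN2] := ex_bound i; exists (maxn N1 N2) => j N.
rewrite inE geq_max => /orP[/eqP -> /andP[_ /HN2]//|js /andP[leN _]].
exact: HN1.
Qed.

Variables (p : Y -> R * R) (gamma : {set Y} -> R -> R * R).
Hypothesis drawing : is_plane_drawing p gamma.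

(** Half arcs from different vertices along different edges are disjoint with their end points
    included, which whole edges are not. The test finds the end of [gamma e] at which [x] is
    drawn. *)
Definition half_arc (x y : Y) (s : R) : R * R :=
  let e := [set x; y]%SET in
  if gamma e 0 == p x then gamma e (s / 2) else gamma e (1 - s / 2).

Definition midpoint (e : {set Y}) : R * R := gamma e (1 / 2).

Lemma half_arc0 x y : adj x y -> half_arc x y 0 = p x.
Proof.
move=> xy; rewrite /half_arc mul0r subr0; case: eqP => // ne.
have [a [b [e_ab ga gb]]] := drawing_ends drawing (mem_edges xy).
rewrite gb; congr p; have ax : a <> x by move=> ax; apply: ne; rewrite ga ax.
have : x \in [set a; b]%SET by rewrite -e_ab !inE eqxx.
by rewrite !inE => /orP[/eqP xa|/eqP ->//]; case: ax.
Qed.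

Lemma half_arc1 x y : half_arc x y 1 = midpoint [set x; y]%SET.
Proof.
by rewrite /half_arc /midpoint; case: eqP => // _; congr gamma; lra.
Qed.

Lemma half_arc_interior x y s : 0 < s <= 1 ->
  exists2 t : R, 0 < t < 1 & half_arc x y s = gamma [set x; y]%SET t.
Proof.
by move=> hs; rewrite /half_arc; case: eqP => _;
  [exists (s / 2) | exists (1 - s / 2)] => //; lra.
Qed.

Lemma continuous_half_arc x y : adj x y -> continuous01 (half_arc x y).
Proof.
move=> xy s s01 e e0; rewrite /half_arc.
have cg := within_continuous01 (drawing_continuous drawing (mem_edges xy)).
case: eqP => _.
- have s2 : 0 <= s / 2 <= 1 by lra.
  have [d d0 hd] := cg _ s2 _ e0; exists d => // s' s'01 ss'; apply: hd; first lra.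
  by move: ss'; rewrite !ltr_norml; lra.
- have s2 : 0 <= 1 - s / 2 <= 1 by lra.
  have [d d0 hd] := cg _ s2 _ e0; exists d => // s' s'01 ss'; apply: hd; first lra.
  by move: ss'; rewrite !ltr_norml; lra.
Qed.

Lemma half_arc_disjoint x y x' y' s t : adj x y -> adj x' y' -> x != x' ->
  [set x; y]%SET != [set x'; y']%SET -> 0 <= s <= 1 -> 0 <= t <= 1 ->
  half_arc x y s <> half_arc x' y' t.
Proof.
move=> xy x'y' xx' ee' s01 t01.
have [->|s0] := eqVneq s 0; have [->|t0] := eqVneq t 0.
- by rewrite !half_arc0 // => /(drawing_vertices drawing)/eqP; rewrite (negbTE xx').
- rewrite half_arc0 //.
  have [|t' t'01 -> /esym] := @half_arc_interior x' y' t.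
    by rewrite lt_neqAle eq_sym t0; case/andP: t01 => -> ->.
  exact: (drawing_avoids_vertices drawing (mem_edges x'y')).
- rewrite [half_arc x' y' 0]half_arc0 //.
  have [|s' s'01 ->] := @half_arc_interior x y s.
    by rewrite lt_neqAle eq_sym s0; case/andP: s01 => -> ->.
  exact: (drawing_avoids_vertices drawing (mem_edges xy)).
- have [|t' t'01 ->] := @half_arc_interior x' y' t.
    by rewrite lt_neqAle eq_sym t0; case/andP: t01 => -> ->.
  have [|s' s'01 ->] := @half_arc_interior x y s.
    by rewrite lt_neqAle eq_sym s0; case/andP: s01 => -> ->.
  exact: (drawing_no_crossing drawing (mem_edges xy) (mem_edges x'y') ee').
Qed.

End HalfArcs.

Section Shading.
Local Open Scope ring_scope.

(** All that is kept of the drawing: [pt] gives the abscissas of vertices and edge midpoints, and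
    [rho x y] the crossing parity with the sampled half arc from [x] towards [y]. Half arcs at one
    vertex and the two halves of one edge are exempt, since they meet. *)
Lemma planar_shading (R : realType) (Y : sgraph) : planar R Y ->
  exists (pt : Y + {set Y} -> R) (rho : Y -> Y -> Y + {set Y} -> bool),
    (forall x a b : Y, adj x a -> adj x b -> a != b ->
      pt (inr [set x; a]%SET) != pt (inr [set x; b]%SET)) /\
    forall x y x' y' : Y, adj x y -> adj x' y' -> x != x' ->
      let m := inr [set x; y]%SET in let m' := inr [set x'; y']%SET in
      m != m' ->
      rho x y (inl x') (+) rho x y m' (+) rho x' y' (inl x) (+) rho x' y' m =
      (pt (inl x) < pt (inl x')) (+) (pt (inl x) < pt m') (+)
      (pt m < pt (inl x')) (+) (pt m < pt m').
Proof.
move=> [p [gamma dr]].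
pose h := half_arc p gamma.
pose sepN (q : Y * Y * (Y * Y)) (N : nat) :=
  let: ((x, y), (x', y')) := q in
  adj x y -> adj x' y' -> x != x' -> [set x; y]%SET != [set x'; y']%SET ->
  forall i j, (i < N)%N -> (j < N)%N ->
  line_separated (h x y (i%:R / N%:R)) (h x y (i.+1%:R / N%:R))
            (h x' y' (j%:R / N%:R)) (h x' y' (j.+1%:R / N%:R)).
have [|N0 HN0] := @uniform_bound (Y * Y * (Y * Y))%type sepN.
  move=> [[x y] [x' y']]; case xy : (adj x y); last by exists 0%N => N _; rewrite /= xy.
  case x'y' : (adj x' y'); last by exists 0%N => N _; rewrite /= x'y'.
  case: (boolP (x != x')) => xx'; last by exists 0%N => N _; rewrite /= (negbTE xx').
  case: (boolP ([set x; y]%SET != [set x'; y']%SET)) => ee'; last first.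
    by exists 0%N => N _; rewrite /= (negbTE ee').
  have [N0 HN] := disjoint_arcs_sampling (continuous_half_arc dr xy)
    (continuous_half_arc dr x'y')
    (fun s t => half_arc_disjoint dr xy x'y' xx' ee' (s := s) (t := t)).
  by exists N0 => N leN _ _ _ _ i j; apply: HN.
pose N := N0.+1.
have NN (a : Y * Y * (Y * Y)) : sepN a N by apply: HN0; apply: leqnSn.
pose sample (x y : Y) (i : nat) := h x y (i%:R / N%:R).
pose pts := [seq sample t.1.1 t.1.2 (t.2 : 'I_N.+1) | t : Y * Y * 'I_N.+1].
have ptsP x y i : (i <= N)%N -> sample x y i \in pts.
  move=> iN; apply/mapP; exists (x, y, inord i); rewrite ?mem_enum //=.
  by rewrite inordK.
have [eta Heta] := generic_direction pts.
have sample0 x y : adj x y -> sample x y 0%N = p x.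
  by move=> xy; rewrite /sample mul0r /h (half_arc0 dr).
have sampleN x y : sample x y N = midpoint gamma [set x; y]%SET.
  by rewrite /sample divff ?pnatr_eq0 // /h half_arc1.
pose pos (q : Y + {set Y}) := match q with inl x => p x | inr e => midpoint gamma e end.
exists (absc eta \o pos), (fun x y q => path_shade eta (sample x y) N (pos q)).
split=> [x a b xa xb ab | x y x' y' xy x'y' xx' m m' mm'].
  rewrite /= -!sampleN; apply: Heta; rewrite ?ptsP // !sampleN /midpoint.
  have ee' : [set x; a]%SET != [set x; b]%SET.
    apply: contraNneq ab => e_ab; have : a \in [set x; b]%SET by rewrite -e_ab !inE eqxx orbT.
    by rewrite !inE => /orP[/eqP ax|//]; move: xa; rewrite ax adj_irrefl.
  by apply: (drawing_no_crossing dr (mem_edges xa) (mem_edges xb) ee'); lra.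
have ee' : [set x; y]%SET != [set x'; y']%SET by apply: contra mm' => /eqP e; rewrite /m e.
have := @path_shade_sep _ eta (sample x y) (sample x' y') N N.
rewrite !sampleN !sample0 //; apply.
  by move=> i j iN jN; apply: (NN (x, y, (x', y'))).
move=> i j iN jN; apply: Heta; rewrite ?ptsP //.
have frac (a : nat) : (a <= N)%N -> 0 <= a%:R / N%:R <= (1 : R).
  by move=> aN; rewrite divr_ge0 ?ler0n // ler_pdivrMr ?ltr0n // mul1r ler_nat.
by apply: (half_arc_disjoint dr) => //; apply: frac.
Qed.
End Shading.

End Drawing.

(** * The cycle space of a cubic graph *)

Lemma set2_inj (T : finType) (x y a b : T) :
  [set x; y] = [set a; b] -> x = a /\ y = b \/ x = b /\ y = a.
Proof.
move=> e; have ha : a \in [set x; y] by rewrite e !inE eqxx.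
have hb : b \in [set x; y] by rewrite e !inE eqxx orbT.
have hx : x \in [set a; b] by rewrite -e !inE eqxx.
have hy : y \in [set a; b] by rewrite -e !inE eqxx orbT.
move: ha hb hx hy; rewrite !inE.
move=> /orP[/eqP<-|/eqP<-] /orP[/eqP<-|/eqP<-] /orP[]/eqP ? /orP[]/eqP ?; subst; auto.
Qed.

Lemma in_edges (G : sgraph) (x y : G) : ([set x; y] \in edges G) = adj x y.
Proof.
apply/imsetP/idP => [[[a b]]|xy]; last by exists (x, y); rewrite ?inE.
rewrite inE /= => ab /set2_inj[[-> ->]//|[-> ->]]; by rewrite adj_sym.
Qed.

Definition symd (T : finType) (A B : {set T}) := (A :\: B) :|: (B :\: A).

Lemma in_symd (T : finType) (A B : {set T}) x :
  (x \in symd A B) = (x \in A) (+) (x \in B).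
Proof. by rewrite !inE; case: (x \in A); case: (x \in B). Qed.


Lemma xor_odd_sum (I : finType) (P : pred I) (F : I -> nat) :
  odd (\sum_(i | P i) F i) = \big[addb/false]_(i | P i) odd (F i).
Proof. by apply: (big_morph odd) => // m n; rewrite oddD. Qed.

Lemma xor_and (I : finType) (P : pred I) (F : I -> bool) b :
  \big[addb/false]_(i | P i) (F i && b) = (\big[addb/false]_(i | P i) F i) && b.
Proof. by apply: esym; apply: (big_morph (andb^~ b)) => // x y; rewrite andb_addl. Qed.

Lemma xor_card (I : finType) (P : pred I) :
  \big[addb/false]_i P i = odd #|P|.
Proof.
rewrite -sum1_card xor_odd_sum [in RHS]big_mkcond.
by apply: eq_bigr => i _; rewrite unfold_in; case: (P i).
Qed.

Lemma xor_symmetric (I : finType) (F : I -> I -> bool) :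
  (forall i j, F i j = F j i) -> (forall i, F i i = false) ->
  \big[addb/false]_(q : I * I) F q.1 q.2 = false.
Proof.
move=> sF dF; rewrite (bigID (fun q => enum_rank q.1 < enum_rank q.2)) /=.
set A := (X in X (+) _); set B := (X in _ (+) X).
suff -> : B = A by rewrite addbb.
rewrite /B (bigID (fun q => q.1 == q.2)) /=.
rewrite big1 ?addFb => [|[i j] /= /andP[_ /eqP->]]; last exact: dF.
rewrite /A (reindex_inj (h := fun q => (q.2, q.1))) /=; last by move=> [a b] [c d] /= [-> ->].
apply: eq_big => [[i j]|[i j] _] /=; last exact: sF.
rewrite -leqNgt ltn_neqAle andbC; congr (_ && _).
by rewrite -(inj_eq enum_rank_inj) eq_sym.
Qed.

(** * Colouring the corners by winding parities *)

Section PlaneMap.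
Variable Y : sgraph.
Hypothesis Ycubic : cubic Y.
Local Notation e x y := ([set x; y] : {set Y}).
Implicit Types (z : {set {set Y}}) (x y a b w : Y).

Definition nb (x : Y) := [set y | adj x y].

Definition nb3 (x y a b : Y) : Prop :=
  [/\ nb x = [set y; a; b], y != a, y != b & a != b].

Lemma nb3_ex (x y : Y) : adj x y -> exists a b, nb3 x y a b.
Proof.
move=> xy; have ynb : y \in nb x by rewrite inE.
have : #|nb x :\ y| == 2.
  by have := cardsD1 y (nb x); rewrite ynb /nb Ycubic add1n => -[<-].
case/cards2P => a [b [ab nbx]]; exists a, b.
have [ya yb] : a \in nb x :\ y /\ b \in nb x :\ y by rewrite nbx !inE !eqxx orbT.
split=> //; first by rewrite -(setD1K ynb) nbx setUA.
  by move: ya; rewrite !inE eq_sym => /andP[].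
by move: yb; rewrite !inE eq_sym => /andP[].
Qed.

Lemma nb3_adj x y a b : nb3 x y a b -> [/\ adj x y, adj x a & adj x b].
Proof.
by case=> nbx *; split; rewrite -[adj _ _]inE -[_ \in _]/(_ \in nb x) nbx !inE eqxx ?orbT.
Qed.

Lemma nb3_rot x y a b : nb3 x y a b -> nb3 x a b y.
Proof.
case=> nbx ya yb ab; split=> //; try by rewrite eq_sym.
by rewrite nbx; apply/setP => w; rewrite !inE; case: (w == y); case: (w == a); case: (w == b).
Qed.

Lemma nb3_swap x y a b : nb3 x y a b -> nb3 x y b a.
Proof.
case=> nbx ya yb ab; split=> //; try by rewrite eq_sym.
by rewrite nbx; apply/setP => w; rewrite !inE; case: (w == y); case: (w == a); case: (w == b).
Qed.

Lemma nb3_mem x y a b w : nb3 x y a b -> adj x w = [|| w == y, w == a | w == b].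
Proof.
by case=> nbx *; rewrite -[adj _ _]inE -[_ \in _]/(_ \in nb x) nbx !inE orbA.
Qed.

Lemma big_nb3 (R : Type) (idx : R) (op : Monoid.com_law idx) (F : Y -> R) x y a b :
  nb3 x y a b -> \big[op/idx]_(w | adj x w) F w = op (F y) (op (F a) (F b)).
Proof.
move=> n3; have [nbx ya yb ab] := n3.
rewrite (bigD1 y) /=; last by case: (nb3_adj n3).
rewrite (bigD1 a) /=; last by case: (nb3_adj n3) => _ -> _; rewrite eq_sym ya.
rewrite (bigD1 b) /=; last by case: (nb3_adj n3) => _ _ ->; rewrite eq_sym yb eq_sym ab.
rewrite big1 ?Monoid.mulm1 // => w; rewrite (nb3_mem _ n3).
by case: (w == y); case: (w == a); case: (w == b).
Qed.

Definition degz (z : {set {set Y}}) x := #|[set y | e x y \in z]|.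

(** The cycle space over the two-element field, with [symd] as its addition. *)
Definition evens : {set {set {set Y}}} :=
  [set z : {set {set Y}} | (z \subset edges Y) && [forall x, ~~ odd (degz z x)]].

Lemma evensP z : reflect (z \subset edges Y /\ forall x, ~~ odd (degz z x)) (z \in evens).
Proof.
rewrite inE; apply: (iffP andP) => -[sz ez]; split=> //.
  by move=> x; move/forallP: ez; apply.
by apply/forallP.
Qed.

Lemma even_adj z x y : z \in evens -> e x y \in z -> adj x y.
Proof. by case/evensP => /subsetP sz _ /sz; rewrite in_edges. Qed.

Lemma degz_sub_nb3 z x y a b : z \subset edges Y -> nb3 x y a b ->
  degz z x = (e x y \in z) + ((e x a \in z) + (e x b \in z)).
Proof.
move=> /subsetP sz n3; rewrite /degz -sum1_card.
rewrite -(big_nb3 _ (fun w => nat_of_bool (e x w \in z)) n3) /=.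
rewrite [RHS]big_mkcond [LHS]big_mkcond; apply: eq_bigr => w _.
rewrite !inE; case xwz : (e x w \in z); last by case: ifP.
by have := sz _ xwz; rewrite in_edges => ->.
Qed.

Lemma degz_nb3 z x y a b : z \in evens -> nb3 x y a b ->
  degz z x = (e x y \in z) + ((e x a \in z) + (e x b \in z)).
Proof. by case/evensP => sz _; apply: degz_sub_nb3. Qed.

Lemma even_nb3 z x y a b : z \in evens -> nb3 x y a b ->
  (e x y \in z) = (e x a \in z) (+) (e x b \in z).
Proof.
move=> ez n3; have /evensP[_ /(_ x)] := ez; rewrite (degz_nb3 ez n3).
by do 3 case: (_ \in z).
Qed.

Lemma symd_even z z' : z \in evens -> z' \in evens -> symd z z' \in evens.
Proof.
move=> /evensP[sz ez] /evensP[sz' ez']; apply/evensP; split.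
  by rewrite subUset !subDset !(subset_trans _ (subsetUr _ _)).
move=> x; move: (ez x) (ez' x); rewrite /degz !cardsE -!xor_card.
set s := \big[_/_]_i _; set s1 := \big[_/_]_i _; set s2 := \big[_/_]_i _.
suff -> : s2 = s (+) s1 by case: s; case: s1.
rewrite /s2 /s /s1 -big_split; apply: eq_bigr => y _; exact: in_symd.
Qed.

Variables (lt : rel (Y + {set Y})) (rho : Y -> Y -> Y + {set Y} -> bool).
Hypothesis lt_total : forall x a b : Y, adj x a -> adj x b -> a != b ->
  lt (inr (e x a)) (inr (e x b)) (+) lt (inr (e x b)) (inr (e x a)).
Hypothesis shading : forall x y x' y' : Y, adj x y -> adj x' y' -> x != x' ->
  let m := inr (e x y) in let m' := inr (e x' y') in m != m' ->
  rho x y (inl x') (+) rho x y m' (+) rho x' y' (inl x) (+) rho x' y' m =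
  lt (inl x) (inl x') (+) lt (inl x) m' (+) lt m (inl x') (+) lt m m'.

(** The identity [shading] is silent on two half arcs with the same start. This term stands in for
    the contribution of the half arc from [x] to [b] to the winding parity at [x] itself, and is
    chosen so that [omega_side] holds. *)
Definition theta (x b : Y) : bool :=
  (\big[addb/false]_(y | adj x y && (y != b)) (rho x y (inr (e x b)) (+) rho x b (inr (e x y))
     (+) lt (inr (e x y)) (inr (e x b)))) (+) lt (inl x) (inr (e x b)).

(** A winding parity of [z] around [x] that makes sense even if [z] passes through [x]: half arcs
    starting elsewhere are counted by their crossings, those at [x] through [theta]. *)
Definition omega (z : {set {set Y}}) (x : Y) : bool :=
  (\big[addb/false]_(q : Y * Y | q.1 != x) ((e q.1 q.2 \in z) && rho q.1 q.2 (inl x))) (+)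
  \big[addb/false]_(b | adj x b) ((e x b \in z) && theta x b).

Lemma omegaD z z' x : omega (symd z z') x = omega z x (+) omega z' x.
Proof.
rewrite /omega -!addbA [X in _ = _ (+) X]addbCA !addbA -big_split -addbA -big_split /=.
by congr (_ (+) _); apply: eq_bigr => i _; rewrite in_symd andb_addl.
Qed.

Lemma theta_nb3 x y b c : nb3 x y b c ->
  theta x b = rho x y (inr (e x b)) (+) rho x b (inr (e x y)) (+)
     lt (inr (e x y)) (inr (e x b)) (+)
     (rho x c (inr (e x b)) (+) rho x b (inr (e x c)) (+)
     lt (inr (e x c)) (inr (e x b))) (+) lt (inl x) (inr (e x b)).
Proof.
move=> n3; have [_ yb yc bc] := n3; rewrite /theta big_mkcondr /= (big_nb3 _ _ n3) /=.
by rewrite yb eqxx [c == b]eq_sym bc /=.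
Qed.

(** The right side is the winding parity around the midpoint of [x y]. To compare it with [omega],
    [shading] is summed over the half arcs of [z] that start away from [x]. Terms depending only on
    the start cancel, since its degree in [z] is even; terms depending only on the edge cancel
    between its two halves, except for edges at [x], which [theta] absorbs. *)
Lemma omega_side z x y : z \in evens -> adj x y -> e x y \notin z ->
  omega z x (+) (0 < degz z x) =
  \big[addb/false]_(q : Y * Y) ((e q.1 q.2 \in z) && rho q.1 q.2 (inr (e x y))).
Proof.
move=> ez xy xyz; set m := inr (e x y).
have rows (P : pred Y) (F : Y -> Y -> bool) : \big[addb/false]_(q : Y * Y | P q.1) F q.1 q.2 =
    \big[addb/false]_(a | P a) \big[addb/false]_b F a b.
  rewrite (pair_big P xpredT F) /=; by apply: eq_bigl => q; rewrite andbT.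
pose g x' := rho x y (inl x') (+) lt (inl x) (inl x') (+) lt m (inl x').
pose u (e' : {set Y}) := rho x y (inr e') (+) lt (inl x) (inr e') (+) lt m (inr e').
rewrite [RHS](bigID (fun q => q.1 != x)) /=.
rewrite (eq_bigr (fun q => ((e q.1 q.2 \in z) && rho q.1 q.2 (inl x)) (+)
   (((e q.1 q.2 \in z) && g q.1) (+) ((e q.1 q.2 \in z) && u (e q.1 q.2))))); last first.
  move=> [x' y'] /= x'x; case x'y'z : (_ \in z) => //=.
  have x'y' := even_adj ez x'y'z.
  have mm' : m != inr (e x' y').
    by apply: contraNneq xyz => -[->].
  rewrite eq_sym in x'x.
  apply: (addb_lin1 (shading xy x'y' x'x mm')); rewrite /g /u -/m.
  by rewrite /=; boolring.
rewrite !big_split /=.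
have -> : \big[addb/false]_(q : Y * Y | q.1 != x) ((e q.1 q.2 \in z) && g q.1) = false.
  rewrite (rows (fun x' => x' != x) (fun x' y' => (e x' y' \in z) && g x')).
  rewrite big1 // => x' _; rewrite xor_and xor_card.
  have /evensP[_ /(_ x')/negbTE] := ez; rewrite /degz cardsE => ->.
  by [].
have symu : \big[addb/false]_(q : Y * Y) ((e q.1 q.2 \in z) && u (e q.1 q.2)) = false.
  apply: (xor_symmetric (F := fun a b => (e a b \in z) && u (e a b))) => [a b|a].
    by rewrite setUC.
  by apply/andP => -[/(even_adj ez)]; rewrite adj_irrefl.
rewrite (bigID (fun q => q.1 != x)) /= in symu.
have row (F : Y -> Y -> bool) : (forall b, ~~ adj x b -> F x b = false) ->
    \big[addb/false]_(q : Y * Y | ~~ (q.1 != x)) F q.1 q.2 = \big[addb/false]_(b | adj x b) F x b.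
  move=> F0; rewrite (rows (fun a => ~~ (a != x)) F).
  under eq_bigl => a do rewrite negbK.
  rewrite big_pred1_eq [RHS]big_mkcond.
  by apply: eq_bigr => b _; case: ifP => // /negbT/F0.
rewrite (row (fun a b => (e a b \in z) && u (e a b))) in symu; last first.
  by move=> b nab; apply/andP => -[/(even_adj ez)]; rewrite (negbTE nab).
rewrite (row (fun a b => (e a b \in z) && rho a b m)); last first.
  by move=> b nab; apply/andP => -[/(even_adj ez)]; rewrite (negbTE nab).
rewrite /omega; set S := \big[addb/false]_(q : Y * Y | q.1 != x) (_ && rho _ _ _).
move: symu; set U := \big[addb/false]_(q : Y * Y | q.1 != x) (_ && u _) => symu.
have [b [c n3]] := nb3_ex xy; have [_ xb xc] := nb3_adj n3.
have [_ _ _ bc] := n3.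
rewrite (big_nb3 _ _ n3) /= in symu.
rewrite (big_nb3 _ _ n3) (big_nb3 _ _ n3) /= (degz_nb3 ez n3).
have zbc := even_nb3 ez n3.
rewrite !(negbTE xyz) /= in symu zbc *.
have {}zbc : (e x b \in z) = (e x c \in z) by move: zbc; do 2 case: (_ \in z).
rewrite (theta_nb3 n3) (theta_nb3 (nb3_swap n3)).
rewrite zbc in symu *; move: symu; case: (e x c \in z) => //= symu; last first.
  by rewrite !addn0 ltnn; apply: (addb_lin1 symu); boolring.
rewrite (_ : (0 < _) = true) //.
(* Here [z] passes through [x] along [x b] and [x c]. Exactly one of the two comparisons of their
   midpoints holds, and this supplies the unit [0 < degz z x]. *)
have tot := lt_total xb xc bc.
apply: (addb_lin2 symu (tot : _ = true)); rewrite /u -/m /=.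
by boolring.
Qed.

(** The colour that [z] gives to the corner at [x] opposite to the edge [x y]. The two sides of that
    edge are the corners indexed by the other two neighbours. *)
Definition kappa z x y : bool := omega z x (+) (e x y \in z).

(** A corner is represented by the even sets that colour it, so corners that no even set
    distinguishes become equal, and their common value is the face. *)
Definition face (x y : Y) : {set {set {set Y}}} := [set z in evens | kappa z x y].

Lemma kappaD z z' x y : kappa (symd z z') x y = kappa z x y (+) kappa z' x y.
Proof. by rewrite /kappa omegaD in_symd addbACA. Qed.

Lemma kappa_flip z x y a b : z \in evens -> nb3 x y a b ->
  kappa z x a (+) kappa z x b = (e x y \in z).
Proof. by move=> ez n3; rewrite (even_nb3 ez n3) /kappa; boolring. Qed.

Lemma kappa_side z x y a b : z \in evens -> nb3 x y a b -> e x y \notin z ->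
  kappa z x a = \big[addb/false]_(q : Y * Y) ((e q.1 q.2 \in z) && rho q.1 q.2 (inr (e x y))).
Proof.
move=> ez n3 xyz; have [xy _ _] := nb3_adj n3.
rewrite -(omega_side ez xy xyz) (degz_nb3 ez n3) /kappa (negbTE xyz).
have := even_nb3 ez n3; rewrite (negbTE xyz).
by case: (omega z x); do 2 case: (_ \in z).
Qed.

(** If [z] avoids [x y], the four corners along the edge all have the colour of its midpoint. If [z]
    contains [x y], the two sides differ at either end and one of two matchings holds. A set [z0]
    that excludes the straight matching forces the crossed one on every such [z], because
    [symd z z0] avoids the edge. *)
Lemma face_sides x y a1 a2 b1 b2 : nb3 x y a1 a2 -> nb3 y x b1 b2 ->
  face x a1 = face y b1 /\ face x a2 = face y b2 \/
  face x a1 = face y b2 /\ face x a2 = face y b1.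
Proof.
move=> nx ny.
have off z : z \in evens -> e x y \notin z ->
    [/\ kappa z x a1 = kappa z y b1, kappa z x a2 = kappa z y b2,
        kappa z x a1 = kappa z y b2 & kappa z x a2 = kappa z y b1].
  move=> ez xyz; have yxz : e y x \notin z by rewrite setUC.
  rewrite (kappa_side ez nx xyz) (kappa_side ez (nb3_swap nx) xyz).
  rewrite (kappa_side ez ny yxz) (kappa_side ez (nb3_swap ny) yxz).
  by rewrite [[set y; x]]setUC.
have flip z : z \in evens ->
    kappa z x a1 (+) kappa z x a2 = kappa z y b1 (+) kappa z y b2.
  by move=> ez; rewrite (kappa_flip ez nx) (kappa_flip ez ny) setUC.
have facesE c d c' d' : {in evens, forall z, kappa z c d = kappa z c' d'} ->
    face c d = face c' d'.
  move=> H; apply/setP => z; rewrite [LHS]in_set [RHS]in_set.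
  by case ez : (z \in evens) => //=; apply: H.
case: (boolP [exists z0, [&& z0 \in evens, e x y \in z0 & kappa z0 x a1 != kappa z0 y b1]]).
  case/existsP => z0 /and3P[ez0 xyz0 ne0]; right.
  have H z : z \in evens -> kappa z x a1 = kappa z y b2 /\ kappa z x a2 = kappa z y b1.
    move=> ez; case: (boolP (e x y \in z)) => xyz; last by case: (off z ez xyz).
    have [|D1 D2 D3 D4] := off (symd z z0) (symd_even ez ez0).
      by rewrite in_symd xyz xyz0.
    move: D1 D2 D3 D4 (flip z ez) (kappa_flip ez nx) ne0.
    rewrite !kappaD xyz.
    case: (kappa z x a1); case: (kappa z x a2); case: (kappa z y b1);
      case: (kappa z y b2); case: (kappa z0 x a1); case: (kappa z0 y b1) => //.
  by split; apply: facesE => z /H[].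
rewrite negb_exists => /forallP H; left.
have {}H z : z \in evens -> kappa z x a1 = kappa z y b1 /\ kappa z x a2 = kappa z y b2.
  move=> ez; case: (boolP (e x y \in z)) => xyz; last by case: (off z ez xyz).
  have := H z; rewrite ez xyz /= negbK => /eqP k1; split=> //.
  by have := flip z ez; rewrite k1 => /addbI.
by split; apply: facesE => z /H[].
Qed.

End PlaneMap.

(* A longest path from [x0] ends in a vertex with a second neighbour on the path. *)
Lemma long_path_cycle (T : finType) (r : rel T) (x0 x1 : T) :
  symmetric r -> irreflexive r -> r x0 x1 ->
  (forall x y, x != x0 -> r x y -> exists2 y', y' != y & r x y') ->
  exists2 c, ucycle r c & 3 <= size c.
Proof.
move=> rs ri r01 deg2.
suff grow n p : path r x0 p -> uniq (x0 :: p) -> p != [::] -> #|T| - size p <= n ->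
    exists2 c, ucycle r c & 3 <= size c.
  apply: (grow #|T| [:: x1]); rewrite /= ?r01 ?leq_subr //.
  by rewrite inE andbT; apply: contraTneq r01 => ->; rewrite ri.
elim: n p => [|n IHn] p rp up p0 le_n.
  have := max_card (mem (x0 :: p)); rewrite (card_uniqP up) /=.
  rewrite leqn0 subn_eq0 in le_n.
  by move=> /leq_trans/(_ le_n); rewrite ltnn.
case/lastP: p => [//|p y] in rp up p0 le_n *.
have := rp; rewrite rcons_path => /andP[rp' rwy].
set w := last x0 p in rwy.
have yx0 : y != x0.
  by move: up; rewrite /= mem_rcons inE negb_or eq_sym => /andP[/andP[]].
have [|y' y'w ryy'] := deg2 y w yx0; first by rewrite rs.
case: (boolP (y' \in x0 :: rcons p y)) => [y'p | y'p]; last first.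
  apply: (IHn (rcons (rcons p y) y')).
  - by rewrite rcons_path rp last_rcons.
  - by rewrite -rcons_cons rcons_uniq y'p.
  - by case: (rcons p y).
  - by move: le_n; rewrite !size_rcons; clear; lia.
have y'y : y' != y by apply: contraTneq ryy' => ->; rewrite ri.
case/splitPl def_p: _ / y'p rp up => [p1 p2 last_p1].
rewrite cat_path last_p1 -cat_cons cat_uniq => /andP[_ rp2] /and3P[_ disj up2].
have last_p2 : last y' p2 = y.
  by have := last_rcons x0 p y; rewrite def_p last_cat last_p1.
exists (y' :: p2).
  rewrite /ucycle /= rcons_path rp2 last_p2 ryy' up2 !andbT /=.
  apply/negP => y'p2; case/negP: disj; apply/hasP; exists y'; rewrite //=.
  by have := mem_last x0 p1; rewrite last_p1.
case: p2 def_p last_p2 {rp2 disj up2} => [_ /= /esym/eqP|a [|b p2]] //.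
  by rewrite eq_sym (negbTE y'y).
rewrite cats1 => /rcons_inj[def_p _] _.
by move: y'w; rewrite /w def_p last_p1 eqxx.
Qed.

(** * Cycles and edge boundaries *)

Section Cycles.
Variable Y : sgraph.
Hypothesis Ycubic : cubic Y.
Local Notation e x y := ([set x; y] : {set Y}).
Implicit Types (z : {set {set Y}}) (x y a b w : Y) (c : seq Y) (X : {set Y}).

Definition cyc_edges c : {set {set Y}} := [set e x (next c x) | x in c].

Lemma in_cyc_edges c x y : is_cycle c ->
  (e x y \in cyc_edges c) = (x \in c) && ((y == next c x) || (y == prev c x)).
Proof.
case=> /andP[_ uc] _; apply/imsetP/andP => [[w wc /set2_inj[[-> ->]|[-> ->]]]|].
- by rewrite wc eqxx.
- by rewrite mem_next wc prev_next // eqxx orbT.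
case=> xc /orP[/eqP->|/eqP->]; first by exists x.
by exists (prev c x); rewrite ?mem_prev // next_prev // setUC.
Qed.

Lemma next_neq_prev c x : is_cycle c -> x \in c -> next c x != prev c x.
Proof.
case=> /andP[_ uc] sc xc; apply/eqP => np.
have nn : next c (next c x) = x by rewrite np next_prev.
have [i c' def_c] := rot_to xc.
move: nn; rewrite -!(next_rot i uc) def_c.
have : uniq (x :: c') by rewrite -def_c rot_uniq.
have : 3 <= size (x :: c') by rewrite -def_c size_rot.
case: c' {def_c} => [|y [|w s]] //= _ /andP[xn _].
rewrite !eqxx; move: xn; rewrite !inE !negb_or => /and3P[xy xw _].
by rewrite [y == x]eq_sym (negbTE xy) => wx; rewrite wx eqxx in xw.
Qed.

Lemma degz_cyc c x : is_cycle c -> degz (cyc_edges c) x = if x \in c then 2 else 0.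
Proof.
move=> cc; rewrite /degz; case: ifP => xc; last first.
  by apply: eq_card0 => y; rewrite inE in_cyc_edges // xc.
have -> : [set y | e x y \in cyc_edges c] = [set next c x; prev c x].
  by apply/setP => y; rewrite !inE in_cyc_edges // xc.
by rewrite cards2 next_neq_prev.
Qed.

Lemma cyc_edges_even c : is_cycle c -> cyc_edges c \in evens Y.
Proof.
move=> cc; apply/evensP; split=> [|x]; last by rewrite degz_cyc //; case: ifP.
apply/subsetP => f /imsetP[x xc ->]; rewrite in_edges.
by case: cc => /andP[cyc _] _; apply: next_cycle cyc xc.
Qed.

(** At a vertex of [c] an even set inside the cycle has both edges or none, so membership spreads
    along [next]. *)
Lemma even_sub_cycle c z : is_cycle c -> z \in evens Y -> z \subset cyc_edges c ->
  z != set0 -> z = cyc_edges c.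
Proof.
move=> cc ez sz /set0Pn[f fz].
have full x : x \in c -> 0 < degz z x -> [set y | e x y \in z] = [set y | e x y \in cyc_edges c].
  move=> xc pos; apply/eqP; rewrite eqEcard; apply/andP; split.
    by apply/subsetP => y; rewrite !inE => /(subsetP sz).
  rewrite -/(degz z x) -/(degz (cyc_edges c) x) (degz_cyc _ cc) xc.
  by have /evensP[_ /(_ x)] := ez; case: (degz z x) pos => [|[]].
have next_in x : x \in c -> 0 < degz z x -> e x (next c x) \in z.
  move=> xc pos; have := full x xc pos; move/setP/(_ (next c x)).
  by rewrite !inE in_cyc_edges // xc eqxx => ->.
have /imsetP[x xc def_f] := subsetP sz f fz.
have posx : 0 < degz z x.
  by rewrite card_gt0; apply/set0Pn; exists (next c x); rewrite inE -def_f.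
have [/andP[_ uc] _] := cc.
apply/eqP; rewrite eqEsubset sz; apply/subsetP => g /imsetP[y yc ->].
apply: (next_in) => //.
have : fconnect (next c) x y by rewrite (fconnect_cycle (cycle_next uc) xc).
move/iter_findex <-; elim: (findex _ _ _) => //= n.
set w := iter n _ _ => posw.
have wc : w \in c by rewrite /w; elim: (n) => //= k; rewrite mem_next.
rewrite card_gt0; apply/set0Pn; exists w; rewrite inE setUC.
exact: next_in.
Qed.

Lemma even_has_cycle z : z \in evens Y -> z != set0 ->
  exists2 c, is_cycle c & cyc_edges c \subset z.
Proof.
move=> ez /set0Pn[f fz].
pose r : rel Y := fun a b => e a b \in z.
have /evensP[/subsetP sz _] := ez.
have [[a b]] := imsetP (sz _ fz); rewrite inE /= => ab def_f.
have [|x|||c ucr sc] := @long_path_cycle _ r a b.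
- by move=> x y; rewrite /r setUC.
- by apply/idP => /(even_adj ez); rewrite adj_irrefl.
- by rewrite /r -def_f.
- move=> x y _ xyz; have [y1 [y2 n3]] := nb3_ex Ycubic (even_adj ez xyz).
  have [_ yy1 yy2 _] := n3; have := even_nb3 ez n3; rewrite (xyz : e x y \in z).
  have [xy1 _|_ /esym xy2] := boolP (e x y1 \in z).
    by exists y1; rewrite // eq_sym.
  by exists y2; rewrite // eq_sym.
have [cyc uc] := andP ucr.
have cc : is_cycle c.
  split=> //; rewrite /ucycle uc andbT; apply: sub_cycle cyc => x y.
  exact: even_adj.
exists c => //; apply/subsetP => g /imsetP[x xc ->].
exact: (next_cycle cyc xc).
Qed.

Definition delta X : {set {set Y}} := [set f in edges Y | #|f :&: X| == 1].

Lemma in_delta X x y : adj x y -> (e x y \in delta X) = (x \in X) (+) (y \in X).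
Proof.
move=> xy; rewrite inE in_edges xy /=.
have xney : x != y by apply: contraTneq xy => ->; rewrite adj_irrefl.
rewrite setIUl cardsU.
have -> : [set x] :&: X :&: ([set y] :&: X) = set0.
  apply/setP => w; rewrite !inE; case: (eqVneq w x) => [->|] //=.
  by rewrite (negbTE xney) andbF.
have card1 a : #|[set a] :&: X| = (a \in X).
  case: (boolP (a \in X)) => aX; first by rewrite (setIidPl _) ?cards1 ?sub1set.
  by apply: eq_card0 => w; rewrite !inE; apply/andP => -[/eqP->]; apply/negP.
by rewrite cards0 subn0 !card1; do 2 case: (_ \in X).
Qed.

Lemma delta_sub_edges X : delta X \subset edges Y.
Proof. by apply/subsetP => f; rewrite inE => /andP[]. Qed.

Lemma edge_ends f : f \in edges Y -> exists a b, adj a b /\ f = e a b.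
Proof. by case/imsetP => [[a b]]; rewrite inE /= => ab ->; exists a, b. Qed.

Lemma delta_setC X : delta (~: X) = delta X.
Proof.
apply/setP => f; case fE : (f \in edges Y); last by rewrite !inE fE.
have [a [b [ab ->]]] := edge_ends fE.
by rewrite !in_delta // !inE; do 2 case: (_ \in X).
Qed.

Lemma delta_symd X X' : delta (symd X X') = symd (delta X) (delta X').
Proof.
apply/setP => f; rewrite in_symd.
case fE : (f \in edges Y); last by rewrite !inE fE.
have [a [b [ab ->]]] := edge_ends fE.
by rewrite !in_delta // !in_symd addbACA.
Qed.

Lemma card_delta1 y : #|delta [set y]| = 3.
Proof.
have -> : delta [set y] = [set e y w | w in nb y].
  apply/setP => f; apply/idP/imsetP => [fd|[w]]; last first.
    by rewrite inE => yw ->; rewrite in_delta // !inE eqxx; case: eqP yw => // ->; rewrite adj_irrefl.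
  have [a [b [ab def_f]]] := edge_ends (subsetP (delta_sub_edges _) _ fd).
  move: fd; rewrite def_f in_delta // !inE; move: ab.
  case: (eqVneq a y) => [->|_] ab; first by exists b; rewrite ?inE.
  by case: (eqVneq b y) ab => //= -> ay _; exists a; rewrite ?inE 1?adj_sym // setUC.
rewrite card_in_imset; first exact: Ycubic.
move=> a b; rewrite !inE => ya yb /set2_inj[[]//|[yb' ay]].
by move: yb; rewrite -yb' adj_irrefl.
Qed.
End Cycles.

(** * Small cuts, and duality of cuts and cycles *)

Section Cuts.
Variable Y : sgraph.
Hypothesis Ycubic : cubic Y.
Hypothesis Yc4 : cyclically_4_edge_connected Y.
Local Notation e x y := ([set x; y] : {set Y}).
Implicit Types (z : {set {set Y}}) (X : {set Y}).

Lemma graph_connected (x y : Y) : connect (@adj Y) x y.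
Proof.
have [[_ /(_ set0)]] := Yc4; rewrite cards0 => /(_ isT)[_ conn] _.
have mem0 w : w \in (~: set0 : {set Y}) by rewrite !inE.
have /connectP[p pth lst] := conn (exist _ x (mem0 x)) (exist _ y (mem0 y)).
apply/connectP; exists (map val p); rewrite -[x]/(val (exist _ x (mem0 x))).
  by elim: p (exist _ x _) pth {lst} => //= w p IHp q /andP[qw /IHp ->]; rewrite andbT.
by have := congr1 val lst; rewrite -(last_map val) /=.
Qed.

Lemma delta0 X x : x \in X -> delta X = set0 -> X = setT.
Proof.
move=> xX X0; apply/setP => y; rewrite [RHS]inE.
have /connectP[p pth ->] := graph_connected x y.
elim: p x xX pth => //= w p IHp x xX /andP[xw]; apply: IHp.
by have := in_delta X xw; rewrite X0 inE xX; case: (w \in X).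
Qed.

Lemma connect_delta_side X (x y : Y) :
  connect (@delete_adj Y (delta X)) x y -> (x \in X) = (y \in X).
Proof.
move=> /connectP[p pth ->].
elim: p x pth => //= w p IHp x /andP[/andP[xw nd] /IHp <-].
by move: nd; rewrite in_delta //; do 2 case: (_ \in X).
Qed.

(* An acyclic component of [Y - delta X] with more than one vertex has two
   vertices of degree at most [1] in it, which take up four edges of the cut. *)
Lemma small_cut_singleton X : X != set0 -> X != setT -> #|delta X| <= 3 ->
  exists y, X = [set y] \/ ~: X = [set y].
Proof.
move=> X0 XT le3; set S := delta X.
have cutS : edge_cut S by exists X.
have [_ /(_ S cutS)] := Yc4; rewrite ltnS => /(_ le3)[C [x0 defC0] acC].
have [x defC] : exists x : Y, C = [set y | connect (delete_adj S) x y] :> {set Y} by exists x0.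
pose r : rel {y | y \in C} := fun a b => delete_adj S (val a) (val b).
have rs : symmetric r by move=> a b; apply: delete_adj_sym.
have ri : irreflexive r by move=> a; apply: delete_adj_irrefl.
have inC (a : Y) b : a \in C -> delete_adj S a b -> b \in C.
  rewrite defC !inE => xa ab; apply: connect_trans xa _.
  exact: connect1.
have leaf a0 a1 : r a0 a1 -> exists (a y : {y | y \in C}), [/\ a != a0, r a y & forall y', r a y' -> y' = y].
  move=> r01; case: (boolP [exists a : {y | y \in C}, [exists y : {y | y \in C}, [&& a != a0, r a y & [forall y', r a y' ==> (y' == y)]]]]).
    case/existsP=> a /existsP[y /and3P[aa0 ay /forallP H]]; exists a, y; split=> // y' ay'.
    by apply/eqP; have := H y'; rewrite ay'.
  rewrite negb_exists => /forallP H.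
  have [|c ucr sc] := long_path_cycle rs ri r01; last by case: (acC c).
  move=> a y aa0 ay; have := H a; rewrite negb_exists => /forallP/(_ y).
  rewrite aa0 ay /= negb_forall => /existsP[y']; rewrite negb_imply => /andP[ay' y'y].
  by exists y'.
have two (a y : {y | y \in C}) : r a y -> (forall y', r a y' -> y' = y) -> exists b c,
    [/\ @adj Y (val a) b, @adj Y (val a) c, b != c, e (val a) b \in S & e (val a) c \in S].
  move=> ay uniq_y; have /andP[aya _] := ay.
  have [b [c n3]] := nb3_ex Ycubic aya; have [_ yb yc bc] := n3.
  have [_ ab ac] := nb3_adj n3; exists b, c; split=> //.
    apply: contraNT yb => nS; have ab' : delete_adj S (val a) b by rewrite /delete_adj ab.
    by have /(congr1 val)/= <- := uniq_y (exist _ b (inC _ _ (valP a) ab')) ab'.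
  apply: contraNT yc => nS; have ac' : delete_adj S (val a) c by rewrite /delete_adj ac.
  by have /(congr1 val)/= <- := uniq_y (exist _ c (inC _ _ (valP a) ac')) ac'.
have xC : x \in C by rewrite defC inE connect0.
have sideC a : a \in C -> (a \in X) = (x \in X).
  by rewrite defC inE => /connect_delta_side.
have isolated w : @adj Y x w -> e x w \in S.
  move=> xw; apply/negPn/negP => nS.
  have rxw : delete_adj S x w by rewrite /delete_adj xw.
  have [a [y [_ ay uy]]] := leaf (exist _ x xC) (exist _ w (inC _ _ xC rxw)) rxw.
  have [a' [y' [a'a a'y' uy']]] := leaf a y ay.
  have [b [c [ab ac bc Sb Sc]]] := two a y ay uy.
  have [b' [c' [ab' ac' bc' Sb' Sc']]] := two a' y' a'y' uy'.
  have aa' : val a != val a' by rewrite (inj_eq val_inj) eq_sym.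
  have cross p q : @adj Y (val a) p -> e (val a) p \in S -> e (val a) p != e (val a') q.
    move=> ap Sp; apply/eqP => /set2_inj[[/eqP]|[aq pa']]; first by rewrite (negbTE aa').
    move: Sp; rewrite in_delta // pa' !sideC ?(valP a) ?(valP a') //.
    by case: (x \in X).
  have inner (q s t : Y) : adj q s -> s != t -> e q s != e q t.
    move=> qs st; apply/eqP => /set2_inj[[_ /eqP]|[_ sq]]; first by rewrite (negbTE st).
    by rewrite sq adj_irrefl in qs.
  have : #|[set e (val a) b; e (val a) c; e (val a') b'; e (val a') c']| <= #|S|.
    by apply: subset_leq_card; rewrite !subUset !sub1set Sb Sc Sb' Sc'.
  rewrite -!setUA !cardsU1 !inE cards1.
  rewrite (negbTE (inner _ _ _ ab bc)) !(negbTE (cross _ _ _ _)) // (negbTE (inner _ _ _ ab' bc')) /=.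
  by move=> h; have := leq_trans h le3.
(* The acyclic component is the single vertex [x], whose three edges fill the cut. So [X] and
   [[set x]] have the same boundary, and by connectedness they are equal or complementary. *)
have starS : delta [set x] = delta X.
  apply/eqP; rewrite eqEcard card_delta1 // le3 andbT.
  apply/subsetP => f fd; have [a [b [ab def_f]]] := edge_ends (subsetP (delta_sub_edges _) _ fd).
  move: fd; rewrite def_f in_delta // !in_set1; move: ab.
  case: (eqVneq a x) => [->|_] ab; first by rewrite -/S isolated.
  by case: (eqVneq b x) ab => //= -> ax _; rewrite -/S setUC isolated // adj_sym.
have d0 : delta (symd X [set x]) = set0.
  by rewrite delta_symd starS; apply/setP => f; rewrite in_symd addbb in_set0.
exists x; case: (boolP (symd X [set x] == set0)) => [/eqP/setP eq0|/set0Pn[w ws]].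
  left; apply/setP => w; have := eq0 w; rewrite in_symd in_set0.
  by case: (w \in X); case: (w \in [set x]).
right; have /setP eqT := delta0 ws d0; apply/setP => v; have := eqT v.
by rewrite in_symd in_setT in_setC; case: (v \in X); case: (v \in [set x]).
Qed.

Lemma delta_ge3 X : X != set0 -> X != setT -> 3 <= #|delta X|.
Proof.
move=> X0 XT; rewrite leqNgt; apply/negP => lt3.
have [y [eq1|eq1]] := small_cut_singleton X0 XT (ltnW lt3).
  by move: lt3; rewrite eq1 card_delta1.
by move: lt3; rewrite -delta_setC eq1 card_delta1.
Qed.

(** The cut space is the orthogonal complement of the cycle space. If [x] reached [y] outside [A],
    the path closed by [x y] would be a cycle meeting [A] in exactly one edge; so the vertices that
    [x] reaches outside [A] form the side [X]. *)
Lemma orthogonal_cut (A : {set {set Y}}) x y : adj x y -> e x y \in A ->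
  (forall z, z \in evens Y -> ~~ odd #|A :&: z|) ->
  exists X, [/\ x \in X, y \notin X & delta X \subset A].
Proof.
move=> xy xyA orth; pose X := [set w | connect (delete_adj A) x w].
have xX : x \in X by rewrite inE connect0.
exists X; split=> //; last first.
  apply/subsetP => f fd; have [a [b [ab def_f]]] := edge_ends (subsetP (delta_sub_edges _) _ fd).
  move: fd; rewrite def_f in_delta //; apply: contraTT => nA.
  have csym : connect_sym (delete_adj A) by apply: sym_connect_sym; apply: delete_adj_sym.
  have cab : connect (delete_adj A) a b by apply: connect1; rewrite /delete_adj ab.
  by rewrite !inE -!(csym _ x) (same_connect csym cab) addbb.
apply/negP; rewrite inE => /connectP[p0 pth0 lst0].
case/shortenP: pth0 lst0 => p pth up _ lst.
have sp : 3 <= size (x :: p).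
  case: p pth lst {up} => [|a [|b p]] //=; first by move=> _ yx; rewrite yx adj_irrefl in xy.
  by move=> /andP[/andP[_ nA] _] ya; rewrite -ya xyA in nA.
pose r a b := delete_adj A a b || ((a == y) && (b == x)).
have cr : cycle r (x :: p).
  rewrite /= rcons_path -lst /r !eqxx orbT andbT.
  by apply: sub_path pth => a b /= ->.
have cc : is_cycle (x :: p).
  split=> //; rewrite /ucycle up andbT; apply: sub_cycle cr => a b /orP[/andP[]//|].
  by case/andP=> /eqP-> /eqP->; rewrite adj_sym.
have := orth _ (cyc_edges_even cc).
have -> : A :&: cyc_edges (x :: p) = [set e x y]; last by rewrite cards1.
apply/setP => f; rewrite !inE; apply/andP/eqP => [[fA /imsetP[w wc def_f]]|->].
  have /orP[/andP[_]|/andP[/eqP wy /eqP nx]] := next_cycle cr wc.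
    by rewrite -def_f fA.
  by rewrite def_f nx wy setUC.
split=> //; apply/imsetP; exists y; first by rewrite lst mem_last.
suff prev_x : prev (x :: p) x = y by rewrite -prev_x next_prev // prev_x setUC.
have /andP[xp _] := up.
by rewrite prev_nth mem_head (memNindex xp) lst (last_nth x).
Qed.

(** Applied below to one or two edges: every edge lies in an even set, and two edges that all even
    sets treat alike coincide. *)
Lemma orthogonal_card (A : {set {set Y}}) x y : adj x y -> e x y \in A ->
  (forall z, z \in evens Y -> ~~ odd #|A :&: z|) -> 3 <= #|A|.
Proof.
move=> xy xyA /(orthogonal_cut xy xyA)[X [xX yX dX]].
apply: leq_trans (subset_leq_card dX); apply: delta_ge3.
  by apply/set0Pn; exists x.
by apply: contraNneq yX => ->; rewrite inE.
Qed.

Lemma edge_in_even x y : adj x y -> exists2 z, z \in evens Y & e x y \in z.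
Proof.
move=> xy; case: (boolP [exists z : {set {set Y}}, (z \in evens Y) && (e x y \in z)]).
  by case/existsP => z /andP[]; exists z.
rewrite negb_exists => /forallP H.
have := @orthogonal_card [set e x y] x y xy (set11 _).
rewrite cards1 => le31; suff : 3 <= 1 by [].
apply: le31 => z ez; have := H z; rewrite ez /= => nz.
rewrite (_ : _ :&: z = set0) ?cards0 //; apply/setP => f; rewrite !inE.
by apply/andP => -[/eqP->]; apply/negP.
Qed.

Lemma edges_equal x y x' y' : adj x y -> adj x' y' ->
  (forall z, z \in evens Y -> (e x y \in z) = (e x' y' \in z)) -> e x y = e x' y'.
Proof.
move=> xy x'y' H; apply/eqP/negPn/negP => ne.
have := @orthogonal_card [set e x y; e x' y'] x y xy.
rewrite cards2 ne => /(_ (set21 _ _)) le32.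
suff : 3 <= 2 by []. apply: le32 => z ez.
have card1 f : #|[set f] :&: z| = (f \in z).
  case: (boolP (f \in z)) => fz; first by rewrite (setIidPl _) ?cards1 ?sub1set.
  by apply: eq_card0 => w; rewrite !inE; apply/andP => -[/eqP->]; apply/negP.
rewrite setIUl cardsU !card1 (_ : _ :&: _ = set0) ?cards0 ?subn0; last first.
  apply/setP => f; rewrite !inE; apply/andP => -[/andP[/eqP-> _] /andP[/eqP ff' _]].
  by rewrite ff' eqxx in ne.
by rewrite (H z ez) oddD addbb.
Qed.
End Cuts.

(** * The faces of the drawing *)

Lemma cardI_sum (T : finType) (A B : {set T}) :
  #|A :&: B| = \sum_(f in A) (f \in B).
Proof.
rewrite -sum1_card big_mkcond [RHS]big_mkcond; apply: eq_bigr => f _.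
by rewrite inE; do 2 case: (_ \in _).
Qed.

Section Dual.
Variables (V F : finType) (inc : V -> {set F}).
Implicit Types (D S : {set F}) (p q : F) (x : V).

(** Sharing a vertex suffices for adjacency in T: two faces at a vertex of a cubic graph also share
    an edge there. *)
Definition dadj p q := (p != q) && [exists x, (p \in inc x) && (q \in inc x)].

(** Connectedness through parts closed under adjacency within [D]; the empty set counts as
    connected. *)
Definition conn D : Prop := forall S, S \subset D -> S != set0 ->
  (forall p q, p \in S -> q \in D :\: S -> ~~ dadj p q) -> S = D.

(** The vertices of [Y] on the boundary of [D]. For a bond they are the vertices of a cycle, so
    counting them gives its length. *)
Definition mixed D x := (inc x :&: D != set0) && (inc x :&: ~: D != set0).

Definition bond D : Prop := [/\ D != set0, ~: D != set0, conn D & conn (~: D)].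

Lemma dadjC p q : dadj p q = dadj q p.
Proof.
by rewrite /dadj eq_sym; congr (_ && _); apply: eq_existsb => x; rewrite andbC.
Qed.

Lemma dadjP p q : reflect (p != q /\ exists x, p \in inc x /\ q \in inc x) (dadj p q).
Proof.
apply: (iffP andP) => -[pq]; first by case/existsP => x /andP[]; split=> //; exists x.
by case=> x [px qx]; split=> //; apply/existsP; exists x; rewrite px.
Qed.
End Dual.

Section Faces.
Variable Y : sgraph.
Hypothesis Ycubic : cubic Y.
Hypothesis Yc4 : cyclically_4_edge_connected Y.
Local Notation e x y := ([set x; y] : {set Y}).
Variable face : Y -> Y -> {set {set {set Y}}}.
Hypothesis face_flip : forall z x y a b, z \in evens Y -> nb3 x y a b ->
  (z \in face x a) (+) (z \in face x b) = (e x y \in z).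
Hypothesis face_sides : forall x y a1 a2 b1 b2, nb3 x y a1 a2 -> nb3 y x b1 b2 ->
  face x a1 = face y b1 /\ face x a2 = face y b2 \/
  face x a1 = face y b2 /\ face x a2 = face y b1.

Definition faces : {set {set {set {set Y}}}} :=
  [set face q.1 q.2 | q : Y * Y & adj q.1 q.2].

Local Notation fc := {f : {set {set {set Y}}} | f \in faces}.

Definition incf (x : Y) : {set fc} := [set p : fc | [exists y, adj x y && (val p == face x y)]].

Definition sel (z : {set {set Y}}) : {set fc} := [set p : fc | z \in val p].

Lemma incfP x (p : fc) : reflect (exists2 y, adj x y & val p = face x y) (p \in incf x).
Proof.
rewrite inE; apply: (iffP existsP) => [[y /andP[xy /eqP->]]|[y xy ->]]; exists y => //.
by rewrite xy eqxx.
Qed.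

Lemma face_fc x y : adj x y -> exists p : fc, val p = face x y.
Proof.
move=> xy; have pF : face x y \in faces by apply/imsetP; exists (x, y); rewrite ?inE.
by exists (exist (fun f => f \in faces) _ pF).
Qed.

Lemma fc_inc (p : fc) : exists x, p \in incf x.
Proof.
case/imsetP: (valP p) => [[x y]]; rewrite inE /= => xy px; exists x.
by apply/incfP; exists y.
Qed.

Lemma face_neq x y a b : nb3 x y a b -> face x a != face x b.
Proof.
move=> n3; have [xy _ _] := nb3_adj n3; have [z ez xyz] := edge_in_even Ycubic Yc4 xy.
apply/eqP => eq_ab; have := face_flip ez n3.
by rewrite eq_ab addbb xyz.
Qed.

(** The faces [p] and [q] are the two sides of the edge [x y]. By [edges_equal] the last clause
    determines the edge, so two faces share at most one. *)
Definition edge_faces (p q : fc) (x y : Y) : Prop :=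
  [/\ adj x y, (p \in incf x) && (q \in incf x), (p \in incf y) && (q \in incf y) &
    forall z, z \in evens Y -> (p \in sel z) (+) (q \in sel z) = (e x y \in z)].

Lemma edge_faces_nb3 x y a b (p q : fc) : nb3 x y a b ->
  val p = face x a -> val q = face x b -> edge_faces p q x y.
Proof.
move=> n3 pa qb; have [xy xa xb] := nb3_adj n3; split=> //.
- by apply/andP; split; apply/incfP; [exists a|exists b].
- have [c [d n3']] := nb3_ex Ycubic (etrans (adj_sym y x) xy).
  have [_ yc yd] := nb3_adj n3'.
  case: (face_sides n3 n3') => -[ac bd]; apply/andP; split; apply/incfP;
    by [exists c; rewrite // -?ac -?bd | exists d; rewrite // -?ac -?bd].
- by move=> z ez; rewrite -(face_flip ez n3) !inE pa qb.
Qed.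

Lemma pair_edge x (p q : fc) : p \in incf x -> q \in incf x -> p != q ->
  exists y, edge_faces p q x y.
Proof.
move=> /incfP[a xa pa] /incfP[b xb qb] pq.
have [c [d n3]] := nb3_ex Ycubic xa.
have ab : b != a by apply: contraNneq pq => ba; rewrite -(inj_eq val_inj) pa qb ba.
move: (nb3_mem b n3); rewrite xb (negbTE ab) /= => /esym/orP[]/eqP def_b.
  exists d; apply: (edge_faces_nb3 (nb3_rot (nb3_rot n3))) => //; by rewrite -def_b.
by exists c; apply: (edge_faces_nb3 (nb3_swap (nb3_rot n3))) => //; rewrite -def_b.
Qed.

Lemma edge_pair x y : adj x y -> exists p q, p != q /\ edge_faces p q x y.
Proof.
move=> xy; have [a [b n3]] := nb3_ex Ycubic xy; have [_ xa xb] := nb3_adj n3.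
have [p pa] := face_fc xa; have [q qb] := face_fc xb; exists p, q.
by rewrite -(inj_eq val_inj) pa qb (face_neq n3); split=> //; apply: edge_faces_nb3 n3 _ _.
Qed.

Lemma edge_faces_edge (p q : fc) x y x' y' :
  edge_faces p q x y -> edge_faces p q x' y' -> e x y = e x' y'.
Proof.
move=> [xy _ _ H] [xy' _ _ H']; apply: (edges_equal Ycubic Yc4) => // z ez.
by rewrite -H // H'.
Qed.

Lemma pair_common (p q : fc) x y x' : p != q -> edge_faces p q x y ->
  (p \in incf x') && (q \in incf x') = (x' == x) || (x' == y).
Proof.
move=> pq H; have [_ px py _] := H; apply/idP/idP => [/andP[px' qx']|].
  have [y' H'] := pair_edge px' qx' pq.
  by have [[-> _]|[_ ->]] := set2_inj (edge_faces_edge H H'); rewrite eqxx ?orbT.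
by case/orP=> /eqP->.
Qed.

Lemma nb3_inc x y a b : nb3 x y a b -> exists p q r : fc,
  [/\ [&& p != q, p != r & q != r], incf x = [set p; q; r],
      edge_faces q r x y, edge_faces p r x a & edge_faces p q x b].
Proof.
move=> n3; have [xy xa xb] := nb3_adj n3.
have [p py] := face_fc xy; have [q qa] := face_fc xa; have [r rb] := face_fc xb.
exists p, q, r; split.
- rewrite -!(inj_eq val_inj) py qa rb (face_neq n3).
  by rewrite (face_neq (nb3_swap (nb3_rot n3))) (face_neq (nb3_rot (nb3_rot n3))).
- have vE (s t : fc) : (s == t) = (val s == val t) by [].
  apply/setP => s; rewrite in_setU in_set2 in_set1 !vE py qa rb.
  apply/incfP/idP => [[w xw ->]|].
    by rewrite (nb3_mem w n3) in xw; case/or3P: xw => /eqP->; rewrite eqxx ?orbT.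
  by rewrite -orbA => /or3P[]/eqP->; [exists y|exists a|exists b].
- exact: edge_faces_nb3 n3 qa rb.
- exact: edge_faces_nb3 (nb3_swap (nb3_rot n3)) py rb.
- exact: edge_faces_nb3 (nb3_rot (nb3_rot n3)) py qa.
Qed.

Lemma card_incf x : #|incf x| = 3.
Proof.
have [y xy] : exists y, adj x y.
  have : 0 < #|[set y | adj x y]| by rewrite Ycubic.
  by case/card_gt0P => y; rewrite inE; exists y.
have [a [b n3]] := nb3_ex Ycubic xy.
have [p [q [r [/and3P[pq pr qr] -> _ _ _]]]] := nb3_inc n3.
by rewrite -setUA !cardsU1 !inE cards1 negb_or pq pr qr.
Qed.

(** A third common face [r] would make [x y] the common edge of all three pairs among [p], [q], [r].
    An even set through [x y] would then separate each pair, which two colours cannot do. *)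
Lemma edge_faces_inc (p q : fc) x y : p != q -> edge_faces p q x y ->
  incf x :&: incf y = [set p; q].
Proof.
move=> pq H; have [xy /andP[px qx] /andP[py qy] _] := H.
apply/eqP; rewrite eq_sym eqEcard; apply/andP; split.
  by rewrite subUset !sub1set !in_setI px py qx qy.
rewrite cards2 pq leqNgt; apply/negP => gt2.
have full : incf x :&: incf y = incf x.
  by apply/eqP; rewrite eqEcard subsetIl card_incf.
have [r] : exists r, r \in incf x :\: [set p; q].
  apply/set0Pn; rewrite -card_gt0 cardsD card_incf.
  rewrite subn_gt0 (leq_ltn_trans (subset_leq_card (subsetIr _ _))) //.
  by rewrite cards2 pq.
rewrite in_setD in_set2 negb_or => /andP[/andP[rp rq] rx].
have ry : r \in incf y.
  have : r \in incf x :&: incf y by rewrite full.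
  by rewrite in_setI => /andP[].
have same s t : s != t -> s \in incf x -> t \in incf x -> s \in incf y -> t \in incf y ->
    forall z, z \in evens Y -> (s \in sel z) (+) (t \in sel z) = (e x y \in z).
  move=> st sx tx sy ty; have [w Hw] := pair_edge sx tx st.
  have := pair_common y st Hw; rewrite sy ty => /esym/orP[]/eqP yw.
    by rewrite yw adj_irrefl in xy.
  by case: Hw => _ _ _; rewrite -yw.
have [z ez xyz] := edge_in_even Ycubic Yc4 xy.
have [pr qr] : p != r /\ q != r by rewrite ![_ == r]eq_sym rp rq.
have := same p q pq px qx py qy z ez; have := same p r pr px rx py ry z ez.
have := same q r qr qx rx qy ry z ez.
by rewrite xyz; do 3 case: (_ \in sel z).
Qed.

Lemma edge_sel z x y : z \in evens Y -> adj x y ->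
  (e x y \in z) = (#|incf x :&: incf y :&: sel z| == 1).
Proof.
move=> ez xy; have [p [q [pq H]]] := edge_pair xy.
rewrite (edge_faces_inc pq H); have [_ _ _ <- //] := H.
rewrite setIUl cardsU.
have card1 f : #|[set f] :&: sel z| = (f \in sel z).
  case: (boolP (f \in sel z)) => fz; first by rewrite (setIidPl _) ?cards1 ?sub1set.
  by apply: eq_card0 => w; rewrite !in_setI in_set1; apply/andP => -[/eqP->]; apply/negP.
rewrite (_ : _ :&: sel z :&: _ = set0) ?cards0 ?subn0 ?card1; last first.
  apply/setP => f; rewrite !in_setI !in_set1 in_set0; apply/andP => -[/andP[/eqP-> _] /andP[/eqP eq_pq _]].
  by rewrite eq_pq eqxx in pq.
by do 2 case: (_ \in sel z).
Qed.
(** Every even set contains an even number of the three common edges, so they contain a cut, and no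
    cut has fewer than three edges. A cut of three edges surrounds a single vertex [y], and all
    three faces meet there. *)
Lemma triangle_inc (p q r : fc) : dadj incf p q -> dadj incf q r -> dadj incf p r ->
  exists y, incf y = [set p; q; r].
Proof.
move=> /dadjP[pq [x1 [px1 qx1]]] /dadjP[qr [x2 [qx2 rx2]]] /dadjP[pr [x3 [px3 rx3]]].
have [y1 H1] := pair_edge px1 qx1 pq.
have [y2 H2] := pair_edge qx2 rx2 qr.
have [y3 H3] := pair_edge px3 rx3 pr.
have [a1 _ _ E1] := H1; have [a2 _ _ E2] := H2; have [a3 _ _ E3] := H3.
have sum z : z \in evens Y -> (e x1 y1 \in z) (+) (e x2 y2 \in z) = (e x3 y3 \in z).
  by move=> ez; rewrite -E1 // -E2 // -E3 //; do 3 case: (_ \in sel z).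
have n12 : e x1 y1 != e x2 y2.
  have [z ez xz] := edge_in_even Ycubic Yc4 a3; apply/eqP => eq12.
  by have := sum z ez; rewrite eq12 addbb xz.
have n13 : e x1 y1 != e x3 y3.
  have [z ez xz] := edge_in_even Ycubic Yc4 a2; apply/eqP => eq13.
  by have := sum z ez; rewrite eq13 xz; case: (_ \in z).
have n23 : e x2 y2 != e x3 y3.
  have [z ez xz] := edge_in_even Ycubic Yc4 a1; apply/eqP => eq23.
  by have := sum z ez; rewrite eq23 xz; case: (_ \in z).
pose A := [set e x1 y1; e x2 y2; e x3 y3].
have sumA (G : {set Y} -> nat) : \sum_(f in A) G f = G (e x1 y1) + (G (e x2 y2) + G (e x3 y3)).
  rewrite /A -setUA big_setU1 ?big_setU1 ?big_set1 //=; first by rewrite inE.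
  by rewrite !inE negb_or n12.
have cA : #|A| = 3 by rewrite -sum1_card sumA.
have [||X [xX yX dX]] := @orthogonal_cut Y A x1 y1 a1; first by rewrite /A !inE eqxx.
  by move=> z ez; rewrite cardI_sum sumA -(sum z ez); do 2 case: (_ \in z).
have X0 : X != set0 by apply/set0Pn; exists x1.
have XT : X != setT by apply: contraNneq yX => ->; rewrite inE.
have dXA : delta X = A.
  by apply/eqP; rewrite eqEcard dX cA (delta_ge3 Ycubic Yc4).
have [|y Xy] := small_cut_singleton Ycubic Yc4 X0 XT; first by rewrite dXA cA.
have {dXA Xy} dA : delta [set y] = A.
  by case: Xy => Xy; rewrite -Xy ?delta_setC.
have at_y x w s t : edge_faces s t x w -> e x w \in A -> s \in incf y /\ t \in incf y.
  move=> [xw /andP[sx tx] /andP[sw tw] _]; rewrite -dA in_delta // !in_set1.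
  by case: eqP => [<-|_] //=; case: eqP => [<-|].
have [py qy] : p \in incf y /\ q \in incf y by apply: (at_y _ _ _ _ H1); rewrite !inE eqxx.
have [_ ry] : q \in incf y /\ r \in incf y.
  by apply: (at_y _ _ _ _ H2); rewrite !inE eqxx ?orbT.
exists y; apply/eqP; rewrite eq_sym eqEcard card_incf !subUset !sub1set py qy ry /=.
by rewrite -setUA !cardsU1 !inE cards1 negb_or pq pr qr.
Qed.

Definition efaces (f : {set Y}) : {set fc} := \bigcap_(x in f) incf x.

Lemma efacesE x y : efaces (e x y) = incf x :&: incf y.
Proof. by rewrite /efaces bigcap_setU !big_set1. Qed.

Definition bnd (D : {set fc}) : {set {set Y}} :=
  [set f in edges Y | #|efaces f :&: D| == 1].

Lemma bnd_sub D : bnd D \subset edges Y.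
Proof. by apply/subsetP => f; rewrite inE => /andP[]. Qed.

Lemma in_bnd (p q : fc) x y D : p != q -> edge_faces p q x y ->
  (e x y \in bnd D) = (p \in D) (+) (q \in D).
Proof.
move=> pq H; have [xy _ _ _] := H.
rewrite inE in_edges xy efacesE (edge_faces_inc pq H) /= cardI_sum big_setU1 ?inE //=.
by rewrite big_set1; do 2 case: (_ \in D).
Qed.

Lemma bnd_sel z : z \in evens Y -> bnd (sel z) = z.
Proof.
move=> ez; apply/setP => f; case fE : (f \in edges Y); last first.
  rewrite inE fE; apply/esym/negP => fz; have /evensP[/subsetP sz _] := ez.
  by rewrite sz in fE.
have [x [y [xy ->]]] := edge_ends fE.
by rewrite (edge_sel ez xy) inE in_edges xy efacesE.
Qed.

Lemma bndC D : bnd (~: D) = bnd D.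
Proof.
apply/setP => f; case fE : (f \in edges Y); last by rewrite !inE fE.
have [x [y [xy ->]]] := edge_ends fE; have [p [q [pq H]]] := edge_pair xy.
by rewrite !(in_bnd _ pq H) !inE; do 2 case: (_ \in D).
Qed.

Lemma degz_bnd D x : degz (bnd D) x = if mixed incf D x then 2 else 0.
Proof.
have [y xy] : exists y, adj x y.
  have : 0 < #|[set y | adj x y]| by rewrite Ycubic.
  by case/card_gt0P => y; rewrite inE; exists y.
have [a [b n3]] := nb3_ex Ycubic xy.
have [p [q [r [/and3P[pq pr qr] incx H1 H2 H3]]]] := nb3_inc n3.
rewrite (degz_sub_nb3 (bnd_sub D) n3) (in_bnd _ qr H1) (in_bnd _ pr H2) (in_bnd _ pq H3).
have meet (B : {set fc}) : (incf x :&: B != set0) = [|| p \in B, q \in B | r \in B].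
  apply/set0Pn/idP => [[s]|].
    by rewrite incx !inE -orbA => /andP[/or3P[]/eqP-> ->]; rewrite ?orbT.
  by case/or3P => sB; [exists p|exists q|exists r]; rewrite incx !inE eqxx ?orbT.
rewrite /mixed !meet !inE.
by case: (p \in D); case: (q \in D); case: (r \in D).
Qed.

Lemma bnd_even D : bnd D \in evens Y.
Proof.
by apply/evensP; split=> [|x]; rewrite ?bnd_sub // degz_bnd; case: ifP.
Qed.

(** A closed part is carried along walks of [Y]: consecutive vertices share two faces, and at least
    one of them is outside [A]. *)
Lemma connC_small (A : {set fc}) : #|A| <= 1 -> conn incf (~: A).
Proof.
move=> A1 S SA /set0Pn[p0 p0S] closed.
have [x0 p0x] := fc_inc p0.
pose P x := incf x :&: S != set0.
have fill x : P x -> incf x :\: A \subset S.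
  move=> /set0Pn[p]; rewrite in_setI => /andP[px pS]; apply/subsetP => q.
  rewrite in_setD => /andP[qA qx]; apply/negPn/negP => qS.
  have := closed p q pS; rewrite in_setD qS in_setC qA => /(_ isT)/negP[].
  by apply/dadjP; split; [apply: contraNneq qS => <- | exists x].
have all_P x : P x.
  have /connectP[w pth ->] := graph_connected Yc4 x0 x.
  have : P x0 by apply/set0Pn; exists p0; rewrite in_setI p0x.
  elim: w (x0) pth => //= y w IHw v /andP[vy pth] Pv; apply: IHw => //.
  have [p [q [pq H]]] := edge_pair vy; have [_ /andP[pv qv] /andP[py qy] _] := H.
  have sub := subsetP (fill v Pv).
  case: (boolP (p \in A)) => pA; last first.
    by apply/set0Pn; exists p; rewrite in_setI py sub // in_setD pA.
  apply/set0Pn; exists q; rewrite in_setI qy sub // in_setD qv andbT.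
  apply: contraTN A1 => qA; rewrite -ltnNge.
  have <- : #|[set p; q]| = 2 by rewrite cards2 pq.
  by apply: subset_leq_card; rewrite subUset !sub1set pA.
apply/eqP; rewrite eqEsubset SA; apply/subsetP => q; rewrite in_setC => qA.
have [x qx] := fc_inc q.
by apply: (subsetP (fill x (all_P x))); rewrite in_setD qA.
Qed.

Lemma bnd_eq0 (S : {set fc}) : S != set0 -> bnd S = set0 -> S = setT.
Proof.
move=> S0 b0; have := @connC_small set0; rewrite cards0 setC0 => /(_ isT); apply=> //.
move=> p q pS; rewrite in_setD => /andP[qS _]; apply/negP => /dadjP[pq [x [px qx]]].
have [y H] := pair_edge px qx pq.
by have := in_bnd S pq H; rewrite b0 in_set0 pS (negbTE qS).
Qed.

Lemma mixed_cyc D c x : is_cycle c -> bnd D = cyc_edges c -> mixed incf D x = (x \in c).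
Proof.
move=> cc bD; have := degz_bnd D x; rewrite bD degz_cyc //.
by case: (mixed _ _ _); case: (x \in c).
Qed.

(** The boundary of a closed part [S] is an even subset of the cycle, hence empty or everything. In
    the first case [S] consists of all faces; in the second [D :\: S] has no boundary and misses
    [S], so it is empty. *)
Lemma conn_of_cycle D c : is_cycle c -> bnd D = cyc_edges c -> conn incf D.
Proof.
move=> cc bD S SD S0 closed; have [bS0|bS0] := eqVneq (bnd S) set0.
  by apply/eqP; rewrite eqEsubset SD (bnd_eq0 S0 bS0) subsetT.
have sub : bnd S \subset bnd D.
  apply/subsetP => f fS; have [x [y [xy def_f]]] := edge_ends (subsetP (bnd_sub _) _ fS).
  have [p [q [pq H]]] := edge_pair xy; move: fS; rewrite def_f !(in_bnd _ pq H).
  have [_ /andP[px qx] _ _] := H.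
  have dpq : dadj incf p q by apply/dadjP; split=> //; exists x.
  have dqp : dadj incf q p by rewrite dadjC.
  case: (boolP (p \in S)) => pS; case: (boolP (q \in S)) => qS //= _.
    rewrite (subsetP SD) //=; apply/negP => qD.
    by have := closed p q pS; rewrite in_setD qS qD dpq => /(_ isT).
  rewrite addbC (subsetP SD) //=; apply/negP => pD.
  by have := closed q p qS; rewrite in_setD pS pD dqp => /(_ isT).
have eqb : bnd S = bnd D by rewrite bD; apply: even_sub_cycle; rewrite -?bD ?bnd_even.
have b0 : bnd (D :\: S) = set0.
  apply/setP => f; rewrite in_set0; apply/negP => fS.
  have [x [y [xy def_f]]] := edge_ends (subsetP (bnd_sub _) _ fS).
  have [p [q [pq H]]] := edge_pair xy; move: fS.
  have /setP/(_ f) := eqb; rewrite def_f !(in_bnd _ pq H) !in_setD.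
  have : (p \in S) ==> (p \in D) by apply/implyP/(subsetP SD).
  have : (q \in S) ==> (q \in D) by apply/implyP/(subsetP SD).
  by case: (p \in S); case: (q \in S); case: (p \in D); case: (q \in D).
have [DS0|DS0] := eqVneq (D :\: S) set0.
  by apply/eqP; rewrite eqEsubset SD -setD_eq0 DS0 eqxx.
have /setP eqT := bnd_eq0 DS0 b0; case/set0Pn: S0 => p pS.
by have := eqT p; rewrite in_setD pS inE.
Qed.

(** The boundary of [D] contains some cycle [c]. No edge of [c] lies inside [D] or inside its
    complement, so each of these connected sets stays on one side of [c], and [c] is the whole
    boundary. *)
Lemma bond_cycle D : bond incf D ->
  exists2 c, is_cycle c & forall x, (x \in c) = mixed incf D x.
Proof.
move=> [D0 DC0 cD cDC].
have bD0 : bnd D != set0.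
  by apply: contraNneq DC0 => /(bnd_eq0 D0) ->; rewrite setCT.
have [c cc sub] := even_has_cycle Ycubic (bnd_even D) bD0.
exists c => // x; set z := cyc_edges c in sub; have ez : z \in evens Y := cyc_edges_even cc.
have z0 : z != set0.
  by apply/set0Pn; case: c cc {sub ez} @z => [|w c]; [case|exists (e w (next (w :: c) w)); apply/imsetP; exists w; rewrite ?mem_head].
have cut (B : {set fc}) : conn incf B -> bnd B = bnd D -> B \subset sel z \/ B \subset ~: sel z.
  move=> cB bB; have [BS0|BS0] := eqVneq (B :&: sel z) set0.
    right; apply/subsetP => p pB; rewrite in_setC; apply/negP => pS.
    by have := in_set0 p; rewrite -BS0 in_setI pB pS.
  left; have /cB H : B :&: sel z \subset B by apply: subsetIl.
  rewrite -H ?subsetIr // => p q; rewrite in_setI in_setD in_setI => /andP[pB pS].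
  move=> /andP[qS qB]; rewrite qB /= in qS; apply/negP => /dadjP[pq [w [pw qw]]].
  have [y Hy] := pair_edge pw qw pq; have [_ _ _ /(_ z ez)] := Hy.
  rewrite pS (negbTE qS) => /esym/(subsetP sub).
  by rewrite -bB (in_bnd _ pq Hy) pB qB.
have bS := bnd_sel ez.
have bDz : bnd D = z.
  have [DS|DS] := cut D cD erefl; have [CS|CS] := cut (~: D) cDC (bndC D).
  - have ST : sel z = ~: set0 by apply/setP => p; rewrite setC0 in_setT; case: (boolP (p \in D)) => pD; [rewrite (subsetP DS)|rewrite (subsetP CS) // in_setC].
    by case/negP: z0; rewrite -bS ST bndC; apply/eqP/setP => f; rewrite !inE setI0 cards0 andbF.
  - suff -> : D = sel z by [].
    by apply/eqP; rewrite eqEsubset DS -setCS.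
  - suff E : ~: D = sel z by rewrite -bndC E.
    by apply/eqP; rewrite eqEsubset CS -setCS setCK.
  - have S0 : sel z = set0.
      apply/setP => p; rewrite in_set0; apply/negP => pS.
      case: (boolP (p \in D)) => pD; first by have := subsetP DS p pD; rewrite in_setC pS.
      by have := subsetP CS p; rewrite !in_setC pD pS => /(_ isT).
    by case/negP: z0; rewrite -bS S0; apply/eqP/setP => f; rewrite !inE setI0 cards0 andbF.
by rewrite (mixed_cyc _ cc bDz).
Qed.

(** A vertex off the cycle has all its faces on one side. The vertices [u] and [v] share a face, so
    they agree on that side, and [D] is the other one. *)
Lemma cycle_bond c u v : is_cycle c -> adj u v -> u \notin c -> v \notin c ->
  exists D, [/\ bond incf D, incf u \subset ~: D, incf v \subset ~: D &
    forall x, mixed incf D x = (x \in c)].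
Proof.
move=> cc uv uc vc; have ez := cyc_edges_even cc; have bS := bnd_sel ez.
pose S := sel (cyc_edges c).
have mono x : x \notin c -> incf x \subset S \/ incf x \subset ~: S.
  move=> /negbTE xc; have := mixed_cyc x cc bS; rewrite xc /mixed => /negbT.
  rewrite negb_and !negbK => /orP[]/eqP H; [right|left]; apply/subsetP => p px.
    rewrite in_setC; apply/negP => pS; have := in_set0 p; by rewrite -H in_setI px pS.
  apply/negPn/negP => pS; have := in_set0 p; by rewrite -H in_setI px in_setC pS.
suff [D bD [uD vD]] : exists2 D, bnd D = cyc_edges c & incf u \subset ~: D /\ incf v \subset ~: D.
  have mD x : mixed incf D x = (x \in c) := mixed_cyc x cc bD.
  exists D; split=> //; split; last 2 first.
  - exact: conn_of_cycle cc bD.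
  - by apply: (conn_of_cycle cc); rewrite bndC.
  - case: c cc mD {uc vc bS ez bD S mono} => [[]//|x c] _ /(_ x).
    by rewrite mem_head => /andP[+ _]; apply: contraNneq => ->; rewrite setI0.
  - case: c cc mD {uc vc bS ez bD S mono} => [[]//|x c] _ /(_ x).
    by rewrite mem_head => /andP[_]; apply: contraNneq => ->; rewrite setI0.
have [p [q [pq [_ /andP[pu _] /andP[pv _] _]]]] := edge_pair uv.
have [uS|uS] := mono u uc; have [vS|vS] := mono v vc.
- by exists (~: S); rewrite ?bndC ?setCK.
- by have := subsetP vS p pv; rewrite in_setC (subsetP uS).
- by have := subsetP uS p pu; rewrite in_setC (subsetP vS).
- by exists S.
Qed.
(** An even set is recovered from its bipartition of the faces; taking the part without [p0] removes
    the choice between the two parts. *)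
Lemma card_evens_le : #|evens Y| <= 2 ^ #|{: fc}|.-1.
Proof.
case: (pickP {: Y}) => [x0 _|Y0]; last first.
  have := card_incf; have [[Y4 _] _] := Yc4.
  by rewrite (eq_card0 Y0) in Y4.
have [p0 _] : exists p0, p0 \in incf x0 by apply/card_gt0P; rewrite card_incf.
pose norm z := if p0 \in sel z then ~: sel z else sel z.
have normK : {in evens Y, cancel norm bnd}.
  by move=> z ez; rewrite /norm; case: ifP => _; rewrite ?bndC bnd_sel.
rewrite -(card_in_imset (can_in_inj normK)) -(cardsC1 p0) -card_powerset.
apply/subset_leq_card/subsetP => _ /imsetP[z _ ->].
rewrite powersetE; apply/subsetP => p; rewrite in_setC1 /norm.
by case: ifP => p0z; apply: contraTneq => ->; rewrite ?in_setC p0z.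
Qed.

Definition odd_verts (A : {set {set Y}}) := [set x | odd (degz A x)].

Lemma odd_vertsD A B : odd_verts (symd A B) = symd (odd_verts A) (odd_verts B).
Proof.
apply/setP => x; rewrite in_symd !inE /degz !cardsE -!xor_card -big_split.
by apply: eq_bigr => y _; apply: (in_symd A B (e x y)).
Qed.

Lemma card_odd_verts (A : {set {set Y}}) : A \subset edges Y -> ~~ odd #|odd_verts A|.
Proof.
move=> /subsetP sA; rewrite cardsE -xor_card.
rewrite (eq_bigr (fun x => \big[addb/false]_y (e x y \in A))); last first.
  by move=> x _; rewrite /degz cardsE -xor_card.
rewrite pair_big /= (xor_symmetric (F := fun x y => e x y \in A)) // => [x y|x].
  by rewrite setUC.
by apply/negP => /sA; rewrite in_edges adj_irrefl.
Qed.

(** Rank and nullity of the boundary map: [odd_verts] has even size, so its part off [x0] determines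
    it, and two edge sets with the same [odd_verts] differ by an even set. *)
Lemma card_edge_sets : 2 ^ #|edges Y| <= 2 ^ #|Y|.-1 * #|evens Y|.
Proof.
case: (pickP {: Y}) => [x0 _|Y0]; last first.
  by have [[Y4 _] _] := Yc4; rewrite (eq_card0 Y0) in Y4.
pose rep B : {set {set Y}} :=
  odflt set0 [pick A : {set {set Y}} | (A \subset edges Y) && (odd_verts A == B)].
have repP (A : {set {set Y}}) : A \subset edges Y ->
    rep (odd_verts A) \subset edges Y /\ odd_verts (rep (odd_verts A)) = odd_verts A.
  move=> sA; rewrite /rep; case: pickP => [B /andP[sB /eqP eB]|/(_ A)] //=.
  by rewrite sA eqxx.
pose g (A : {set {set Y}}) := (odd_verts A :\ x0, symd A (rep (odd_verts A))).
have g_inj : {in powerset (edges Y) &, injective g}.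
  move=> A B; rewrite !powersetE => sA sB [eqx eqs].
  have {eqx}eqAB : odd_verts A = odd_verts B.
    have := card_odd_verts sA; have := card_odd_verts sB.
    rewrite (cardsD1 x0 (odd_verts A)) (cardsD1 x0 (odd_verts B)) eqx !oddD !oddb.
    move=> parA parB; have x0AB : (x0 \in odd_verts A) = (x0 \in odd_verts B).
      by move: parA parB; do 2 case: (x0 \in _); case: (odd _).
    apply/setP => y; have /setP/(_ y) := eqx; rewrite !in_setD1.
    by case: eqP => //= ->.
  apply/setP => f; have /setP/(_ f) := eqs.
  by rewrite !in_symd eqAB => /addIb.
rewrite -card_powerset -(card_in_imset g_inj) -(cardsC1 x0) -card_powerset -cardsX.
apply/subset_leq_card/subsetP => _ /imsetP[A sA ->]; rewrite powersetE in sA.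
have [sR eR] := repP A sA.
rewrite in_setX powersetE /=; apply/andP; split.
  by apply/subsetP => y; rewrite in_setD1 in_setC1 => /andP[].
apply/evensP; split.
  apply/subsetP => f; rewrite in_symd.
  by case: (boolP (f \in A)) => [/(subsetP sA)//|_ /(subsetP sR)].
move=> y; have := in_set0 y; have <- : odd_verts (symd A (rep (odd_verts A))) = set0.
  by rewrite odd_vertsD eR; apply/setP => w; rewrite in_symd addbb in_set0.
by rewrite inE => ->.
Qed.

Lemma card_darts : 3 * #|Y| <= 2 * #|edges Y|.
Proof.
have -> : 3 * #|Y| = #|[set q : Y * Y | adj q.1 q.2]|.
  rewrite -sum1_card (eq_bigl (fun q : Y * Y => true && adj q.1 q.2)); last by move=> q; rewrite inE.
  rewrite -(pair_big_dep xpredT (fun x y => adj x y) (fun _ _ => 1)) /=.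
  rewrite (eq_bigr (fun=> 3)); first by rewrite sum_nat_const mulnC.
  by move=> x _; rewrite sum1_card -(Ycubic x) cardsE.
pose g (q : Y * Y) := (e q.1 q.2, enum_rank q.1 < enum_rank q.2).
have g_inj : {in [set q : Y * Y | adj q.1 q.2] &, injective g}.
  move=> [x y] [x' y']; rewrite !inE /= => xy xy' [/set2_inj[[-> ->]//|[xy1 yx1]] lt_eq].
  have : enum_rank x != enum_rank y.
    by rewrite (inj_eq enum_rank_inj); apply: contraTneq xy => ->; rewrite adj_irrefl.
  rewrite -(inj_eq val_inj) /=; move: lt_eq; rewrite -xy1 -yx1.
  by case: ltngtP => // eq_r _ /negP[].
rewrite -(card_in_imset g_inj).
have -> : 2 * #|edges Y| = #|setX (edges Y) [set: bool]|.
  by rewrite cardsX cardsT card_bool mulnC.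
apply/subset_leq_card/subsetP => f /imsetP[[x y] + ->]; rewrite inE /= => xy.
by rewrite in_setX in_setT in_edges xy.
Qed.

(** With V, E, F for the numbers of vertices, edges and faces, the two bounds on the cycle space
    give [E - (V - 1) <= F - 1], and [3 * V <= 2 * E] eliminates E. *)
Lemma euler_faces : #|Y| + 4 <= 2 * #|{: fc}|.
Proof.
have := leq_trans card_edge_sets (leq_mul (leqnn _) card_evens_le).
rewrite -expnD leq_exp2l // => le_e; have le_d := card_darts.
have [[Y4 _] _] := Yc4.
have [x _] : exists x : Y, true by case: (pickP {: Y}) => [x|Y0]; [exists x|rewrite (eq_card0 Y0) in Y4].
have [p _] : exists p, p \in incf x by apply/card_gt0P; rewrite card_incf.
have F1 : 0 < #|{: fc}| by apply/card_gt0P; exists p.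
lia.
Qed.
End Faces.

(** * Bonds of the dual triangulation *)

Section Connectivity.
Variables (V F : finType) (inc : V -> {set F}).
Implicit Types (D S R : {set F}) (p q : F) (x : V).
Local Notation dadj := (dadj inc).
Local Notation conn := (conn inc).

Lemma conn1 p : conn [set p].
Proof.
move=> S /subsetP Sp /set0Pn[q qS] _; apply/eqP; rewrite eqEsubset.
apply/andP; split; first by apply/subsetP.
by have := Sp q qS; rewrite inE => /eqP <-; rewrite sub1set.
Qed.

Lemma conn_add D p q : conn D -> q \in D -> dadj p q -> conn (p |: D).
Proof.
move=> cD qD pq S SD S0 closed.
have qS_D : q \in S -> D \subset S.
  move=> qS; rewrite -(cD (D :&: S)) ?subsetIl ?subsetIr //.
    by apply/set0Pn; exists q; rewrite inE qD.
  move=> a b; rewrite !inE => /andP[aD aS] /andP[+ bD]; rewrite bD /= => bS.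
  by apply: closed => //; rewrite !inE bS bD orbT.
have pS_D : p \in S -> q \in S.
  move=> pS; apply/negPn/negP => qS; have := closed p q pS.
  by rewrite !inE qS qD orbT pq => /(_ isT).
have D_pS : q \in S -> p \in S.
  move=> qS; apply/negPn/negP => pS; have := closed q p qS.
  by rewrite !inE pS eqxx dadjC pq => /(_ isT).
have qS : q \in S.
  apply/negPn/negP => qS; have pS : p \notin S by apply: contra qS.
  have SsubD : S \subset D.
    apply/subsetP => s sS; have := subsetP SD s sS; rewrite !inE.
    by case/orP=> // /eqP sp; rewrite -sp sS in pS.
  have eqSD : S = D.
    apply: cD => // a b aS; rewrite inE => /andP[bS bD]; apply: closed => //.
    by rewrite !inE bS bD orbT.
  by rewrite eqSD qD in qS.
by apply/eqP; rewrite eqEsubset SD subUset sub1set D_pS // qS_D.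
Qed.

Definition restr D : rel F := fun a b => [&& a \in D, b \in D & dadj a b].

Definition component D p : {set F} := [set q | connect (restr D) p q].

Lemma restr_sym D : connect_sym (restr D).
Proof.
apply: sym_connect_sym => a b; rewrite /restr dadjC.
by case: (a \in D); case: (b \in D).
Qed.

Lemma mem_comp D p : p \in component D p. Proof. by rewrite inE connect0. Qed.

Lemma comp_sub D p : p \in D -> component D p \subset D.
Proof.
move=> pD; apply/subsetP => q; rewrite inE => /connectP[s pth ->].
by elim: s p pD pth => //= a s IHs p pD /andP[/and3P[_ aD _]]; apply: IHs.
Qed.

Lemma comp_closed D p a b : p \in D -> a \in component D p -> b \in D -> dadj a b -> b \in component D p.
Proof.
move=> pD aC bD ab; have aD := subsetP (comp_sub pD) a aC.
move: aC; rewrite !inE => pa; apply: connect_trans pa (connect1 _).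
by rewrite /restr aD bD.
Qed.

Lemma comp_conn D p : p \in D -> conn (component D p).
Proof.
move=> pD S SC /set0Pn[s sS] closed.
have step a b : a \in S -> restr D a b -> b \in S.
  move=> aS /and3P[aD bD ab]; apply/negPn/negP => bS.
  have := closed a b aS; rewrite inE bS (comp_closed pD _ bD ab) ?(subsetP SC) //.
  by rewrite ab => /(_ isT).
apply/eqP; rewrite eqEsubset SC; apply/subsetP => q qC.
have : connect (restr D) s q.
  move: qC (subsetP SC s sS); rewrite !inE => pq ps.
  by apply: connect_trans pq; rewrite restr_sym.
case/connectP => w pth ->; elim: w s sS pth => //= a w IHw s sS /andP[sa].
exact: IHw (step _ _ sS sa).
Qed.

Lemma conn_comp D p : conn D -> p \in D -> component D p = D.
Proof.
move=> cD pD; apply: cD; first exact: comp_sub.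
  by apply/set0Pn; exists p; apply: mem_comp.
move=> a b aC; rewrite inE => /andP[bC bD]; apply: contra bC.
exact: comp_closed.
Qed.

End Connectivity.

Section Bonds.
Variables (V F : finType) (inc : V -> {set F}).
Implicit Types (D S R O : {set F}) (p q : F) (x : V).
Local Notation dadj := (dadj inc).
Local Notation conn := (conn inc).
Local Notation bond := (bond inc).
Local Notation mixed := (mixed inc).
Hypothesis card_inc : forall x, #|inc x| = 3.
Hypothesis inc_face : forall p, exists x, p \in inc x.
Hypothesis connC_small : forall A : {set F}, #|A| <= 1 -> conn (~: A).
Hypothesis card_pair : forall p q, dadj p q -> #|[set x | (p \in inc x) && (q \in inc x)]| = 2.

Definition fdeg p := #|[set x | p \in inc x]|.
Definition len D := #|[set x | mixed D x]|.
Definition nbf p := [set q | dadj p q].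

Lemma dadj_neq p q : dadj p q -> p != q. Proof. by case/andP. Qed.

Lemma dadj_irr p : dadj p p = false. Proof. by rewrite /dadj eqxx. Qed.

Lemma cut_pair (S : {set F}) p q : p \in S -> q \notin S ->
  exists a b, [/\ a \in S, b \notin S & dadj a b].
Proof.
move=> pS qS; case: (boolP [exists a, exists b, [&& a \in S, b \notin S & dadj a b]]).
  by case/existsP => a /existsP[b /and3P[? ? ?]]; exists a, b.
rewrite negb_exists => /forallP H; case/negP: qS.
have := @connC_small set0; rewrite cards0 setC0 => /(_ isT S) -> //.
  by apply/set0Pn; exists p.
move=> a b aS; rewrite in_setD => /andP[bS _]; apply/negP => ab.
by have := H a; rewrite negb_exists => /forallP/(_ b); rewrite aS bS ab.
Qed.

(* The faces other than [p] form a connected set, so every component of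
   [D :\ v] that avoids [p] reaches the complement of [D]; a face [v] whose
   removal leaves the largest component around [p] is therefore removable. *)
Lemma removable D p : bond D -> p \in D -> 1 < #|D| ->
  exists v, [/\ v \in D, v != p, bond (D :\ v), exists2 q, q \in D :\ v & dadj v q &
    exists2 q, q \notin D & dadj v q].
Proof.
move=> [D0 C0 cD cC] pD D1.
pose out v := [exists q, (q \notin D) && dadj v q].
have escape S v : S \subset D -> v \notin S -> S != set0 -> (exists r, r \notin v |: S) ->
    (forall a b, a \in S -> b \in D -> b \notin S -> dadj a b -> b = v) ->
    exists2 w, w \in S & out w.
  move=> SD vS S0 [r rS] only; apply/exists_inP; apply: contraT; rewrite negb_exists_in => /forall_inP H.
  have := @connC_small [set v]; rewrite cards1 => /(_ isT S) eqS.
  have : S = ~: [set v]; last first.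
    by move=> eqC; move: rS; rewrite eqC !inE orbN.
  apply: eqS => //.
    by apply/subsetP => s sS; rewrite !inE; apply: contraNneq vS => <-.
  move=> a b aS; rewrite !inE => /andP[bS bv]; apply/negP => ab.
  case: (boolP (b \in D)) => bD; first by rewrite (only a b) ?eqxx in bv.
  by have /negP[] := H a aS; apply/existsP; exists b; rewrite bD ab.
have [r rC] := set0Pn _ C0; rewrite inE in rC.
pose P v := [&& v \in D, v != p & out v].
have [v0 Pv0] : exists v, P v.
  have [|||||w wS wout] := @escape (D :\ p) p; rewrite ?subD1set //.
  - by rewrite !inE eqxx.
  - by rewrite -card_gt0; move: D1; rewrite (cardsD1 p) pD.
  - by exists r; rewrite !inE (negbTE rC) andbF orbF; apply: contraNneq rC => ->.
  - by move=> a b _ bD; rewrite !inE bD andbT negbK => /eqP.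
  by exists w; move: wS; rewrite /P !inE => /andP[-> ->].
pose size_at v := #|component inc (D :\ v) p|.
have [v /and3P[vD vp /existsP[r' /andP[r'D vr']]] vmax] := arg_maxnP size_at Pv0.
have pDv : p \in D :\ v by rewrite !inE eq_sym vp.
have cDv : conn (D :\ v).
  suff <- : component inc (D :\ v) p = D :\ v by apply: comp_conn.
  apply/eqP; rewrite eqEsubset comp_sub //=; apply/negPn/negP => /subsetPn[w wD wC].
  pose K := component inc (D :\ v) w.
  have KD : K \subset D :\ v by apply: comp_sub.
  have disj a : a \in K -> a \in component inc (D :\ v) p = false.
    rewrite !inE in wC * => wa; apply/negP => pa; case/negP: wC.
    by apply: connect_trans pa _; rewrite restr_sym.
  have [|||||w' w'K w'out] := @escape K v.
  - exact: subset_trans KD (subD1set _ _).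
  - by apply/negP => /(subsetP KD); rewrite !inE eqxx.
  - by apply/set0Pn; exists w; apply: mem_comp.
  - exists p; rewrite !inE negb_or eq_sym vp /=; apply/negP => wp; case/negP: wC.
    by rewrite inE restr_sym.
  - move=> a b aK bD bK ab; apply/eqP/negPn/negP => bv; case/negP: bK.
    by apply: (comp_closed wD aK) => //; rewrite !inE bv.
  have w'D := subsetP KD w' w'K.
  have Pw' : P w'.
    rewrite /P w'out andbT; move: w'D; rewrite !inE => /andP[_ ->] /=.
    by apply/negP => /eqP w'p; have := disj w' w'K; rewrite w'p mem_comp.
  (* Deleting [w'] in place of [v] keeps the whole component of [p] and adds [v] to it, against the
     choice of [v]. *)
  have := vmax w' Pw'; rewrite /geq /= leqNgt => /negP[]; apply: proper_card.
  have pDw : p \in D :\ w' by rewrite !inE pD andbT; case/and3P: Pw' => _; rewrite eq_sym.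
  have sub : component inc (D :\ v) p \subset component inc (D :\ w') p.
    rewrite -{1}(conn_comp (comp_conn pDv) (mem_comp _ _ _)).
    apply/subsetP => q; rewrite !inE; apply: connect_sub => a b /and3P[aC bC ab].
    apply: connect1; rewrite /restr ab andbT !inE.
    have := subsetP (comp_sub inc pDv) a aC; have := subsetP (comp_sub inc pDv) b bC.
    rewrite !inE => /andP[_ ->] /andP[_ ->]; rewrite !andbT; apply/andP; split.
      by apply: contraTneq aC => ->; rewrite disj.
    by apply: contraTneq bC => ->; rewrite disj.
  rewrite properE sub /=; apply/subsetPn; exists v; last first.
    by apply/negP => /(subsetP (comp_sub inc pDv)); rewrite !inE eqxx.
  have [a [b [aC bC ab]]] : exists a b, [/\ a \in component inc (D :\ v) p, b = v & dadj a b].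
    have [a aC ea] : exists2 a, a \in component inc (D :\ v) p & dadj a v.
      apply/exists_inP; apply: contraT; rewrite negb_exists_in => /forall_inP H.
      have : component inc (D :\ v) p = D.
        apply: cD; first by apply: subset_trans (comp_sub inc pDv) (subD1set _ _).
          by apply/set0Pn; exists p; apply: mem_comp.
        move=> a b aC; rewrite inE => /andP[bC bD]; apply/negP => ab.
        have := H a aC; case: (eqVneq b v) ab => [->-> //|bv ab _].
        by case/negP: bC; apply: comp_closed aC _ ab => //; rewrite !inE bv.
      by move=> eqD; have := comp_sub inc pDv; rewrite eqD => /subsetP/(_ v vD); rewrite !inE eqxx.
    by exists a, v.
  apply: (comp_closed pDw (subsetP sub a aC)); last by rewrite -bC.
  by rewrite !inE vD andbT; move: w'D; rewrite !inE eq_sym => /andP[].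
exists v; split=> //.
- split=> //; first by apply/set0Pn; exists p.
    by apply/set0Pn; exists v; rewrite !inE eqxx.
  have -> : ~: (D :\ v) = v |: ~: D by apply/setP => q; rewrite !inE negb_and negbK.
  by apply: conn_add cC _ vr'; rewrite inE.
- have : ~ (forall q, q \in D :\ v -> ~~ dadj v q).
    move=> H; have : [set v] = D.
      apply: cD; rewrite ?sub1set //; first by apply/set0Pn; exists v; rewrite inE.
      by move=> a b; rewrite inE => /eqP-> bD; apply: H; move: bD; rewrite !inE.
    by move=> eqD; rewrite -eqD cards1 in D1.
  move=> H; apply/exists_inP; apply: contraT; rewrite negb_exists_in => /forall_inP H'; case: H => q qD.
  exact: H'.
- by exists r'.
Qed.

Lemma card_inc_gt2 x (S : {set F}) : #|S| <= 2 -> ~~ (inc x \subset S).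
Proof. by apply: contraL => /subset_leq_card; rewrite card_inc -ltnNge. Qed.

Lemma mixed1 p x : mixed [set p] x = (p \in inc x).
Proof.
rewrite /mixed; apply/andP/idP => [[/set0Pn[q]]|px].
  by rewrite !inE => /andP[qx /eqP <-].
split; first by apply/set0Pn; exists p; rewrite !inE px eqxx.
have /subsetPn[q qx qp] : ~~ (inc x \subset [set p]) by rewrite card_inc_gt2 ?cards1.
by apply/set0Pn; exists q; rewrite !inE qx -in_set1.
Qed.

Lemma len1 p : len [set p] = fdeg p.
Proof. by apply: eq_card => x; rewrite !inE mixed1. Qed.

Lemma bond1 p : bond [set p].
Proof.
split; [ | | exact: conn1 | by apply: connC_small; rewrite cards1].
  by apply/set0Pn; exists p; rewrite inE.
have [x _] := inc_face p.
have /subsetPn[q qx qp] : ~~ (inc x \subset [set p]) by rewrite card_inc_gt2 ?cards1.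
by apply/set0Pn; exists q; rewrite inE.
Qed.

(** A boundary vertex of [D] is on the boundary of [D :\ v] or on [v]; the two common vertices of
    [v] and [q] belong to both classes, hence the 2. *)
Lemma len_rem D v q : v \in D -> q \in D :\ v -> dadj v q ->
  len D + 2 <= len (D :\ v) + fdeg v.
Proof.
move=> vD qD vq; rewrite /len /fdeg -cardsUI.
apply: leq_add; last first.
  rewrite -(card_pair vq); apply/subset_leq_card/subsetP => x; rewrite !inE.
  move=> /andP[vx qx]; rewrite vx andbT; apply/andP; split; apply/set0Pn.
    by exists q; move: qD; rewrite !inE qx.
  by exists v; rewrite !inE vx eqxx.
apply/subset_leq_card/subsetP => x; rewrite !inE => mx.
case: (boolP (v \in inc x)) => vx; rewrite ?orbT // orbF.
have /andP[/set0Pn[a] + /set0Pn[b]] := mx; rewrite !inE => /andP[ax aD] /andP[bx bD].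
apply/andP; split; apply/set0Pn; [exists a|exists b]; rewrite !inE.
  by rewrite ax aD andbT; apply: contraNneq vx => <-.
by rewrite bx (negbTE bD) andbF.
Qed.

(** The face [p] meets [D] only along its edge with [q]. The two ends of that edge stay on the
    boundary, since the third face there is neither [p] nor in [D], and no other vertex is counted
    twice. *)
Lemma len_add D p q : p \notin D -> nbf p :&: D = [set q] ->
  len D + fdeg p <= len (p |: D) + 2.
Proof.
move=> pD nbD; rewrite /len /fdeg -cardsUI.
have pq : dadj p q.
  have : q \in nbf p :&: D by rewrite nbD inE.
  by rewrite !inE => /andP[].
have only x r : p \in inc x -> r \in inc x -> r \in D -> r = q.
  move=> px rx rD; apply/eqP; rewrite -in_set1 -nbD !inE rD andbT.
  apply/dadjP; split; last by exists x.
  by apply: contraNneq pD => ->.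
apply: leq_add; last first.
  rewrite -(card_pair pq); apply/subset_leq_card/subsetP => x; rewrite !inE.
  move=> /andP[/andP[/set0Pn[a] + _] px]; rewrite !inE px /= => /andP[ax aD].
  by rewrite -(only x a px ax aD).
apply/subset_leq_card/subsetP => x; rewrite !inE => /orP[mx|px].
  case: (boolP (p \in inc x)) => [px|px].
    apply/andP; split; apply/set0Pn; first by exists p; rewrite !inE px eqxx.
    have /subsetPn[a ax] : ~~ (inc x \subset [set p; q]).
      by rewrite card_inc_gt2 // cards2; case: (_ == _).
    rewrite !inE negb_or => /andP[ap aq]; exists a; rewrite !inE ax (negbTE ap) /=.
    by apply: contra aq => aD; apply/eqP; exact: (only x a px ax aD).
  have /andP[/set0Pn[a] + /set0Pn[b]] := mx; rewrite !inE => /andP[ax aD] /andP[bx bD].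
  apply/andP; split; apply/set0Pn; [exists a|exists b]; rewrite !inE.
    by rewrite ax aD orbT.
  by rewrite bx negb_or bD andbT; apply: contraNneq px => <-.
apply/andP; split; apply/set0Pn; first by exists p; rewrite !inE px eqxx.
have /subsetPn[a ax] : ~~ (inc x \subset [set p; q]).
  by rewrite card_inc_gt2 // cards2; case: (_ == _).
rewrite !inE negb_or => /andP[ap aq]; exists a; rewrite !inE ax (negbTE ap) /=.
by apply: contra aq => aD; apply/eqP; exact: (only x a px ax aD).
Qed.

End Bonds.

(** The interface through which faces are seen from here on, free of their encoding by even sets.
    The field [dm_triangle] excludes separating triangles of T. *)
Record dual_map (Y : sgraph) (F : finType) (inc : Y -> {set F}) : Prop := DualMap {
  dm_card_inc : forall x, #|inc x| = 3;
  dm_inc_face : forall p, exists x, p \in inc x;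
  dm_connC_small : forall A : {set F}, #|A| <= 1 -> conn inc (~: A);
  dm_pair_common : forall x p q, p \in inc x -> q \in inc x -> p != q ->
    exists y, adj x y /\ forall x', (p \in inc x') && (q \in inc x') = (x' == x) || (x' == y);
  dm_card_incI : forall x y, adj x y -> #|inc x :&: inc y| = 2;
  dm_triangle : forall p q r, dadj inc p q -> dadj inc q r -> dadj inc p r ->
    exists y, inc y = [set p; q; r];
  dm_bond_cycle : forall D, bond inc D ->
    exists2 c, is_cycle c & forall x, (x \in c) = mixed inc D x
}.

(** * The cyclic order of the neighbours of a face *)

Section Links.
Variables (Y : sgraph) (F : finType) (inc : Y -> {set F}).
Implicit Types (D S R O : {set F}) (p q : F) (x y : Y) (c : seq Y).
Local Notation dadj := (dadj inc).
Local Notation conn := (conn inc).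
Local Notation bond := (bond inc).
Local Notation mixed := (mixed inc).
Local Notation fdeg := (fdeg inc).
Local Notation len := (len inc).
Local Notation nbf := (nbf inc).
Hypothesis M : dual_map inc.
Let card_inc := dm_card_inc M.
Let inc_face := dm_inc_face M.
Let connC_small := dm_connC_small M.
Let pair_common := dm_pair_common M.
Let card_incI := dm_card_incI M.
Let triangle := dm_triangle M.
Let bond_cycle := dm_bond_cycle M.

Lemma card_pair p q : dadj p q -> #|[set x | (p \in inc x) && (q \in inc x)]| = 2.
Proof.
move=> /dadjP[pq [x [px qx]]]; have [y [xy E]] := pair_common px qx pq.
have -> : [set w | (p \in inc w) && (q \in inc w)] = [set x; y].
  by apply/setP => w; rewrite !inE E.
by rewrite cards2; case: eqP xy => // ->; rewrite adj_irrefl.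
Qed.

(** The cycle [c] runs around [p], and [out x] is the face across the edge from [x] to its
    successor; so [out] lists the neighbours of [p] in cyclic order. *)
Definition link p c (out : Y -> F) : Prop :=
  [/\ is_cycle c, forall x, (x \in c) = (p \in inc x),
     forall x, x \in c -> [/\ p != out x, out x != out (next c x) &
       inc (next c x) = [set p; out x; out (next c x)]],
     {in c &, injective out} &
     forall q, dadj p q <-> exists2 x, x \in c & q = out x].

Lemma exists_link p : exists c out, link p c out.
Proof.
have [c cc mc] := bond_cycle (bond1 card_inc inc_face connC_small p).
have {}mc x : (x \in c) = (p \in inc x) by rewrite mc (mixed1 card_inc).
have [/andP[cyc uc] _] := cc.
have adj_next x : x \in c -> adj x (next c x) by move=> xc; apply: next_cycle cyc xc.
pose out x := odflt p [pick q in (inc x :&: inc (next c x)) :\ p].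
have outP x : x \in c -> [/\ p != out x, out x \in inc x & out x \in inc (next c x)].
  move=> xc; rewrite /out; case: pickP => [q /= |none].
    by rewrite !inE eq_sym => /and3P[].
  have := card_incI (adj_next x xc); rewrite (cardsD1 p) eq_card0 // => H.
  by move: H; case: (_ \in _).
have common x : x \in c -> forall x', (p \in inc x') && (out x \in inc x') =
    (x' == x) || (x' == next c x).
  move=> xc x'; have [pout ox onx] := outP x xc; have px : p \in inc x by rewrite -mc.
  have [y [xy E]] := pair_common px ox pout.
  suff -> : next c x = y by [].
  have := E (next c x); rewrite onx -mc mem_next xc /= => /esym/orP[]/eqP // nx.
  by have := adj_next x xc; rewrite nx adj_irrefl.
have next_neq x : x \in c -> next c x != x.
  by move=> xc; apply: contraTneq (adj_next x xc) => ->; rewrite adj_irrefl.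
have inj : {in c &, injective out}.
  move=> x y xc yc oxy.
  have [_ oy ony] := outP y yc.
  have := common x xc y; rewrite -mc yc oxy oy => /esym/orP[]/eqP // yx.
  have := common x xc (next c y); rewrite -mc mem_next yc oxy ony => /esym/orP[]/eqP.
    rewrite yx => nnx; have := next_neq_prev cc (etrans (mem_next c x) xc).
    by rewrite nnx prev_next // eqxx.
  by move=> ny; have := next_neq y yc; rewrite yx in ny *; rewrite ny eqxx.
have incn x : x \in c -> [/\ p != out x, out x != out (next c x) &
       inc (next c x) = [set p; out x; out (next c x)]].
  move=> xc; have nc : next c x \in c by rewrite mem_next.
  have [pout _ onx] := outP x xc; have [pout' onx' _] := outP _ nc.
  have oo : out x != out (next c x).
    by apply: contraNneq (next_neq x xc) => /(inj _ _ xc nc) <-.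
  split=> //; apply/eqP; rewrite eq_sym eqEcard card_inc !subUset !sub1set.
  rewrite -mc nc onx onx' /= -setUA !cardsU1 !inE cards1.
  by rewrite negb_or pout pout' oo.
exists c, out; split=> // q; split=> [/dadjP[pq [x [px qx]]]|[x xc ->]].
  have xc : x \in c by rewrite mc.
  have pc : prev c x \in c by rewrite mem_prev.
  have [_ _] := incn _ pc; rewrite next_prev // => incx.
  move: qx; rewrite incx !inE eq_sym (negbTE pq) /= => /orP[]/eqP ->; last by exists x.
  by exists (prev c x).
by have [pout ox _] := outP x xc; apply/dadjP; split=> //; exists x; rewrite -mc.
Qed.

Section OneLink.
Variables (p : F) (c : seq Y) (out : Y -> F).
Hypothesis lk : link p c out.

Let cc : is_cycle c. Proof. by case: lk. Qed.
Let uc : uniq c. Proof. by case: cc => /andP[]. Qed.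
Let mc x : (x \in c) = (p \in inc x). Proof. by case: lk. Qed.

Lemma link_size : size c = fdeg p.
Proof. by rewrite -(card_uniqP uc); apply: eq_card => x; rewrite inE mc. Qed.

Lemma next_inj : injective (next c).
Proof. exact: can_inj (prev_next uc). Qed.

Lemma mem_iter_next i x : (iter i (next c) x \in c) = (x \in c).
Proof. by elim: i => //= i IHi; rewrite mem_next. Qed.

Lemma iter_next_inj x i j : x \in c -> i < fdeg p -> j < fdeg p ->
  iter i (next c) x = iter j (next c) x -> i = j.
Proof.
move=> xc; rewrite -link_size -(order_cycle (cycle_next uc) uc xc) => li lj eq_ij.
by rewrite -(findex_iter li) eq_ij findex_iter.
Qed.

Lemma iter_next_surj x y : x \in c -> y \in c ->
  exists2 i, i < fdeg p & y = iter i (next c) x.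
Proof.
move=> xc yc; have fxy : fconnect (next c) x y by rewrite (fconnect_cycle (cycle_next uc) xc).
exists (findex (next c) x y); last by rewrite iter_findex.
by rewrite -link_size -(order_cycle (cycle_next uc) uc xc) findex_max.
Qed.

Lemma link_out x : x \in c -> dadj p (out x).
Proof. by case: lk => _ _ _ _ H xc; apply/H; exists x. Qed.

Lemma link_next x : x \in c -> dadj (out x) (out (next c x)).
Proof.
move=> xc; case: lk => _ _ /(_ x xc)[_ oo incn] _ _; apply/dadjP; split=> //.
by exists (next c x); rewrite incn !inE !eqxx !orbT.
Qed.

(** Adjacent neighbours of [p] form a triangle with it, so they meet [p] at a common vertex [w]; the
    faces across the two edges of [p] at [w] are consecutive. *)
Lemma link_adj x y : x \in c -> y \in c -> dadj (out x) (out y) ->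
  y = next c x \/ x = next c y.
Proof.
move=> xc yc xy; have [_ _ incn inj _] := lk.
have [w incw] := triangle (link_out xc) xy (link_out yc).
have wc : w \in c by rewrite mc incw !inE eqxx.
have pc : prev c w \in c by rewrite mem_prev.
have [po oo] := incn _ pc; rewrite next_prev // in oo *; rewrite incw => incE.
have [px _ _] := incn _ xc; have [py _ _] := incn _ yc.
have xney : x != y by apply: contraTneq xy => ->; rewrite dadj_irr.
have mem a : a \in c -> out a \in [set p; out x; out y] -> a = x \/ a = y.
  move=> ac; have [pa _ _] := incn _ ac.
  rewrite !inE eq_sym (negbTE pa) /= => /orP[]/eqP/inj; [left|right]; auto.
have pw : prev c w != w.
  by apply: contraNneq oo => ->.
have : prev c w = x \/ prev c w = y by apply: mem pc _; rewrite incE !inE eqxx orbT.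
have : w = x \/ w = y by apply: mem wc _; rewrite incE !inE eqxx !orbT.
case=> ew; case=> ep.
- by rewrite ep ew eqxx in pw.
- by right; rewrite -ep next_prev.
- by left; rewrite -ep next_prev.
- by rewrite ep ew eqxx in pw.
Qed.

Variable Q : {set F}.
(** [B] is [A] moved back by one step. So [A :&: B] counts the triangles at [p] inside [Q], and
    [B :\: A] counts the gaps of the link outside [Q], each once. *)
Let A := [set x in c | out x \in Q].
Let B := [set x in c | out (next c x) \in Q].

Lemma card_link_nbf : #|nbf p :&: Q| = #|A|.
Proof.
have [_ _ _ inj nbP] := lk.
have injA : {in A &, injective out}.
  by move=> x y; rewrite !inE => /andP[xc _] /andP[yc _]; apply: inj.
rewrite -(card_in_imset injA); apply: eq_card => q; rewrite !inE.
apply/andP/imsetP => [[/nbP[x xc ->] xQ]|[x]]; first by exists x; rewrite ?inE ?xc.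
by rewrite inE => /andP[xc xQ] ->; split=> //; apply/nbP; exists x.
Qed.

Lemma next_B : next c @: B = A.
Proof.
apply/setP => x; rewrite !inE; apply/imsetP/andP => [[y]|[xc xQ]].
  by rewrite inE => /andP[yc yQ] ->; rewrite mem_next.
by exists (prev c x); rewrite ?inE next_prev // mem_prev xc.
Qed.

Lemma card_link_B : #|B| = #|A|.
Proof. by rewrite -next_B card_imset //; apply: next_inj. Qed.

Lemma card_link_triangles : p \in Q ->
  #|[set x | (p \in inc x) && (inc x \subset Q)]| = #|A :&: B|.
Proof.
move=> pQ; have [_ _ incn _ _] := lk.
rewrite -[RHS](card_imset _ next_inj); apply: eq_card => x; rewrite inE -mc.
apply/andP/imsetP => [[xc sub]|[y]].
  have pc : prev c x \in c by rewrite mem_prev.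
  have [_ _ ] := incn _ pc; rewrite next_prev // => incx.
  exists (prev c x); last by rewrite next_prev.
  by rewrite !inE mem_prev xc /= next_prev // !(subsetP sub) // incx !inE eqxx ?orbT.
rewrite !inE => /andP[/andP[yc yQ] /andP[_ nyQ]] ->; rewrite mem_next; split=> //.
by have [_ _ ->] := incn _ yc; rewrite !subUset !sub1set pQ yQ nyQ.
Qed.

Lemma link_invariant : A \subset B -> A != set0 -> {in c, forall x, out x \in Q}.
Proof.
move=> /subsetP sub /set0Pn[x]; rewrite inE => /andP[xc xQ] y yc.
have [i _ ->] := iter_next_surj xc yc.
suff : iter i (next c) x \in A by rewrite inE => /andP[].
elim: i => [|i IHi]; first by rewrite inE xc.
by have := sub _ IHi; rewrite !inE !mem_next !mem_iter_next xc.
Qed.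

(* Every position outside [Q] precedes, within [m] steps, a position from which
   the link enters [Q]. *)
Lemma link_runs m : (forall x, x \in c -> exists2 i, i <= m & out (iter i (next c) x) \in Q) ->
  fdeg p <= #|A| + #|B :\: A| * m.
Proof.
move=> runs; rewrite -link_size -(card_uniqP uc) -(cardsE (mem c)).
have -> : #|[set x in c]| = #|A| + #|[set x in c] :\: A|.
  rewrite -(cardsID A); congr (_ + _); apply: eq_card => x; rewrite !inE.
  by case: (x \in c).
rewrite leq_add2l.
have sub : [set x in c] :\: A \subset
    \bigcup_(i < m) [set x in c | iter i (next c) x \in B :\: A].
  apply/subsetP => x; rewrite !inE => /andP[xA xc]; rewrite xc /= in xA.
  have [i im iQ] := runs x xc.
  have ex : exists k, out (iter k (next c) x) \in Q by exists i.
  have [k kQ kmin] := ex_minnP ex.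
  case: k => [|k] in kQ kmin; first by rewrite kQ in xA.
  apply/bigcupP; have km : k < m by apply: leq_trans im; apply: kmin.
  exists (Ordinal km) => //=; rewrite !inE !mem_iter_next xc /= kQ andbT.
  by apply/negP => /kmin; rewrite ltnn.
apply: leq_trans (subset_leq_card sub) _.
have cle (i : 'I_m) : #|[set x in c | iter i (next c) x \in B :\: A]| <= #|B :\: A|.
  have inji : injective (iter i (next c)) by elim: (i : nat) => //= k IHk x y /next_inj/IHk.
  rewrite -(card_imset _ inji); apply/subset_leq_card/subsetP => _ /imsetP[x + ->].
  by rewrite inE => /andP[].
have bnd : #|\bigcup_(i < m) [set x in c | iter i (next c) x \in B :\: A]| <=
    \sum_(i < m) #|B :\: A|.
  elim/big_rec2: _ => [|i n S _ le]; first by rewrite cards0.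
  by apply: leq_trans (leq_card_setU _ _) _; apply: leq_add (cle i) le.
by apply: leq_trans bnd _; rewrite sum_nat_const card_ord mulnC.
Qed.
End OneLink.

(** The neighbours of [p] other than [q] form a path in the complement. A closed part of what
    remains either contains this path, and then [p] can be added to it, or has no face next to [p];
    both cases reduce to connectedness of [~: D]. *)
Lemma bond_add D p q : bond D -> p \notin D -> nbf p :&: D = [set q] ->
  ~: (p |: D) != set0 -> bond (p |: D).
Proof.
move=> [D0 C0 cD cC] pD nbD W0.
have [c [out lk]] := exists_link p; have [cc mc incn inj nbP] := lk.
have [pq qD] : dadj p q /\ q \in D.
  by have : q \in nbf p :&: D by [rewrite nbD inE]; rewrite !inE => /andP[].
split=> //; first by apply/set0Pn; exists p; rewrite !inE eqxx.
  exact: conn_add cD qD pq.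
have [x0 x0c def_q] := (nbP q).1 pq.
have inW r : dadj p r -> r != q -> r \in ~: (p |: D).
  move=> pr rq; rewrite !inE negb_or eq_sym (dadj_neq pr) /=.
  by apply: contra rq => rD; rewrite -in_set1 -nbD !inE pr.
move=> S SW S0 closed.
have SD s : s \in S -> s != p /\ s \notin D.
  by move=> /(subsetP SW); rewrite !inE negb_or => /andP[].
pose y i := out (iter i (next c) x0).
have yW i : 0 < i < fdeg p -> y i \in ~: (p |: D).
  move=> /andP[i0 il]; apply: inW; first by apply: (link_out lk); rewrite mem_iter_next.
  rewrite def_q; apply/eqP => /inj eq_i.
  have := iter_next_inj lk x0c il (ltn_trans i0 il) (j := 0).
  by rewrite eq_i ?mem_iter_next // => /(_ erefl) i_0; rewrite i_0 in i0.
have stepS a b : a \in S -> b \in ~: (p |: D) -> dadj a b -> b \in S.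
  move=> aS bW ab; apply/negPn/negP => bS; have := closed a b aS.
  by rewrite in_setD bS bW ab => /(_ isT).
have yS i : 0 < i < fdeg p -> (y i \in S) = (y 1 \in S).
  elim: i => [|[|i] IHi] // /andP[_ il]; rewrite -IHi ?(ltnW il) //.
  have ic : iter i.+1 (next c) x0 \in c by rewrite mem_iter_next.
  have adj_y : dadj (y i.+1) (y i.+2) := link_next lk ic.
  apply/idP/idP => [yS|yS].
    by apply: stepS yS _ _; [apply: yW; rewrite (ltnW il)|rewrite dadjC].
  by apply: stepS yS _ adj_y; apply: yW.
have nb_y r : dadj p r -> r != q -> exists2 i, 0 < i < fdeg p & r = y i.
  move=> /nbP[w wc ->] wq; have [i il def_w] := iter_next_surj lk x0c wc.
  exists i; last by rewrite /y -def_w.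
  rewrite il andbT lt0n; apply: contra wq => /eqP i0.
  by rewrite def_q def_w i0.
case: (boolP [exists r in S, dadj p r]) => [/exists_inP[r rS pr]|].
  have rq : r != q by apply: contraTneq rS => ->; apply/negP => /SD[_]; rewrite qD.
  have y1S : y 1 \in S by have [i il ri] := nb_y r pr rq; rewrite -(yS i il) -ri.
  have eqS : p |: S = ~: D.
    apply: cC; first 2 last.
    - move=> a b; rewrite !inE negb_or => aS /andP[/andP[bp bS] bD].
      have bW : b \in ~: (p |: D) by rewrite !inE negb_or bp.
      case/orP: aS => [/eqP->|aS]; last by apply: closed; rewrite // in_setD bS.
      apply/negP => pb; case/negP: bS.
      have bq : b != q by apply: contraNneq bD => ->.
      by have [i il ->] := nb_y b pb bq; rewrite yS.
    - rewrite subUset sub1set inE pD /=; apply/subsetP => s /SD[_ sD].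
      by rewrite inE.
    - by apply/set0Pn; exists p; rewrite !inE eqxx.
  apply/eqP; rewrite eqEsubset SW; apply/subsetP => s; rewrite !inE negb_or => /andP[sp sD].
  have : s \in p |: S by rewrite eqS inE.
  by rewrite !inE (negbTE sp).
rewrite negb_exists_in => /forall_inP none.
have eqS : S = ~: D.
  apply: cC => //; first by apply/subsetP => s /SD[_ sD]; rewrite inE.
  move=> a b aS; rewrite !inE => /andP[bS bD].
  have [->|bp] := eqVneq b p; first by rewrite dadjC none.
  by apply: closed => //; rewrite !inE bS negb_or bp.
have : p \in S by rewrite eqS inE.
by move=> /SD[]; rewrite eqxx.
Qed.

End Links.

(** * Euler's formula for a set of faces *)

Section Counting.
Variables (Y : sgraph) (F : finType) (inc : Y -> {set F}).
Implicit Types (D S R O Q W J : {set F}) (p q v w : F) (x y : Y) (c : seq Y).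
Local Notation dadj := (dadj inc).
Local Notation conn := (conn inc).
Local Notation bond := (bond inc).
Local Notation mixed := (mixed inc).
Local Notation fdeg := (fdeg inc).
Local Notation len := (len inc).
Local Notation nbf := (nbf inc).
Local Notation component := (component inc).
Local Notation link := (link inc).
Hypothesis M : dual_map inc.
Let card_inc := dm_card_inc M.
Let connC_small := dm_connC_small M.

Lemma card_incI_le x Q : #|inc x :&: Q| <= 3.
Proof. by rewrite -(card_inc x) subset_leq_card // subsetIl. Qed.

Lemma card_inc_link p c (out : Y -> F) x Q : link p c out -> x \in c ->
  #|inc (next c x) :&: Q| = (p \in Q) + ((out x \in Q) + (out (next c x) \in Q)).
Proof.
move=> lk xc; have [_ _ incn _ _] := lk; have [po oo ->] := incn x xc.
have [po' _ _] := incn (next c x) (etrans (mem_next c x) xc).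
by rewrite cardI_sum -setUA big_setU1 ?big_setU1 ?big_set1 ?inE ?negb_or ?po ?po'.
Qed.

(** Faces are removed one at a time by [removable]. The link of the removed face enters and leaves
    the rest; at these two corners the number of faces of the set falls from at least two to at most
    one, which pays for the 2. *)
Lemma bond_euler D : bond D -> 2 * #|D| <= 2 + #|[set x | 1 < #|inc x :&: D|]|.
Proof.
have [n] := ubnP #|D|; elim: n D => // n IHn D ltD bD.
have [D1|D1] := leqP #|D| 1; first by move: D1; set a := #|D|; lia.
have [D0 _ _ _] := bD; case/set0Pn: D0 => p pD.
have [v [vD vp bDv [q qD vq] [r rD vr]]] := removable connC_small bD pD D1.
have cDv : #|D| = #|D :\ v|.+1 by rewrite (cardsD1 v) vD.
have IH := IHn (D :\ v) _ bDv; rewrite cDv in ltD; have {}IH := IH ltD.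
have [c [out lk]] := exists_link M v; have [cc mc incn inj nbP] := lk.
set Q := D :\ v in IH *.
pose A := [set x in c | out x \in Q]; pose B := [set x in c | out (next c x) \in Q].
have [xq xqc def_q] := (nbP q).1 vq; have [xr xrc def_r] := (nbP r).1 vr.
have nAB : ~~ (A \subset B).
  apply/negP => sAB; have A0 : A != set0.
    by apply/set0Pn; exists xq; rewrite inE xqc -def_q.
  have := link_invariant lk sAB A0 xrc; rewrite -def_r !inE => /andP[_].
  by rewrite (negbTE rD).
have nBA : ~~ (B \subset A).
  apply: contra nAB => sBA; suff -> : A = B by [].
  by apply/eqP; rewrite eq_sym eqEcard sBA (card_link_B lk Q) leqnn.
have [x1 x1A x1B] := subsetPn nAB; have [x2 x2B x2A] := subsetPn nBA.
move: x1A x1B x2B x2A; rewrite ![_ \in A]in_set ![_ \in B]in_set.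
move=> /andP[x1c x1Q]; rewrite x1c /= => x1nQ.
move=> /andP[x2c x2Q]; rewrite x2c /= => x2nQ.
have vQ : (v \in Q) = false by rewrite !inE eqxx.
have QD a : a \in Q -> a \in D by rewrite !inE => /andP[].
have odd1 x : x \in c -> (out x \in Q) (+) (out (next c x) \in Q) ->
   #|inc (next c x) :&: Q| <= 1 /\ 1 < #|inc (next c x) :&: D|.
  move=> xc; rewrite !(card_inc_link _ lk xc) vQ vD.
  case: (boolP (out x \in Q)) => [/QD->|_]; case: (boolP (out (next c x) \in Q)) => [/QD->|_] //.
  by case: (out x \in D).
have [lt1 gt1] := odd1 x1 x1c ltac:(by rewrite x1Q (negbTE x1nQ)).
have [lt2 gt2] := odd1 x2 x2c ltac:(by rewrite x2Q (negbTE x2nQ)).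
have n12 : next c x1 != next c x2.
  apply/eqP => /(next_inj lk) e12; move: x1nQ; rewrite e12.
  by have -> := x2Q.
have step : #|[set x | 1 < #|inc x :&: Q|]| + #|[set next c x1; next c x2]| <= #|[set x | 1 < #|inc x :&: D|]|.
  rewrite -cardsUI (_ : _ :&: _ = set0) ?cards0 ?addn0; last first.
    apply/setP => x; rewrite in_setI in_set2 in_set0 in_set.
    by apply/andP => -[gt /orP[]/eqP ex]; rewrite ex ltnNge ?lt1 ?lt2 in gt.
  apply/subset_leq_card/subsetP => x; rewrite in_setU in_set2 !inE.
  case/orP=> [gt|/orP[]/eqP-> //].
  by apply: leq_trans gt _; apply/subset_leq_card/setIS/subD1set.
rewrite cards2 n12 in step; rewrite cDv mulnS.
by rewrite leq_add2l; apply: leq_trans IH _; rewrite addnC.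
Qed.

(** In T[Q], [cnt 3 Q] counts triangles and [cnt 2 Q] counts the sides of edges that are not filled
    by such a triangle. *)
Definition cnt i Q := #|[set x | #|inc x :&: Q| == i]|.

Lemma cntC i Q : i <= 3 -> cnt i (~: Q) = cnt (3 - i) Q.
Proof.
move=> i3; apply: eq_card => x; rewrite !inE.
have := cardsID Q (inc x); rewrite card_inc -setDE; set a := #|_|; set b := #|_|.
by move=> ab; apply/eqP/eqP; lia.
Qed.

Lemma sum_cnt (G : nat -> nat) Q :
  \sum_x G #|inc x :&: Q| =
  G 0 * cnt 0 Q + (G 1 * cnt 1 Q + (G 2 * cnt 2 Q + G 3 * cnt 3 Q)).
Proof.
rewrite /cnt -!sum1_card !big_distrr /= !(big_mkcond (fun x => x \in _)) -!big_split.
apply: eq_bigr => x _; rewrite !inE.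
by have := card_incI_le x Q; case: #|_| => [|[|[|[|]]]] //= _; lia.
Qed.

Lemma card_vertices Q : #|Y| = cnt 0 Q + (cnt 1 Q + (cnt 2 Q + cnt 3 Q)).
Proof. by have := sum_cnt (fun=> 1) Q; rewrite sum1_card !mul1n. Qed.

Lemma card_gt1_cnt Q : #|[set x | 1 < #|inc x :&: Q|]| = cnt 2 Q + cnt 3 Q.
Proof.
have := sum_cnt (fun i => 1 < i) Q; rewrite /= !mul0n !mul1n !add0n => <-.
by rewrite -sum1_card big_mkcond; apply: eq_bigr => x _; rewrite inE; case: ifP.
Qed.

Lemma sum_triangles Q :
  \sum_(v in Q) #|[set x | (v \in inc x) && (inc x \subset Q)]| = 3 * cnt 3 Q.
Proof.
have := sum_cnt (fun i => if i == 3 then 3 else 0) Q.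
rewrite /= !mul0n !add0n => <-.
rewrite (eq_bigr (fun v => \sum_x ((v \in inc x) && (inc x \subset Q)))); last first.
  by move=> v _; rewrite -sum1_card big_mkcond; apply: eq_bigr => x _; rewrite inE; case: ifP.
rewrite exchange_big; apply: eq_bigr => x _ /=.
have [sub|nsub] := boolP (inc x \subset Q).
  rewrite (setIidPl sub) card_inc /= -[RHS](card_inc x) -sum1_card.
  rewrite big_mkcond [RHS]big_mkcond; apply: eq_bigr => v _.
  by case: (boolP (v \in inc x)) => [/(subsetP sub) ->|_] //; case: ifP.
rewrite big1 => [|v _]; last by rewrite andbF.
case: eqP => // eq3; case/negP: nsub; apply/setIidPl/eqP.
by rewrite eqEcard subsetIl card_inc eq3.
Qed.

(** Double counting of ordered pairs of faces of [Q] at a vertex; an adjacent pair has two common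
    vertices, so both sides appear doubled. *)
Lemma sum_degrees Q : \sum_(v in Q) #|nbf v :&: Q| = 3 * cnt 3 Q + cnt 2 Q.
Proof.
have := sum_cnt (fun i => i * i.-1) Q; rewrite /= !mul0n !add0n => S.
suff : \sum_x #|inc x :&: Q| * #|inc x :&: Q|.-1 = 2 * \sum_(v in Q) #|nbf v :&: Q| by lia.
rewrite {S} big_distrr /=.
have deg2 v : v \in Q -> 2 * #|nbf v :&: Q| = \sum_x (v \in inc x) * #|inc x :&: (Q :\ v)|.
  move=> vQ; transitivity (\sum_(w in Q :\ v) \sum_x ((v \in inc x) && (w \in inc x))).
    rewrite setIC cardI_sum big_distrr /= (big_setD1 v vQ) /= inE dadj_irr muln0 add0n.
    apply: eq_bigr => w; rewrite !inE => /andP[wv _].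
    have -> : \sum_x ((v \in inc x) && (w \in inc x)) = #|[set x | (v \in inc x) && (w \in inc x)]|.
      by rewrite -sum1_card [RHS]big_mkcond; apply: eq_bigr => x _; rewrite inE; case: ifP.
    case: (boolP (dadj v w)) => [vw|nvw]; first by rewrite (card_pair M vw).
    rewrite muln0; apply/esym/eqP; rewrite cards_eq0; apply/eqP/setP => x; rewrite !inE.
    by apply: contraNF nvw => /andP[vx wx]; apply/dadjP; split; [rewrite eq_sym|exists x].
  rewrite exchange_big; apply: eq_bigr => x _ /=.
  by rewrite setIC cardI_sum; case: (v \in inc x) => /=; rewrite ?mul1n // big1 ?mul0n.
rewrite (eq_bigr _ deg2) exchange_big; apply: eq_bigr => x _ /=.
rewrite (bigID (fun v => v \in inc x)) /= [X in _ + X]big1 ?addn0; last first.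
  by move=> v /andP[_ /negbTE->].
rewrite (eq_bigr (fun=> #|inc x :&: Q|.-1)).
  by rewrite sum_nat_const; congr (_ * _); apply: eq_card => v; rewrite !inE andbC.
move=> v /andP[vQ vx]; rewrite vx mul1n.
by rewrite [in RHS](cardsD1 v) inE vx vQ /= setIDA.
Qed.

(** What is left is [Q] with the other components, and each of these touches [Q] because the set of
    all faces is connected. *)
Lemma component_bond Q p : conn Q -> Q != set0 -> p \notin Q -> bond (component (~: Q) p).
Proof.
move=> cQ /set0Pn[q0 q0Q] pQ; have pW : p \in ~: Q by rewrite inE.
set R := component (~: Q) p; have RW : R \subset ~: Q := comp_sub inc pW.
have RQ q : q \in Q -> q \notin R.
  by move=> qQ; apply/negP => /(subsetP RW); rewrite inE qQ.
split; first by apply/set0Pn; exists p; apply: mem_comp.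
- by apply/set0Pn; exists q0; rewrite in_setC RQ.
- exact: comp_conn.
move=> S SR S0 closed.
have noRS a b : a \in R -> b \notin Q -> b \notin R -> dadj a b -> False.
  move=> aR bQ bR ab; case/negP: bR; apply: comp_closed pW aR _ ab.
  by rewrite inE.
have SnR a : a \in S -> a \notin R by move=> /(subsetP SR); rewrite in_setC.
have QS : Q \subset S.
  have [q /andP[qQ qS]] : exists q, (q \in Q) && (q \in S).
    apply/existsP; apply: contraT; rewrite negb_exists => /forallP none.
    case/set0Pn: S0 => s sS.
    have q0S : q0 \notin S by have := none q0; rewrite q0Q.
    have [a [b [aS bS ab]]] := cut_pair connC_small sS q0S.
    have aQ : a \notin Q by have := none a; rewrite aS andbT.
    case: (boolP (b \in R)) => bR.
      by case: (noRS b a bR aQ (SnR a aS)); rewrite dadjC.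
    by have := closed a b aS; rewrite in_setD in_setC bS bR ab => /(_ isT).
  suff <- : Q :&: S = Q by apply: subsetIr.
  apply: cQ; [exact: subsetIl | by apply/set0Pn; exists q; rewrite inE qQ |].
  move=> a b; rewrite !inE => /andP[aQ aS] /andP[+ bQ]; rewrite bQ /= => bS.
  by apply: closed => //; rewrite in_setD in_setC bS RQ.
apply/eqP; rewrite eqEsubset SR; apply/subsetP => s; rewrite in_setC => sR.
apply: contraT => sS.
have sS' : s \in ~: S :\: R by rewrite in_setD sR in_setC.
have q0S' : q0 \notin ~: S :\: R by rewrite in_setD in_setC (subsetP QS q0 q0Q) andbF.
have [a [b [aS bS ab]]] := cut_pair connC_small sS' q0S'.
move: aS bS; rewrite ![_ \in _ :\: R]in_setD ![_ \in ~: S]in_setC negb_and !negbK => /andP[aR aS] /orP[bR|bS].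
  have aQ : a \notin Q by apply: contra aS => /(subsetP QS).
  by case: (noRS b a bR aQ aR); rewrite dadjC.
by have := closed b a bS; rewrite in_setD in_setC aS aR dadjC ab => /(_ isT).
Qed.

Hypothesis Ycubic : cubic Y.
Hypothesis Yc4 : cyclically_4_edge_connected Y.
Hypothesis fdeg_ge4 : forall p, 4 <= fdeg p.
Hypothesis euler : #|Y| + 4 <= 2 * #|F|.

(** Here [cnt 1 R] is the length of the face of T[Q] that contains the component [R]. If it were at
    most 3, the vertices on [R] would have an edge boundary of at most three edges; then at most one
    vertex misses [R], and [Q] is too small for degree sum 8. *)
Lemma component_cnt1 Q p : conn Q -> Q != set0 -> p \notin Q ->
  8 <= 3 * cnt 3 Q + cnt 2 Q -> 4 <= cnt 1 (component (~: Q) p).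
Proof.
move=> cQ Q0 pQ cQ8; have pW : p \in ~: Q by rewrite inE.
set R := component (~: Q) p; have RW : R \subset ~: Q := comp_sub inc pW.
have pR : p \in R := mem_comp inc (~: Q) p.
rewrite leqNgt; apply/negP => lt4.
pose X := [set x | inc x :&: R != set0].
pose N1 := [set x | #|inc x :&: R| == 1].
(* A vertex with one face in [R] has at most one edge leaving [X], and [g] selects it; without such
   an edge the default gives the singleton of [x]. *)
pose g x : {set Y} := [set x; odflt x [pick y | adj x y && (y \notin X)]].
have out_X a b : adj a b -> a \in X -> b \notin X ->
    #|inc a :&: R| = 1 /\ inc a :&: inc b = inc a :\: R.
  move=> ab aX bX; have sub : inc a :&: inc b \subset inc a :\: R.
    apply/subsetP => s; rewrite !in_setI in_setD => /andP[sa sb]; rewrite sa andbT.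
    apply: contra bX => sR; rewrite in_set; apply/set0Pn; exists s.
    by rewrite in_setI sb.
  have aR : 0 < #|inc a :&: R| by rewrite card_gt0; move: aX; rewrite in_set.
  have card3 := cardsID R (inc a); rewrite card_inc in card3.
  have := subset_leq_card sub; rewrite (dm_card_incI M ab) => le2.
  have eq1 : #|inc a :&: R| = 1.
    by move: card3 aR le2; set i := #|_|; set j := #|_|; lia.
  split=> //; apply/eqP; rewrite eqEcard sub (dm_card_incI M ab).
  by move: card3; rewrite eq1 add1n => -[->].
have cut_N1 : delta X \subset g @: N1.
  have H a b : adj a b -> a \in X -> b \notin X -> [set a; b] \in g @: N1.
    move=> ab aX bX; have [eq1 eqI] := out_X a b ab aX bX.
    apply/imsetP; exists a; first by rewrite in_set eq1.
    rewrite /g; case: pickP => [y /andP[ay yX]|/(_ b)]; last by rewrite ab bX.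
    have [_ eqI'] := out_X a y ay aX yX.
    have : 1 < #|inc a :&: inc b| by rewrite (dm_card_incI M ab).
    case/card_gt1P => s [t [sI tI st]].
    move: (sI) (tI); rewrite !in_setI => /andP[sa sb] /andP[ta tb].
    have [w [aw E]] := dm_pair_common M sa ta st.
    have := E b; rewrite sb tb => /esym/orP[]/eqP eb; first by rewrite eb adj_irrefl in ab.
    move: sI tI; rewrite eqI -eqI' !in_setI => /andP[_ sy] /andP[_ ty].
    have := E y; rewrite sy ty => /esym/orP[]/eqP ey; first by rewrite ey adj_irrefl in ay.
    by rewrite /= eb ey.
  apply/subsetP => f fX; have [a [b [ab def_f]]] := edge_ends (subsetP (delta_sub_edges X) f fX).
  move: fX; rewrite def_f in_delta //.
  case: (boolP (a \in X)) => aX; case: (boolP (b \in X)) => bX // _; first exact: H.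
  by rewrite setUC; apply: H; rewrite // adj_sym.
have le3 : #|delta X| <= 3.
  apply: leq_trans (subset_leq_card cut_N1) _.
  exact: leq_trans (leq_imset_card _ _) lt4.
have Xp : 4 <= #|X|.
  apply: leq_trans (fdeg_ge4 p) _; apply/subset_leq_card/subsetP => x.
  by rewrite !in_set => px; apply/set0Pn; exists p; rewrite in_setI px.
have CX1 : #|~: X| <= 1.
  have [->|XT] := eqVneq X setT; first by rewrite setCT cards0.
  have X0 : X != set0 by rewrite -card_gt0; apply: leq_trans Xp.
  have [y [eX|->]] := small_cut_singleton Ycubic Yc4 X0 XT le3; last by rewrite cards1.
  by rewrite eX cards1 in Xp.
have QR x : #|inc x :&: Q| + #|inc x :&: R| <= 3.
  rewrite -cardsUI (_ : _ :&: _ :&: _ = set0) ?cards0 ?addn0.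
    by rewrite -(card_inc x) subset_leq_card // subUset !subsetIl.
  apply/setP => s; rewrite !in_setI in_set0; apply/negP => /andP[/andP[_ sQ] /andP[_ sR]].
  by have := subsetP RW s sR; rewrite in_setC sQ.
pose T i := [set x | #|inc x :&: Q| == i].
have XR x : x \in X -> 0 < #|inc x :&: R| by rewrite in_set card_gt0.
have T3 : #|T 3| + #|T 2 :\: X| <= 1.
  apply: leq_trans CX1; rewrite -cardsUI (_ : _ :&: _ = set0) ?cards0 ?addn0; last first.
    apply/setP => x; rewrite in_setI in_setD !in_set; apply/negP => /and3P[/eqP-> _].
    by [].
  apply/subset_leq_card/subsetP => x; rewrite in_setU in_setD in_setC in_set.
  case/orP=> [/eqP e3|/andP[] //]; apply/negP => /XR.
  by have := QR x; rewrite e3; set i := #|_|; lia.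
have T2 : #|T 2 :&: X| <= 3.
  apply: (@leq_trans (cnt 1 R)); last exact: lt4.
  apply/subset_leq_card/subsetP => x; rewrite in_setI => /andP[].
  rewrite !in_set => /eqP e2 xX; have := QR x; rewrite e2; move: xX; rewrite -card_gt0.
  by set i := #|_|; lia.
(* The degree sum is at most [3 * 1 + 3 = 6]. *)
have := cardsID X (T 2); move: cQ8 T3 T2; rewrite /cnt -/(T 3) -/(T 2).
set i := #|T 3|; set j := #|T 2|; set k := #|_ :&: _|; set l := #|_ :\: _|.
lia.
Qed.

(** For one component [R], [bond_euler] gives [4 * #|R| <= 4 + 2 * (cnt 2 R + cnt 3 R)], and
    [component_cnt1] bounds the 4 by [cnt 1 R]. The faces at a vertex are pairwise adjacent, so no
    vertex meets two components and the bounds add up. *)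
Lemma euler_complement Q : conn Q -> Q != set0 -> 8 <= 3 * cnt 3 Q + cnt 2 Q ->
  4 * #|~: Q| <= 2 * cnt 3 (~: Q) + 2 * cnt 2 (~: Q) + cnt 1 (~: Q).
Proof.
move=> cQ Q0 cQ8.
(* [W] ranges over unions of components, one of which is split off in each step. *)
suff H n W : #|W| < n -> W \subset ~: Q ->
    (forall a b, a \in W -> b \in ~: Q -> dadj a b -> b \in W) ->
    4 * #|W| <= 2 * cnt 3 W + 2 * cnt 2 W + cnt 1 W.
  by apply: (H #|~: Q|.+1).
elim: n W => // n IHn W ltW WQ closed.
have [->|/set0Pn[p pW]] := eqVneq W set0; first by rewrite cards0.
have pC := subsetP WQ p pW; have pQ : p \notin Q by rewrite -in_setC.
have c1 := component_cnt1 cQ Q0 pQ cQ8; have bR := component_bond cQ Q0 pQ.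
set R := component (~: Q) p in c1 bR.
have pR : p \in R := mem_comp inc (~: Q) p.
have RW : R \subset W.
  suff <- : R :&: W = R by apply: subsetIr.
  have [_ _ cR _] := bR; apply: cR; first exact: subsetIl.
    by apply/set0Pn; exists p; rewrite in_setI pR.
  move=> a b; rewrite in_setI in_setD in_setI => /andP[aR aW] /andP[+ bR'].
  rewrite bR' /= => bW; apply: contra bW => ab; apply: closed aW _ ab.
  exact: (subsetP (comp_sub inc pC)).
set W2 := W :\: R.
have le_R x : inc x :&: R = set0 \/ inc x :&: W2 = set0.
  have [->|/set0Pn[a aI]] := eqVneq (inc x :&: R) set0; [by left|right].
  move: aI; rewrite in_setI => /andP[ax aR]; apply/setP => b; rewrite in_set0 in_setI in_setD.
  apply/negP => /and3P[bx bR' bW]; case/negP: (bR').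
  apply: (comp_closed pC aR (subsetP WQ b bW)); apply/dadjP; split; last by exists x.
  by apply: contraNneq bR' => <-.
have cardW x : #|inc x :&: W| = #|inc x :&: R| + #|inc x :&: W2|.
  rewrite -(cardsID R (inc x :&: W)); congr (_ + _); apply: eq_card => s.
    rewrite !in_setI; case: (boolP (s \in R)) => sR; rewrite ?andbF // (subsetP RW _ sR).
    by rewrite andbT.
  by rewrite !(in_setI, in_setD); case: (s \in inc x); case: (s \in R); rewrite ?andbF.
have add i : 0 < i -> cnt i R + cnt i W2 <= cnt i W.
  move=> i0; rewrite /cnt -cardsUI (_ : _ :&: _ = set0) ?cards0 ?addn0; last first.
    apply/setP => x; rewrite in_setI !in_set; apply/negP => /andP[/eqP e1 /eqP e2].
    case: (le_R x) => e0; move: e1 e2; rewrite e0 cards0 => e1 e2.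
      by rewrite -e1 in i0.
    by rewrite -e2 in i0.
  apply/subset_leq_card/subsetP => x; rewrite in_setU !in_set cardW.
  case: (le_R x) => ->; rewrite cards0 ?addn0 ?add0n.
    by case/orP=> // /eqP i_0; rewrite -i_0 in i0.
  by case/orP=> // /eqP i_0; rewrite -i_0 in i0.
have cW : #|W| = #|R| + #|W2| by rewrite -(cardsID R W) (setIidPr RW).
have R0 : 0 < #|R| by apply/card_gt0P; exists p.
have IH : 4 * #|W2| <= 2 * cnt 3 W2 + 2 * cnt 2 W2 + cnt 1 W2.
  apply: IHn.
  - by move: ltW R0; rewrite cW; set i := #|R|; set j := #|W2|; lia.
  - exact: subset_trans (subsetDl _ _) WQ.
  move=> a b; rewrite !in_setD => /andP[aR aW] bC ab; rewrite (closed a b) // andbT.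
  apply: contra aR => bR'; apply: (comp_closed pC bR' (subsetP WQ a aW)).
  by rewrite dadjC.
have := bond_euler bR; rewrite card_gt1_cnt => eR.
have := add 1 isT; have := add 2 isT; have := add 3 isT.
move: IH c1 eR; rewrite cW; set i := #|R|; set j := #|W2|.
by move: (cnt 1 W) (cnt 2 W) (cnt 3 W) (cnt 1 R) (cnt 2 R) (cnt 3 R) (cnt 1 W2) (cnt 2 W2) (cnt 3 W2); lia.
Qed.

(** Twice [euler] minus the bound for the complement, whose counts [cntC] turns into counts for
    [Q]. *)
Lemma euler_lower Q : conn Q -> Q != set0 -> 8 <= 3 * cnt 3 Q + cnt 2 Q ->
  8 + 2 * cnt 3 Q + cnt 2 Q <= 4 * #|Q|.
Proof.
move=> cQ Q0 cQ8; have := euler_complement cQ Q0 cQ8.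
rewrite !cntC // !subSS !subn0; have := euler; rewrite (card_vertices Q) -(cardsC Q).
move: #|Q| #|~: Q| (cnt 0 Q) (cnt 1 Q) (cnt 2 Q) (cnt 3 Q).
by move=> a b c0 c1 c2 c3; rewrite ?subnn; lia.
Qed.

End Counting.

(** * Discharging *)

Section Trees.
Variables (Y : sgraph) (F : finType) (inc : Y -> {set F}).
Implicit Types (D S R O Q W J : {set F}) (p q v w : F) (x y : Y) (c : seq Y).
Local Notation dadj := (dadj inc).
Local Notation conn := (conn inc).
Local Notation bond := (bond inc).
Local Notation fdeg := (fdeg inc).
Local Notation len := (len inc).
Local Notation nbf := (nbf inc).
Local Notation component := (component inc).
Local Notation link := (link inc).
Local Notation cnt := (cnt inc).
Hypothesis M : dual_map inc.
Let card_inc := dm_card_inc M.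
Let inc_face := dm_inc_face M.
Let connC_small := dm_connC_small M.
Hypothesis fdeg_ge4 : forall p, 4 <= fdeg p.

Lemma grow D p q : bond D -> p \notin D -> nbf p :&: D = [set q] ->
  ~: (p |: D) != set0 -> bond (p |: D) /\ len D + 2 <= len (p |: D).
Proof.
move=> bD pD nb W0; split; first exact: (bond_add M bD pD nb W0).
have := len_add card_inc (card_pair M) pD nb; have := fdeg_ge4 p; lia.
Qed.

(** The leaves are attached one at a time, each touching only the centre; the face [o] keeps the
    complement nonempty. *)
Lemma star_bond p J o : {in J, forall q, dadj p q} ->
  {in J &, forall q r, ~~ dadj q r} -> o \notin p |: J ->
  bond (p |: J) /\ fdeg p + 2 * #|J| <= len (p |: J).
Proof.
have [n] := ubnP #|J|; elim: n J => // n IHn J ltJ pJ indep oJ.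
have [J0|/set0Pn[j jJ]] := eqVneq J set0.
  by rewrite J0 setU0 cards0 muln0 addn0 (len1 card_inc); split=> //; apply: bond1.
pose J' := J :\ j; have sJ : J' \subset J by apply: subD1set.
have cJ : #|J| = #|J'|.+1 by rewrite (cardsD1 j) jJ.
have [||||b' l'] := IHn J'; first by rewrite cJ in ltJ.
- by move=> q /(subsetP sJ); apply: pJ.
- by move=> q r /(subsetP sJ) qJ /(subsetP sJ); apply: indep.
- by apply: contra oJ; apply/subsetP/setUS.
have eqJ : p |: J = j |: (p |: J') by rewrite setUCA setD1K.
have jp : j != p by rewrite eq_sym (dadj_neq (pJ j jJ)).
have [|||b l] := @grow (p |: J') j p b'.
- by rewrite !inE negb_or jp eqxx.
- apply/setP => q; rewrite !inE; apply/andP/eqP => [[jq /orP[/eqP//|/andP[_ qJ]]]|->].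
    by have := indep j q jJ qJ; rewrite jq.
  by rewrite dadjC pJ // eqxx.
- by rewrite -eqJ; apply/set0Pn; exists o; rewrite inE.
rewrite -eqJ in b l; split=> //.
by apply: leq_trans l; rewrite cJ mulnS addnCA addnC leq_add2r.
Qed.

Definition arc (out : Y -> F) c x m : {set F} := [set out (iter (i : 'I_m) (next c) x) | i : 'I_m].

Lemma mem_arc (out : Y -> F) c x m q :
  reflect (exists2 i, i < m & q = out (iter i (next c) x)) (q \in arc out c x m).
Proof.
apply: (iffP imsetP) => [[i _ ->]|[i im ->]]; first by exists i.
by exists (Ordinal im).
Qed.

(** By [link_adj] the next face of the link touches only its predecessor, as long as the arc does
    not close up. The first face gives length 4, each further one at least 2. *)
Lemma arc_bond p c out x m : link p c out -> x \in c -> 0 < m < fdeg p ->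
  bond (arc out c x m) /\ 2 * m + 2 <= len (arc out c x m).
Proof.
move=> lk xc; have [cc mc incn inj nbP] := lk.
have yc i : iter i (next c) x \in c by rewrite mem_iter_next.
elim: m => // m IHm /andP[_ ltm].
have [m0|m0] := posnP m.
  have -> : arc out c x m.+1 = [set out x].
    apply/setP => q; rewrite inE m0; apply/mem_arc/eqP => [[i]|->]; last by exists 0.
    by rewrite ltnS leqn0 => /eqP-> ->.
  by rewrite m0 (len1 card_inc); split; [apply: bond1 | apply: fdeg_ge4].
have [|b' l'] := IHm; first by rewrite m0 ltnW.
have arcS : arc out c x m.+1 = out (iter m (next c) x) |: arc out c x m.
  apply/setP => q; rewrite !inE; apply/mem_arc/orP => [[i]|[/eqP->|/mem_arc[i im ->]]].
  - rewrite ltnS leq_eqVlt => /orP[/eqP->|im] ->; [by left|right].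
    by apply/mem_arc; exists i.
  - by exists m.
  - by exists i => //; apply: ltnW.
have iter_eq i j : i < fdeg p -> j < fdeg p ->
   iter i (next c) x = iter j (next c) x -> i = j := iter_next_inj lk xc.
have [|||b l] := @grow (arc out c x m) (out (iter m (next c) x))
    (out (iter m.-1 (next c) x)) b'.
- apply/mem_arc => -[i im] /inj ei; have := iter_eq m i (ltnW ltm) (ltn_trans im (ltnW ltm)).
  by rewrite ei ?yc // => /(_ erefl) eim; rewrite eim ltnn in im.
- apply/setP => q; rewrite in_setI !in_set1 inE; apply/andP/eqP => [[yq /mem_arc[i im eq]]|->].
    have adj_i : dadj (out (iter m (next c) x)) (out (iter i (next c) x)) by rewrite -eq.
    have [e1|e1] := link_adj M lk (yc m) (yc i) adj_i.
      have := iter_eq i m.+1 (ltn_trans im (ltnW ltm)) ltm e1; lia.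
    have := iter_eq m i.+1 (ltnW ltm) (leq_ltn_trans im (ltnW ltm)) e1.
    by move=> mi; rewrite eq mi.
  split; last by apply/mem_arc; exists m.-1; rewrite // ltn_predL.
  have := link_next lk (yc m.-1); rewrite -iterS prednK // dadjC.
  by [].
- apply/set0Pn; exists p; rewrite inE -arcS; apply/mem_arc => -[i _ ep].
  by have [] := incn _ (yc i); rewrite -ep eqxx.
rewrite arcS; split=> //.
by apply: leq_trans l; rewrite mulnS -addnA addnC leq_add2r.
Qed.

End Trees.

(** With [t = d - g] the claim reads [12 <= 2 * d + g]. If [d < 6], three gaps would give only
    [f <= 5 + 3 * (k - 2) < 3 * k]; so [g], and with it [d], is at least 4. *)
Lemma huge_charge k t d g f : 2 <= k -> t <= d -> 3 * k < f -> t + g = d ->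
  f <= d + g * (k - 2) -> 12 + t <= 3 * d /\ 4 <= d.
Proof.
move=> k2 td fv eqg le_f; have [d6|d6] := leqP 6 d; first by lia.
have g4 : 4 <= g.
  rewrite leqNgt; apply/negP => g3; have : g * (k - 2) <= 3 * (k - 2) by rewrite leq_mul2r; lia.
  lia.
lia.
Qed.

(** Adding the last two bounds gives [i1 + i2 <= 2 * k - 1 - f], hence [d >= 2 * (f - k) >= 8]. *)
Lemma star_charge k t d i1 i2 f m : m.+1 = f -> m <= i1 + i2 + d -> t <= d -> k + 4 <= f ->
  f + 2 * i2 < 2 * k -> f + 2 * i1 < 2 * k -> 12 + t <= 3 * d /\ 4 <= d.
Proof. lia. Qed.

(** It remains to see [1 + t + 2 * a + (a < d) <= 3 * d]. If [t < d], the missing triangle pays for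
    the 1; if [t = d], then [a <= 3 < d] leaves room. *)
Lemma corner_charge a t d : a <= d -> 2 <= a <= 3 -> t <= d ->
  (0 < d -> t = d -> 4 <= d) -> 12 + t + 2 * a + (a < d) <= 3 * d + 11.
Proof.
move=> ad /andP[a2 a3] td teq; have [t_d|t_d] := eqVneq t d.
  have d4 : 4 <= d by apply: teq => //; lia.
  by case: (ltnP a d) => /=; lia.
by case: (ltnP a d) => /= h; move/eqP: t_d => t_d; lia.
Qed.

Section Contradiction.
Variables (Y : sgraph) (F : finType) (inc : Y -> {set F}).
Implicit Types (D S R Q W J : {set F}) (p q v w b : F) (x y : Y) (c : seq Y).
Local Notation dadj := (dadj inc).
Local Notation conn := (conn inc).
Local Notation bond := (bond inc).
Local Notation fdeg := (fdeg inc).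
Local Notation len := (len inc).
Local Notation nbf := (nbf inc).
Local Notation component := (component inc).
Local Notation link := (link inc).
Local Notation cnt := (cnt inc).
Hypothesis M : dual_map inc.
Let card_inc := dm_card_inc M.
Let inc_face := dm_inc_face M.
Let connC_small := dm_connC_small M.
Hypothesis Ycubic : cubic Y.
Hypothesis Yc4 : cyclically_4_edge_connected Y.
Hypothesis fdeg_ge4 : forall p, 4 <= fdeg p.
Hypothesis euler : #|Y| + 4 <= 2 * #|F|.
Variables (u1 u2 : Y).
Hypothesis u12 : adj u1 u2.
Variable k : nat.
Hypothesis k_ge2 : 2 <= k.
Let O := inc u1 :|: inc u2.
Hypothesis gap : forall D, bond D -> O \subset ~: D -> 2 * k <= len D -> 3 * k < len D.

Lemma heavy D : bond D -> O \subset ~: D -> 2 * k <= len D ->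
  (exists2 p, p \in D & 3 * k < fdeg p) \/
  exists p q, [/\ p \in D, q \in D, p != q, k + 4 <= fdeg p & k + 4 <= fdeg q].
Proof.
have [n] := ubnP #|D|; elim: n D => // n IHn D ltD bD OD lenD.
have lenD3 := gap bD OD lenD.
have [D1|D1] := leqP #|D| 1.
  have [D0 _ _ _] := bD; have /cards1P[p eD] : #|D| == 1.
    by rewrite eqn_leq D1 card_gt0.
  by left; exists p; rewrite ?eD ?inE // -(len1 card_inc) -eD.
have [D0 _ _ _] := bD; case/set0Pn: D0 => p0 p0D.
(* The constant is [(3 * k + 1) + 2 - (2 * k - 1) = k + 4]. *)
have rem v q : v \in D -> bond (D :\ v) -> q \in D :\ v -> dadj v q ->
    2 * k <= len (D :\ v) \/ k + 4 <= fdeg v.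
  move=> vD bDv qD vq; have := len_rem (card_pair M) vD qD vq; lia.
have smaller v : v \in D -> bond (D :\ v) -> 2 * k <= len (D :\ v) ->
  (exists2 p, p \in D & 3 * k < fdeg p) \/
  exists p q, [/\ p \in D, q \in D, p != q, k + 4 <= fdeg p & k + 4 <= fdeg q].
  move=> vD bDv lenDv; have sD : D :\ v \subset D by apply: subD1set.
  have [||||[p pD hp]|[p [q [pD qD pq hp hq]]]] := IHn (D :\ v) => //.
  - by move: ltD; rewrite (cardsD1 v) vD.
  - by apply: subset_trans OD _; rewrite setCS.
  - by left; exists p; rewrite ?(subsetP sD).
  - by right; exists p, q; rewrite !(subsetP sD).
have [v [vD _ bDv [q qD vq] _]] := removable connC_small bD p0D D1.
have [lv|hv] := rem v q vD bDv qD vq; first exact: (smaller v).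
have [w [wD wv bDw [r rD wr] _]] := removable connC_small bD vD D1.
have [lw|hw] := rem w r wD bDw rD wr; first exact: (smaller w).
by right; exists w, v.
Qed.

Definition big p := (p \notin O) && (k + 4 <= fdeg p).

Lemma notO D p : O \subset ~: D -> p \in D -> p \notin O.
Proof. by move=> /subsetP sO pD; apply/negP => /sO; rewrite inE pD. Qed.

Lemma small_len D : bond D -> O \subset ~: D -> {in D, forall p, ~~ big p} -> len D < 2 * k.
Proof.
move=> bD OD small; rewrite ltnNge; apply/negP => /(heavy bD OD).
case=> [[p pD hp]|[p [q [pD _ _ hp _]]]]; have := small p pD;
  by rewrite /big (notO OD pD) /= => /negP[]; lia.
Qed.

Lemma one_big_len D b : bond D -> O \subset ~: D -> fdeg b < 2 * k ->
  (forall p, p \in D -> p != b -> ~~ big p) -> len D < 2 * k.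
Proof.
move=> bD OD hb small; rewrite ltnNge; apply/negP => /(heavy bD OD).
case=> [[p pD hp]|[p [q [pD qD pq hp hq]]]].
  have [pb|pb] := eqVneq p b; first by move: hp hb; rewrite pb; lia.
  by have := small p pD pb; rewrite /big (notO OD pD) /= => /negP[]; lia.
have [pb|pb] := eqVneq p b; last by have := small p pD pb; rewrite /big (notO OD pD) hp.
have qb : q != b by rewrite -pb eq_sym.
by have := small q qD qb; rewrite /big (notO OD qD) hq.
Qed.

Let B' := O :|: [set p | big p].

Definition tri Q v := #|[set x | (v \in inc x) && (inc x \subset Q)]|.

Lemma tri_le Q v : v \in Q -> tri Q v <= #|nbf v :&: Q|.
Proof.
move=> vQ; have [c [out lk]] := exists_link M v.
by rewrite /tri (card_link_triangles lk vQ) (card_link_nbf lk Q) subset_leq_card // subsetIl.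
Qed.

(** Equality means that the link of [v] never leaves [Q], so all [fdeg v] neighbours are counted. *)
Lemma tri_eq Q v : v \in Q -> 0 < #|nbf v :&: Q| -> tri Q v = #|nbf v :&: Q| ->
  4 <= #|nbf v :&: Q|.
Proof.
move=> vQ; have [c [out lk]] := exists_link M v.
rewrite /tri (card_link_triangles lk vQ) (card_link_nbf lk Q); set A := [set x in c | _].
set B := [set x in c | _] => A0 eqAB.
have sAB : A \subset B.
  by apply/setIidPl/eqP; rewrite eqEcard subsetIl eqAB leqnn.
have allQ := link_invariant lk sAB; rewrite -card_gt0 in allQ.
apply: leq_trans (fdeg_ge4 v) _; rewrite -(link_size lk).
have [cc _ _ _ _] := lk; have [/andP[_ uc] _] := cc.
rewrite -(card_uniqP uc); apply/subset_leq_card/subsetP => x xc.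
by rewrite inE xc (allQ A0 x xc).
Qed.

(** * Charges on the component of a big face *)

Section Component.
Variable b : F.
Hypothesis bB : big b.
Let Q := component B' b.
Let bB' : b \in B'. Proof. by rewrite !inE bB orbT. Qed.
Let QB : Q \subset B'. Proof. exact: comp_sub. Qed.
Let bQ : b \in Q. Proof. exact: mem_comp. Qed.
Let cQ : conn Q. Proof. exact: comp_conn. Qed.

Lemma out_Q v w : v \in Q -> dadj v w -> w \notin Q -> (w \notin O) && ~~ big w.
Proof.
move=> vQ vw wQ; have : w \notin B'.
  by apply: contra wQ => wB; apply: (comp_closed bB' vQ wB vw).
by rewrite !in_setU in_set negb_or.
Qed.

(** Otherwise [k - 1] consecutive neighbours outside [Q] form an arc without big faces, a bond of
    length at least [2 * (k - 1) + 2 = 2 * k]. *)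
Lemma big_runs v c out x : v \in Q -> v \notin O -> link v c out -> x \in c ->
  exists2 i, i <= k - 2 & out (iter i (next c) x) \in Q.
Proof.
move=> vQ vO lk xc.
have pred_le i : i < k - 1 -> i <= k - 2 by move: k_ge2; clear; lia.
have arc_le f : k + 4 <= f -> 0 < k - 1 < f by move: k_ge2; clear; lia.
have bv : big v by have := subsetP QB v vQ; rewrite in_setU in_set (negbTE vO).
have hv : k + 4 <= fdeg v by case/andP: bv.
case: (boolP [exists i : 'I_(k - 1), out (iter i (next c) x) \in Q]) => [/existsP[i iQ]|].
  by exists i => //; apply: pred_le; apply: ltn_ord.
rewrite negb_exists => /forallP none.
have small q : q \in arc out c x (k - 1) -> (q \notin O) && ~~ big q.
  case/mem_arc => i im ->; apply: (out_Q vQ); last by have := none (Ordinal im).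
  by apply: (link_out lk); rewrite mem_iter_next.
have [|bA lA] := @arc_bond _ _ _ M fdeg_ge4 v c out x (k - 1) lk xc.
  exact: arc_le hv.
have OA : O \subset ~: arc out c x (k - 1).
  apply/subsetP => o oO; rewrite in_setC; apply/negP => /small.
  by rewrite oO.
have := small_len bA OA (fun q qA => proj2 (andP (small q qA))).
by rewrite ltnNge (leq_trans _ lA) // mulnBr muln1 subnK // leq_pmulr // ltnW.
Qed.

Lemma charge_big v : v \in Q -> v \notin O ->
  12 + tri Q v <= 3 * #|nbf v :&: Q| /\ 4 <= #|nbf v :&: Q|.
Proof.
move=> vQ vO; have bv : big v by have := subsetP QB v vQ; rewrite in_setU in_set (negbTE vO).
have hv : k + 4 <= fdeg v by case/andP: bv.
have tle := tri_le vQ.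
have [c [out lk]] := exists_link M v; have [cc mc incn inj nbP] := lk.
(* A face is itself a bond, so [gap] leaves only lengths below [2 * k], treated by stars, and above
   [3 * k], treated by arcs. *)
have [huge|nhuge] := leqP (2 * k) (fdeg v).
  have fv : 3 * k < fdeg v.
    rewrite -(len1 card_inc); apply: gap; [exact: bond1 | | by rewrite (len1 card_inc)].
    by apply/subsetP => o oO; rewrite !inE; apply: contraNneq vO => <-.
  have := link_runs lk (fun x xc => big_runs vQ vO lk xc).
  have := card_link_nbf lk Q; have := card_link_triangles lk vQ; rewrite -/(tri Q v).
  set A := [set x in c | out x \in Q]; set B := [set x in c | _] => eqt eqd.
  have : #|A :&: B| + #|B :\: A| = #|A|.
    by rewrite setIC -(card_link_B lk Q) -/B -(cardsID A B).
  rewrite -eqt -eqd => eqg le_f.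
  exact: huge_charge k_ge2 tle fv eqg le_f.
have [x0 x0c] : exists x0, x0 \in c.
  by case: (c) cc => [[//]|x0 s] _; exists x0; rewrite mem_head.
pose y i := iter i (next c) x0; have yc i : y i \in c by rewrite mem_iter_next.
(* One position of the link is left out, so that positions of equal parity are never cyclically
   consecutive, even if [fdeg v] is odd. *)
pose n := (fdeg v).-1.
have nf : n < fdeg v by rewrite ltn_predL; apply: leq_trans (fdeg_ge4 v).
pose I par := [set i : 'I_n | (odd i == par) && (out (y i) \notin Q)].
pose J par := [set out (y i) | i : 'I_n in I par].
have cJ par : #|J par| = #|I par|.
  apply: card_in_imset => i j _ _ /inj eij; apply/val_inj.
  by apply: (iter_next_inj lk x0c (ltn_trans (ltn_ord i) nf) (ltn_trans (ltn_ord j) nf)); exact: eij.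
have cI : n <= #|I true| + #|I false| + #|nbf v :&: Q|.
  have inj_y : {in [set i : 'I_n | out (y i) \in Q] &, injective (fun i : 'I_n => out (y i))}.
    move=> i j _ _ /inj eij; apply/val_inj.
    by apply: (iter_next_inj lk x0c (ltn_trans (ltn_ord i) nf) (ltn_trans (ltn_ord j) nf)); exact: eij.
  have inQ : #|[set i : 'I_n | out (y i) \in Q]| <= #|nbf v :&: Q|.
    rewrite -(card_in_imset inj_y); apply/subset_leq_card/subsetP => _ /imsetP[i + ->].
    by rewrite in_set => iQ; rewrite in_setI iQ andbT in_set; apply: (link_out lk).
  apply: leq_trans (leq_add (leqnn _) inQ); rewrite -[leqLHS]card_ord -cardsT.
  apply: leq_trans (leq_trans (leq_card_setU _ _) (leq_add (leq_card_setU (I true) (I false)) (leqnn _))).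
  apply/subset_leq_card/subsetP => i _; rewrite !in_setU.
  have mS : (i \in [set j : 'I_n | out (y j) \in Q]) = (out (y i) \in Q) by rewrite in_set.
  have mI par : (i \in I par) = (odd i == par) && (out (y i) \notin Q) by rewrite in_set.
  by rewrite mS !mI; case: (_ \in Q); case: (odd i).
have star par : fdeg v + 2 * #|I par| < 2 * k.
  have Jout q : q \in J par -> [/\ dadj v q, q \notin O & ~~ big q].
    case/imsetP => i; rewrite in_set => /andP[_ iQ] ->.
    have vi : dadj v (out (y i)) by apply: (link_out lk).
    by have /andP[? ?] := out_Q vQ vi iQ.
  have OJ : O \subset ~: (v |: J par).
    apply/subsetP => o oO; rewrite in_setC in_setU1 negb_or; apply/andP; split.
      by apply: contraNneq vO => <-.
    by apply/negP => /Jout[_]; rewrite oO.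
  have [o oO] : exists o, o \in O by apply/set0Pn; rewrite -card_gt0; apply: leq_trans (subset_leq_card (subsetUl _ _)); rewrite card_inc.
  have oJ : o \notin v |: J par by have := subsetP OJ o oO; rewrite in_setC.
  have [||bJ lJ] := @star_bond _ _ _ M fdeg_ge4 v (J par) o _ _ oJ.
  - by move=> q /Jout[].
  - move=> q r /imsetP[i + ->] /imsetP[j + ->].
    rewrite in_set => /andP[/eqP oi _]; rewrite in_set => /andP[/eqP oj _]; apply/negP => ij.
    have [e1|e1] := link_adj M lk (yc i) (yc j) ij.
      have := iter_next_inj lk x0c (j := i.+1) (ltn_trans (ltn_ord j) nf) (leq_ltn_trans (ltn_ord i) nf) e1.
      move=> eji; move: oj; rewrite eji /= oi; by case: (par).
    have := iter_next_inj lk x0c (j := j.+1) (ltn_trans (ltn_ord i) nf) (leq_ltn_trans (ltn_ord j) nf) e1.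
    move=> eij; move: oi; rewrite eij /= oj; by case: (par).
  rewrite cJ in lJ; apply: leq_ltn_trans lJ _.
  apply: (one_big_len bJ OJ nhuge) => q; rewrite in_setU1 => /orP[/eqP->|/Jout[]//].
  by rewrite eqxx.
have nE : n.+1 = fdeg v by apply: prednK; apply: leq_trans (fdeg_ge4 v).
exact: (star_charge nE cI tle hv (star false) (star true)).
Qed.

(** The face [b] has at least four neighbours in [Q], and each of them counts [b] in return. *)
Lemma degree_sum_ge8 : 8 <= 3 * cnt 3 Q + cnt 2 Q.
Proof.
have bO : b \notin O by case/andP: bB.
have [_ d4] := charge_big bQ bO.
rewrite -(sum_degrees M Q) (big_setD1 b bQ) /=.
have le1 v : v \in Q :\ b -> (v \in nbf b) <= #|nbf v :&: Q|.
  move=> _; case: (boolP (v \in nbf b)) => // vb; rewrite card_gt0.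
  by apply/set0Pn; exists b; rewrite in_setI bQ andbT in_set dadjC; move: vb; rewrite in_set.
have : \sum_(v in Q :\ b) (v \in nbf b) <= \sum_(v in Q :\ b) #|nbf v :&: Q|.
  by apply: leq_sum.
rewrite -cardI_sum => le_s.
have eqI : (Q :\ b) :&: nbf b = nbf b :&: Q.
  apply/setP => v; rewrite !in_setI in_setD1 andbC; case: (eqVneq v b) => [->|_] //=.
  by rewrite in_set dadj_irr.
rewrite eqI in le_s; exact: (leq_add d4 (leq_trans d4 le_s)).
Qed.

(** Three times [euler_lower], with the counts rewritten as sums over [Q]. *)
Lemma charge_total :
  24 + \sum_(v in Q) 3 * #|nbf v :&: Q| <= \sum_(v in Q) (12 + tri Q v).
Proof.
have Q0 : Q != set0 by apply/set0Pn; exists b.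
have := euler_lower M Ycubic Yc4 fdeg_ge4 euler cQ Q0 degree_sum_ge8.
have -> : \sum_(v in Q) (12 + tri Q v) = #|Q| * 12 + 3 * cnt 3 Q.
  by rewrite -(sum_triangles M Q) -sum_nat_const -big_split.
have -> : \sum_(v in Q) 3 * #|nbf v :&: Q| = 3 * (3 * cnt 3 Q + cnt 2 Q).
  by rewrite -(sum_degrees M Q) big_distrr.
by move: #|Q| (cnt 3 Q) (cnt 2 Q) => m c3 c2; clear; lia.
Qed.

Lemma corner_meets_Q : exists o, (o \in O) && (o \in Q).
Proof.
apply/existsP; apply: contraT; rewrite negb_exists => /forallP none.
have := charge_total; rewrite leqNgt => /negP[]; rewrite ltnS.
apply: (@leq_trans (\sum_(v in Q) 3 * #|nbf v :&: Q|)).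
  by apply: leq_sum => v vQ; have [] := charge_big vQ (_ : v \notin O) => //; have := none v; rewrite vQ andbT.
by apply: leq_trans (leq_addl 23 _) _; rewrite addSn.
Qed.

(** The faces at [u1] are pairwise adjacent, so are those at [u2], and the two triples overlap; one
    face of [O] in [Q] therefore brings in the others. *)
Lemma corners_sub_Q : O \subset Q.
Proof.
have [o /andP[oO oQ]] := corner_meets_Q.
have spread x : inc x \subset O -> forall s t, s \in inc x -> t \in inc x -> s \in Q -> t \in Q.
  move=> xO s t sx tx sQ; have [<- //|st] := eqVneq s t.
  apply: (comp_closed bB' sQ); first by rewrite in_setU (subsetP xO).
  by apply/dadjP; split=> //; exists x.
have s1 := spread u1 (subsetUl _ _); have s2 := spread u2 (subsetUr _ _).
have [a] : exists a, a \in inc u1 :&: inc u2.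
  by apply/set0Pn; rewrite -card_gt0 (dm_card_incI M u12).
rewrite in_setI => /andP[a1 a2].
have aQ : a \in Q.
  by move: oO; rewrite in_setU => /orP[o1|o2]; [apply: (s1 o)|apply: (s2 o)].
by apply/subsetP => t; rewrite in_setU => /orP[t1|t2]; [apply: (s1 a)|apply: (s2 a)].
Qed.

(** The degree of [o] in the two triangles [inc u1] and [inc u2], which share an edge of T. *)
Let corner_deg o := if o \in inc u1 :&: inc u2 then 3 else 2.

Lemma card_corners : #|O| = 4.
Proof. by rewrite cardsU !card_inc (dm_card_incI M u12). Qed.

Lemma corner_deg_le o : o \in O -> corner_deg o <= #|nbf o :&: O|.
Proof.
move=> oO; have nb x : o \in inc x -> inc x \subset O -> inc x :\ o \subset nbf o :&: O.
  move=> ox xO; apply/subsetP => s; rewrite in_setD1 => /andP[so sx].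
  rewrite in_setI (subsetP xO _ sx) andbT in_set; apply/dadjP.
  by split; [rewrite eq_sym|exists x].
have n1 o1 := nb u1 o1 (subsetUl _ _); have n2 o2 := nb u2 o2 (subsetUr _ _).
have card2 x : o \in inc x -> #|inc x :\ o| = 2.
  by move=> ox; have := cardsD1 o (inc x); rewrite ox card_inc => -[].
rewrite /corner_deg in_setI; case: (boolP (o \in inc u1)) => o1; last first.
  have o2 : o \in inc u2 by move: oO; rewrite in_setU (negbTE o1).
  by rewrite /= -(card2 _ o2) subset_leq_card // n2.
case: (boolP (o \in inc u2)) => o2 /=; last by rewrite -(card2 _ o1) subset_leq_card // n1.
have -> : 3 = #|O :\ o| by have := cardsD1 o O; rewrite oO card_corners => -[].
apply: subset_leq_card; apply/subsetP => s; rewrite in_setD1 in_setU => /andP[so].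
by case/orP=> sx; [apply: (subsetP (n1 o1))|apply: (subsetP (n2 o2))]; rewrite in_setD1 so.
Qed.

Lemma charge_corner o : o \in O ->
  (12 + tri Q o) + 2 * corner_deg o + (corner_deg o < #|nbf o :&: Q|) <=
  3 * #|nbf o :&: Q| + 11.
Proof.
move=> oO; have oQ := subsetP corners_sub_Q o oO.
have le_d : corner_deg o <= #|nbf o :&: Q|.
  by apply: leq_trans (corner_deg_le oO) _; apply/subset_leq_card/setIS/corners_sub_Q.
have a23 : 2 <= corner_deg o <= 3 by rewrite /corner_deg; case: ifP.
have tle := tri_le oQ; have teq := @tri_eq Q o oQ.
move: le_d a23 tle teq; move: (corner_deg o) (tri Q o) #|nbf o :&: Q|.
exact: corner_charge.
Qed.

Lemma no_big_component : False.
Proof.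
have bO : b \notin O by case/andP: bB.
(* [Q] is connected and contains [b] outside [O], so an edge of T[Q] leaves [O]; it makes one corner
   inequality strict. *)
have [o [w [oO wQ wO ow]]] : exists o w, [/\ o \in O, w \in Q, w \notin O & dadj o w].
  case: (boolP [exists o, exists w, [&& o \in O, w \in Q, w \notin O & dadj o w]]).
    by case/existsP => o /existsP[w /and4P[? ? ? ?]]; exists o, w.
  rewrite negb_exists => /forallP none; case/negP: bO.
  suff -> : O = Q by exact: bQ.
  apply: cQ; [exact: corners_sub_Q | by rewrite -card_gt0 card_corners |].
  move=> s t sO; rewrite in_setD => /andP[tO tQ]; apply/negP => st.
  by have := none s; rewrite negb_exists => /forallP/(_ t); rewrite sO tQ tO st.
have strict : corner_deg o < #|nbf o :&: Q|.
  apply: leq_ltn_trans (corner_deg_le oO) _; apply: proper_card; rewrite properE.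
  rewrite (setIS _ corners_sub_Q) /=; apply/subsetPn; exists w.
    by rewrite in_setI wQ andbT in_set.
  by rewrite in_setI (negbTE wO) andbF.
have := charge_total; rewrite !(big_setID (A := Q) O) /= (setIidPr corners_sub_Q).
have outer : \sum_(v in Q :\: O) (12 + tri Q v) <= \sum_(v in Q :\: O) 3 * #|nbf v :&: Q|.
  by apply: leq_sum => v; rewrite in_setD => /andP[vO vQ]; have [] := charge_big vQ vO.
(* The four faces give [4 * 11 = 44], and [corner_deg] sums to [3 + 3 + 2 + 2 = 10]; so the charges
   over [O] are at most [44 - 20 - 1 = 23]. *)
have inner : \sum_(v in O) (12 + tri Q v) + \sum_(v in O) 2 * corner_deg v + 1 <=
    \sum_(v in O) 3 * #|nbf v :&: Q| + 44.
  have -> : 44 = \sum_(v in O) 11 by rewrite sum_nat_const card_corners.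
  have le_o : 1 <= \sum_(v in O) (corner_deg v < #|nbf v :&: Q|).
    by rewrite (big_setD1 o oO) /= strict.
  apply: leq_trans (leq_add (leqnn _) le_o) _; rewrite -!big_split /=.
  by apply: leq_sum => v vO; exact: charge_corner.
have corner_sum : \sum_(v in O) 2 * corner_deg v = 20.
  rewrite -big_distrr /= (eq_bigr (fun v => 2 + (v \in inc u1 :&: inc u2))); last first.
    by move=> v _; rewrite /corner_deg; case: ifP.
  rewrite big_split /= sum_nat_const card_corners -cardI_sum.
  rewrite (setIidPr _) ?(dm_card_incI M u12) //.
  by apply: subset_trans (subsetIl _ _) (subsetUl _ _).
rewrite corner_sum in inner; move: inner outer.
set s1 := \sum_(v in O) _; set s2 := \sum_(v in O) _.
set s3 := \sum_(v in _) _; set s4 := \sum_(v in _) _.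
by move: s1 s2 s3 s4; clear; lia.
Qed.

End Component.

Theorem no_long_bond D : bond D -> O \subset ~: D -> len D < 2 * k.
Proof.
move=> bD OD; rewrite ltnNge; apply/negP => lenD.
have [[p pD hp]|[p [q [pD _ _ hp _]]]] := heavy bD OD lenD.
  apply: (@no_big_component p); rewrite /big (notO OD pD) /=; lia.
by apply: (@no_big_component p); rewrite /big (notO OD pD).
Qed.

End Contradiction.

(** * From bonds of the dual back to cycles of H *)

Lemma faces_dual_map (Y : sgraph) (face : Y -> Y -> {set {set {set Y}}}) :
  cubic Y -> cyclically_4_edge_connected Y ->
  (forall z x y a b, z \in evens Y -> nb3 x y a b ->
    (z \in face x a) (+) (z \in face x b) = ([set x; y] \in z)) ->
  (forall x y a1 a2 b1 b2, nb3 x y a1 a2 -> nb3 y x b1 b2 ->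
    face x a1 = face y b1 /\ face x a2 = face y b2 \/
    face x a1 = face y b2 /\ face x a2 = face y b1) ->
  dual_map (@incf Y face).
Proof.
move=> Ycubic Yc4 flip sides; split.
- exact: (card_incf Ycubic Yc4 flip sides).
- exact: fc_inc.
- by move=> A; apply: (connC_small Ycubic Yc4 flip sides).
- move=> x p q px qx pq; have [y H] := pair_edge Ycubic flip sides px qx pq.
  exists y; split; first by case: H.
  by move=> x'; apply: (pair_common Ycubic Yc4 flip sides).
- move=> x y xy; have [p [q [pq H]]] := edge_pair Ycubic Yc4 flip sides xy.
  by rewrite (edge_faces_inc Ycubic Yc4 flip sides pq H) cards2 pq.
- by move=> p q r; apply: (triangle_inc Ycubic Yc4 flip sides).
- by move=> D; apply: (bond_cycle Ycubic Yc4 flip sides).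
Qed.

Lemma cycle_delete (Y : sgraph) (A : {set Y}) (c : seq (delete_vertices A)) :
  is_cycle c -> is_cycle (map val c : seq Y).
Proof.
case=> /andP[cyc uc] sc; split; last by rewrite size_map.
rewrite /ucycle map_inj_uniq ?uc ?andbT; last exact: val_inj.
case: c cyc {uc sc} => //= x c; rewrite -map_rcons; move: (rcons c x) => s.
by elim: s x => //= y s IHs x /andP[xy /IHs ->]; rewrite andbT.
Qed.

Lemma delete_cycle (Y : sgraph) (A : {set Y}) (c : seq Y) :
  is_cycle c -> {in c, forall x, x \notin A} ->
  exists2 c' : seq (delete_vertices A), is_cycle c' & size c' = size c.
Proof.
move=> [/andP[cyc uc] sc] cA.
have [c' def_c] : exists c' : seq (delete_vertices A), map val c' = c.
  have mem_c x : x \in c -> x \in ~: A by rewrite inE => /cA.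
  elim: c mem_c {cyc uc sc cA} => [|x c IHc] mem_c; first by exists [::].
  have [|c' <-] := IHc; first by move=> y yc; apply: mem_c; rewrite inE yc orbT.
  by exists (exist _ x (mem_c x (mem_head x c)) :: c').
exists c'; last by rewrite -def_c size_map.
move: cyc uc sc; rewrite -def_c size_map map_inj_uniq; last exact: val_inj.
move=> cyc uc sc; split=> //; rewrite /ucycle uc andbT.
case: c' cyc {def_c uc sc} => //= x c'; rewrite -map_rcons; move: (rcons c' x) => s.
by elim: s x => //= y s IHs x /andP[xy /IHs ->]; rewrite andbT.
Qed.

Theorem mainTheorem2 (R : realType) (Y : sgraph)
    (Yc4 : cyclically_4_edge_connected Y) (Ycubic : cubic Y)
    (Yplanar : planar R Y)
    (g : nat) (Yg : is_girth Y g) (g_ge4 : 4 <= g)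
    (u v : Y) (uv : adj u v)
    (H : sgraph) (HE : H = delete_vertices [set u; v])
    (k : nat) (k_ge4 : 4 <= k) (k_even : ~~ odd k)
    (l : nat) (Hl : is_circumference H l) (l_gek : k <= l) :
  exists2 c : seq H, is_cycle c & k <= size c <= (3 * k) %/ 2.
Proof.
have [pt [rho [pt_neq star]]] := Drawing.planar_shading Yplanar.
pose lt : rel (Y + {set Y}) := fun a b => (pt a < pt b)%R.
have lt_total x a b : adj x a -> adj x b -> a != b ->
    lt (inr [set x; a]) (inr [set x; b]) (+) lt (inr [set x; b]) (inr [set x; a]).
  by move=> xa xb ab; rewrite /lt; case: Order.TotalTheory.ltgtP (pt_neq x a b xa xb ab).
pose face := @face Y lt rho.
have flip z x y a b : z \in evens Y -> nb3 x y a b ->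
    (z \in face x a) (+) (z \in face x b) = ([set x; y] \in z).
  by move=> ez n3; rewrite /face !(in_set, ez) /= (kappa_flip lt rho ez n3).
have sides := face_sides Ycubic lt_total star.
pose inc := @incf Y face.
have M : dual_map inc := faces_dual_map Ycubic Yc4 flip sides.
have euler := euler_faces Ycubic Yc4 flip sides.
(* The vertices of a face form a cycle, so the girth bounds its length. *)
have fdeg4 p : 4 <= fdeg inc p.
  have [c [out lk]] := exists_link M p; rewrite -(link_size lk); case: lk => cc _ _ _ _.
  by apply: leq_trans g_ge4 _; have [_] := Yg; apply.
subst H; apply: contrapT => none.
have [K def_k] : exists K, k = 2 * K.
  by exists k./2; rewrite mul2n even_halfK.
(* A bond of length in [[2 * K, 3 * K]] away from the faces at [u] and [v] would be a cycle of H
   with length in the wanted interval. *)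
have gap (D : {set {f | f \in faces face}}) : bond inc D ->
    inc u :|: inc v \subset ~: D -> 2 * K <= len inc D ->
    3 * K < len inc D.
  move=> bD OD lenD; rewrite ltnNge; apply/negP => lenD3; apply: none.
  have [c cc mc] := dm_bond_cycle M bD.
  have [|c' cc' sc'] := @delete_cycle Y [set u; v] c cc.
    move=> x xc; apply: contraTN xc => xuv; rewrite mc /mixed negb_and; apply/orP; left.
    rewrite negbK -subset0; apply/subsetP => p; rewrite in_setI => /andP[px pD].
    have pO : p \in inc u :|: inc v.
      by move: px xuv; rewrite in_set2 in_setU => px /orP[]/eqP <-; rewrite px ?orbT.
    by have := subsetP OD p pO; rewrite in_setC pD.
  exists c' => //; rewrite sc'.
  have -> : size c = len inc D.
    have [/andP[_ uc] _] := cc.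
    by rewrite -(card_uniqP uc); apply: eq_card => x; rewrite !inE mc.
  by rewrite def_k lenD leq_divRL // mulnC; lia.
have [[c cc sc] _] := Hl; have cc' := cycle_delete cc.
have avoid x : x \in [set u; v] -> x \notin (map val c : seq Y).
  by move=> xuv; apply/mapP => -[w _ xw]; have := valP w; rewrite inE -xw xuv.
have [D [bD uD vD mD]] := cycle_bond Ycubic Yc4 flip sides cc' uv
  (avoid u (set21 _ _)) (avoid v (set22 _ _)).
have OD : inc u :|: inc v \subset ~: D by rewrite subUset uD.
have K2 : 2 <= K by move: k_ge4; rewrite def_k; clear; lia.
have := no_long_bond M Ycubic Yc4 fdeg4 euler uv K2 gap bD OD.
have -> : len inc D = size c.
  have [/andP[_ uc] _] := cc'; rewrite -(size_map val c) -(card_uniqP uc).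
  by apply: eq_card => x; rewrite !inE mD.
by rewrite sc -def_k ltnNge l_gek.
Qed.
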